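(* Let $N\ge1$ be an integer, let $D\in\mathcal{D}_{N,1}$ have a locally finite kinetic energy, and let $G\in L^2(\mathbb{R}^3\times\mathbb{R}^3)$ be such that $D=G^\dagger*G$ (a.e.) and $\nabla_2G\in L^2(\mathbb{R}^3\times\mathbb{R}^3_{\mathrm{loc}})$. Then for each $\Gamma\in\mathcal{D}_N$ with $\Gamma\mapsto D$, it holds that $\mathbf{c}_\Gamma\in L^1_{\mathrm{loc}}(\mathbb{R}^3)$ and that, for almost every $\mathbf{r}\in\mathbb{R}^3$, $$\mathbf{c}_\Gamma(\mathbf{r})=\left(-\mathrm{i}[\nabla_2G]^\dagger*G\right)(\mathbf{r},\mathbf{r})=\operatorname{diag}(-\mathrm{i}\nabla_1D)(\mathbf{r}).$$
   Context: All derivatives are weak derivatives; $\nabla_i$ is the weak gradient with respect to the $i$th argument. $L^2(\mathbb{R}^3\times\mathbb{R}^3_{\mathrm{loc}})$ is the set of functions lying in $L^2(\mathbb{R}^3\times K)$ for every compact $K\subset\mathbb{R}^3$. $\mathcal{D}_N$ is the set of (spin-free) mixed $N$-electron states $\Gamma(\mathbf{r}_{1:N},\mathbf{s}_{1:N})=\sum_ip_i\Psi_i(\mathbf{r}_{1:N})\Psi_i^*(\mathbf{s}_{1:N})$, a countable convex combination ($p_i\ge0$, $\sum_ip_i=1$) of normalized $\Psi_i\in L^2(\mathbb{R}^{3N})$, each either totally symmetric or totally antisymmetric under permutations of its $N$ arguments in $\mathbb{R}^3$. Its 1-rdm is $D_\Gamma(\mathbf{r},\mathbf{s})=N\sum_ip_i\int_{\mathbb{R}^{3N-3}}\Psi_i(\mathbf{r},\mathbf{r}_{2:N})\Psi_i^*(\mathbf{s},\mathbf{r}_{2:N})\,d\mathbf{r}_{2:N}$;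 $\Gamma\mapsto D$ means $D_\Gamma=D$ almost everywhere on $\mathbb{R}^3\times\mathbb{R}^3$. The momentum density of $\Gamma$ is $\mathbf{c}_\Gamma(\mathbf{r})=N\sum_ip_i\int_{\mathbb{R}^{3N-3}}[-\mathrm{i}\nabla_{\mathbf{r}}\Psi_i(\mathbf{r},\mathbf{r}_{2:N})]\Psi_i^*(\mathbf{r},\mathbf{r}_{2:N})\,d\mathbf{r}_{2:N}$. $\mathcal{D}_{N,1}$ (the set of 1-rdms of mixed $N$-electron states) consists of those $D\in L^2(\mathbb{R}^3\times\mathbb{R}^3)$ that are kernels of trace-class operators on $L^2(\mathbb{R}^3)$, are Hermitian ($D(\mathbf{r},\mathbf{s})=D(\mathbf{s},\mathbf{r})^*$ a.e.), satisfy $0\le\iint\phi^*(\mathbf{r})D(\mathbf{r},\mathbf{s})\phi(\mathbf{s})\,d\mathbf{r}\,d\mathbf{s}\le2\|\phi\|_2^2$ for all $\phi\in L^2(\mathbb{R}^3)$, and have $\operatorname{Tr}D=N$. $D\in\mathcal{D}_{N,1}$ has locally finite kinetic energy if the weak derivative $\nabla_1\cdot\nabla_2D$ is the kernel of a trace-class operator over $L^2(K)$ for every compact $K\subset\mathbb{R}^3$. Kernel product: $(B*C)(x,y)=\int B(x,z)C(z,y)\,dz$, and $G^\dagger(\mathbf{r},\mathbf{u})=G(\mathbf{u},\mathbf{r})^*$, so $(G^\dagger*G)(\mathbf{r},\mathbf{s})=\int G(\mathbf{u},\mathbf{r})^*G(\mathbf{u},\mathbf{s})\,d\mathbf{u}$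 and $(-\mathrm{i}[\nabla_2G]^\dagger*G)(\mathbf{r},\mathbf{s})=-\mathrm{i}\int[\nabla_2G(\mathbf{u},\mathbf{r})]^*G(\mathbf{u},\mathbf{s})\,d\mathbf{u}$. For a kernel $A$ which equals a.e. a product $P*Q$ with $P\in L^2(\mathbb{R}^3_{\mathrm{loc}}\times\mathbb{R}^m)$ and $Q\in L^2(\mathbb{R}^m\times\mathbb{R}^3_{\mathrm{loc}})$ (i.e. square integrable over $K\times\mathbb{R}^m$, resp. $\mathbb{R}^m\times K$, for every compact $K$), $\operatorname{diag}A$ is the function $x\mapsto(P*Q)(x,x)$, which is a.e. independent of the factorization. *)

(* Defs.v *)
From HB Require Import structures.
From mathcomp Require Import all_boot all_order all_algebra perm.
From mathcomp Require Import complex.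
From mathcomp Require Import all_classical all_reals all_analysis.
Set Implicit Arguments.
Unset Strict Implicit.
Unset Printing Implicit Defensive.
Import Order.TTheory GRing.Theory Num.Theory.
Import numFieldNormedType.Exports.
Local Open Scope classical_set_scope.
Local Open Scope ring_scope.

(* The Borel sigma-algebra of 'M[R]_(m, n), generated by the entries. *)
Section measurable_matrix.
Context {R : realType} (m n : nat).

Definition mx_cylinders : set (set 'M[R]_(m, n)) :=
  [set A | exists i j, exists2 B : set R,
     measurable B & A = (fun M : 'M[R]_(m, n) => M i j) @^-1` B].

Let mx_set0 : <<s mx_cylinders >> set0.
Proof. exact: sigma_algebra0. Qed.

Let mx_setC A : <<s mx_cylinders >> A -> <<s mx_cylinders >> (~` A).
Proof. exact: sigma_algebraC. Qed.

Let mx_bigcup (F : (set 'M[R]_(m, n))^nat) :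
  (forall i, <<s mx_cylinders >> (F i)) -> <<s mx_cylinders >> (\bigcup_i F i).
Proof. exact: sigma_algebra_bigcup. Qed.

HB.instance Definition _ := @isMeasurable.Build default_measure_display
  'M[R]_(m, n) (<<s mx_cylinders >>) mx_set0 mx_setC mx_bigcup.

Lemma measurable_entry i j :
  measurable_fun [set: 'M[R]_(m, n)] (fun M : 'M[R]_(m, n) => M i j : R).
Proof.
by move=> _ B mB; rewrite setTI; apply: sub_sigma_algebra; exists i, j, B.
Qed.

Lemma measurable_fun_mx d (T : measurableType d) (f : T -> 'M[R]_(m, n)) :
  (forall i j, measurable_fun setT (fun x => f x i j : R)) ->
  measurable_fun setT f.
Proof.
move=> mf; apply: (@measurability _ _ _ _ _ _ mx_cylinders) => //.
by move=> _ [_ [i [j [B mB ->]]] <-]; exact: mf.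
Qed.

End measurable_matrix.


(* The image of a product measure under a Borel isomorphism. *)
Section image_prod.
Context d1 d2 d3 (T1 : measurableType d1) (T2 : measurableType d2)
  (T3 : measurableType d3) (R : realType).
Variables (m1 : {sigma_finite_measure set T1 -> \bar R}).
Variables (m2 : {sigma_finite_measure set T2 -> \bar R}).
Variables (f : T1 * T2 -> T3) (g : T3 -> T1 * T2).
Hypotheses (mf : measurable_fun setT f) (mg : measurable_fun setT g).
Hypothesis (fK : cancel f g).

Definition image_prod of measurable_fun setT f & measurable_fun setT g
  & cancel f g : set T3 -> \bar R := pushforward (m1 \x m2)%E f.

Local Notation nu := (image_prod mf mg fK).

Let nu0 : nu set0 = 0%E.
Proof. by rewrite /image_prod /pushforward preimage_set0 measure0. Qed.

Let nu_ge0 A : (0 <= nu A)%E.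
Proof. exact: measure_ge0. Qed.

Let nu_sigma_additive : semi_sigma_additive nu.
Proof.
exact: (@measure_semi_sigma_additive _ _ _ (pushforward (m1 \x m2)%E f)).
Qed.

HB.instance Definition _ := isMeasure.Build _ _ _ nu
  nu0 nu_ge0 nu_sigma_additive.

Let nu_sigma_finite : sigma_finite setT nu.
Proof.
have /sigma_finiteP[F [TF ndF Foo]] := sigma_finiteT m1.
have /sigma_finiteP[G [TG ndG Goo]] := sigma_finiteT m2.
exists (fun k => g @^-1` (F k `*` G k)) => [|k].
  rewrite -preimage_bigcup (_ : \bigcup_k _ = setT) ?preimage_setT//.
  rewrite -setXTT TF TG predeqE => -[x y]; split.
    by move=> [n _ []/= ? ?]; split; exists n.
  move=> [/= [n _ Fnx] [k _ Gky]]; exists (maxn n k) => //; split.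
  - by move: x Fnx; exact/subsetPset/ndF/leq_maxl.
  - by move: y Gky; exact/subsetPset/ndG/leq_maxr.
have [mF Fkoo] := Foo k; have [mG Gkoo] := Goo k.
split.
  by rewrite -[X in measurable X]setTI; apply: mg => //; exact: measurableX.
rewrite /image_prod /pushforward -comp_preimage.
rewrite (_ : g \o f = id) ?preimage_id; last exact/funext.
by rewrite product_measure1E// lte_mul_pinfty// ge0_fin_numE.
Qed.

HB.instance Definition _ := Measure_isSigmaFinite.Build _ _ _ nu
  nu_sigma_finite.

End image_prod.

Section lebesgue_mx.
Context {R : realType}.

Definition row_cons n (p : measurableTypeR R * 'rV[R]_n) : 'rV[R]_(1 + n) :=
  row_mx (\row_(_ < 1) p.1) p.2.
Definition row_uncons n (v : 'rV[R]_(1 + n)) : measurableTypeR R * 'rV[R]_n :=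
  (lsubmx v 0 0, rsubmx v).

Lemma row_consK n : cancel (@row_cons n) (@row_uncons n).
Proof. by case=> x v; rewrite /row_uncons row_mxKl row_mxKr mxE. Qed.

Lemma measurable_row_cons n : measurable_fun setT (@row_cons n).
Proof.
apply: measurable_fun_mx => i j; rewrite /row_cons.
case: (split_ordP j) => k ->.
  under eq_fun do rewrite row_mxEl mxE; exact: measurable_fst.
under eq_fun do rewrite row_mxEr.
exact: measurableT_comp (measurable_entry i k) measurable_snd.
Qed.

Lemma measurable_row_uncons n : measurable_fun setT (@row_uncons n).
Proof.
apply/measurable_fun_pairP; split.
  under [X in measurable_fun _ X]eq_fun do rewrite /= mxE.
  exact: measurable_entry.
apply: measurable_fun_mx => i j /=.
under eq_fun do rewrite mxE; exact: measurable_entry.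
Qed.

Definition mx_cons m n (p : 'rV[R]_n * 'M[R]_(m, n)) : 'M[R]_(1 + m, n) :=
  col_mx p.1 p.2.
Definition mx_uncons m n (M : 'M[R]_(1 + m, n)) : 'rV[R]_n * 'M[R]_(m, n) :=
  (usubmx M, dsubmx M).

Lemma mx_consK m n : cancel (@mx_cons m n) (@mx_uncons m n).
Proof. by case=> x v; rewrite /mx_uncons col_mxKu col_mxKd. Qed.

Lemma measurable_mx_cons m n : measurable_fun setT (@mx_cons m n).
Proof.
apply: measurable_fun_mx => i j; rewrite /mx_cons.
case: (split_ordP i) => k ->.
  under eq_fun do rewrite col_mxEu.
  exact: measurableT_comp (measurable_entry k j) measurable_fst.
under eq_fun do rewrite col_mxEd.
exact: measurableT_comp (measurable_entry k j) measurable_snd.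
Qed.

Lemma measurable_mx_uncons m n : measurable_fun setT (@mx_uncons m n).
Proof.
apply/measurable_fun_pairP; split; apply: measurable_fun_mx => i j /=;
  under eq_fun do rewrite mxE; exact: measurable_entry.
Qed.

(* Lebesgue measure on R^n and on the m-tuples of points of R^n (rows of a
   matrix); a zero-dimensional space carries the unit mass at its point. *)
Fixpoint leb_rV n : {sigma_finite_measure set 'rV[R]_n -> \bar R} :=
  match n with
  | 0 => [the {sigma_finite_measure set _ -> \bar R} of \d_(0 : 'rV[R]_0)]
  | n'.+1 => [the {sigma_finite_measure set _ -> \bar R} of
      image_prod
        [the {sigma_finite_measure set _ -> \bar R} of @lebesgue_measure R]
        (leb_rV n')
        (@measurable_row_cons n') (@measurable_row_uncons n') (@row_consK n')]
  end.

Fixpoint leb_mx m n : {sigma_finite_measure set 'M[R]_(m, n) -> \bar R} :=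
  match m with
  | 0 => [the {sigma_finite_measure set _ -> \bar R} of \d_(0 : 'M[R]_(0, n))]
  | m'.+1 => [the {sigma_finite_measure set _ -> \bar R} of
      image_prod (leb_rV n) (leb_mx m' n)
        (@measurable_mx_cons m' n) (@measurable_mx_uncons m' n)
        (@mx_consK m' n)]
  end.

End lebesgue_mx.

Section complex_integration.
Context d (T : measurableType d) (R : realType).
Variable mu : {measure set T -> \bar R}.
Implicit Types (A : set T) (f g : T -> R[i]).

Definition cint A f : R[i] :=
  Complex (Rintegral mu A (fun x => complex.Re (f x)))
          (Rintegral mu A (fun x => complex.Im (f x))).

Definition cintegrable A f :=
  mu.-integrable A (fun x => (complex.Re (f x))%:E) /\
  mu.-integrable A (fun x => (complex.Im (f x))%:E).

Definition in_L2 A f :=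
  [/\ measurable_fun A (fun x => complex.Re (f x) : R),
      measurable_fun A (fun x => complex.Im (f x) : R) &
      (\int[mu]_(x in A) (Normc.normc (f x) ^+ 2)%:E < +oo)%E].

(* <f, g>, antilinear in f *)
Definition ip A f g := cint A (fun x => (f x)^*%C * g x).

(* A countable orthonormal basis of L^2(A). Entries of norm 0 are allowed, so
   that the finite-dimensional case (A a null set) is covered as well. *)
Definition onb A (e : nat -> T -> R[i]) :=
  [/\ forall i, in_L2 A (e i),
      forall i j, i <> j -> ip A (e i) (e j) = 0,
      forall i, ip A (e i) (e i) = 1 \/ ip A (e i) (e i) = 0 &
      forall f, in_L2 A f -> (forall i, ip A (e i) f = 0) -> ip A f f = 0].

End complex_integration.

Definition csum (R : realType) (u : nat -> R[i]) : R[i] :=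
  Complex (limn (series (fun i => complex.Re (u i))))
          (limn (series (fun i => complex.Im (u i)))).

Section kernels.
Context d (T : measurableType d) (R : realType).
Variable mu : {sigma_finite_measure set T -> \bar R}.
Implicit Types (X : set T) (A : T * T -> R[i]).

Definition kmul d1 d2 (T1 : measurableType d1) (T2 : measurableType d2) X
    (B : T1 * T -> R[i]) (C : T * T2 -> R[i]) (p : T1 * T2) : R[i] :=
  cint mu X (fun z => B (p.1, z) * C (z, p.2)).

Definition kadj T1 T2 (B : T1 * T2 -> R[i]) (p : T2 * T1) : R[i] :=
  (B (p.2, p.1))^*%C.

(* <f, A g> *)
Definition kform X A (f g : T -> R[i]) : R[i] :=
  cint (mu \x mu)%E (X `*` X) (fun p => (f p.1)^*%C * A p * g p.2).

(* P is the kernel of |A|, the positive square root of A^dagger A, for the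
   Hilbert-Schmidt operator of kernel A on L^2(X); |A| is itself
   Hilbert-Schmidt, hence has a square integrable kernel. *)
Definition kabs X A (P : T * T -> R[i]) :=
  [/\ in_L2 (mu \x mu)%E (X `*` X) P,
      forall f, in_L2 mu X f -> 0 <= kform X P f f &
      {ae (mu \x mu)%E, forall p, (X `*` X) p ->
        kmul X P P p = kmul X (kadj A) A p}].

(* Tr |A| < oo; trace-class operators are Hilbert-Schmidt. *)
Definition trace_class X A :=
  in_L2 (mu \x mu)%E (X `*` X) A /\
  exists P e, [/\ kabs X A P, onb mu X e &
    (\sum_(0 <= i <oo) (complex.Re (kform X P (e i) (e i)))%:E < +oo)%E].

(* For a trace-class kernel the sum does not depend on the basis. *)
Definition has_trace X A (t : R[i]) :=
  exists e, [/\ onb mu X e,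
    series (fun i => complex.Re (kform X A (e i) (e i))) @ \oo
      --> complex.Re t &
    series (fun i => complex.Im (kform X A (e i) (e i))) @ \oo
      --> complex.Im t].

End kernels.

#[short(type="measNormedModType")]
HB.structure Definition MeasurableNormedModule d (K : numDomainType) :=
  {V of Measurable d V & NormedModule K V}.

HB.instance Definition _ (R : realType) m n := NormedModule.on 'M[R]_(m, n).

HB.instance Definition _ d1 d2 (R : realType)
    (V1 : measNormedModType d1 R) (V2 : measNormedModType d2 R) :=
  NormedModule.on (V1 * V2)%type.

(* Functions are Borel representatives of classes modulo a.e. equality. Test
   functions are real-valued: complex ones are covered by linearity. *)
Section weak_derivatives.
Context d (R : realType) (V : measNormedModType d R).
Variable mu : {measure set V -> \bar R}.

Definition iter_derive (phi : V -> R) (vs : seq V) : V -> R :=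
  foldr (fun v psi x => 'D_v psi x) phi vs.

Definition smooth (phi : V -> R) :=
  forall vs, continuous (iter_derive phi vs) /\
             forall v x, derivable (iter_derive phi vs) x v.

Definition test_function (phi : V -> R) :=
  smooth phi /\ exists2 K, compact K & forall x, ~ K x -> phi x = 0.

Definition in_L1loc (f : V -> R[i]) :=
  forall K, compact K -> cintegrable mu K f.

Definition weak_derive (v : V) (f g : V -> R[i]) :=
  [/\ in_L1loc f, in_L1loc g &
      forall phi, test_function phi ->
        cint mu setT (fun x => f x * ('D_v phi x)%:C%C) =
        - cint mu setT (fun x => g x * (phi x)%:C%C)].

End weak_derivatives.

Section electrons.
Context {R : realType}.
Local Notation R3 := 'rV[R]_3.
Local Notation C := R[i].
Local Notation mu3 := (@leb_rV R 3).
Local Notation mu6 := (mu3 \x mu3)%E.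
Local Notation e k := (delta_mx 0 k : R3).

Definition weak_grad1 (A : R3 * R3 -> C) (dA : 'I_3 -> R3 * R3 -> C) :=
  forall k, weak_derive mu6 (e k, 0 : R3) A (dA k).

Definition weak_grad2 (A : R3 * R3 -> C) (dA : 'I_3 -> R3 * R3 -> C) :=
  forall k, weak_derive mu6 (0 : R3, e k) A (dA k).

(* W is the weak derivative nabla_1 . nabla_2 A *)
Definition weak_div12 (A W : R3 * R3 -> C) :=
  [/\ in_L1loc mu6 A, in_L1loc mu6 W &
      forall phi : R3 * R3 -> R, test_function phi ->
        cint mu6 setT (fun p => A p *
          (\sum_(k < 3)
             iter_derive phi [:: (e k, 0 : R3); (0 : R3, e k)] p)%:C%C) =
        cint mu6 setT (fun p => W p * (phi p)%:C%C)].

(* the set D_{N,1} *)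
Record rdm1 (N : nat) (D : R3 * R3 -> C) : Prop := {
  rdm1_L2 : in_L2 mu6 setT D;
  rdm1_trace_class : trace_class mu3 setT D;
  rdm1_hermitian : {ae mu6, forall p, D p = kadj D p};
  rdm1_bounds : forall phi, in_L2 mu3 setT phi ->
    0 <= kform mu3 setT D phi phi <= 2 * ip mu3 setT phi phi;
  rdm1_trace : has_trace mu3 setT D N%:R }.

Definition loc_finite_kinetic (D : R3 * R3 -> C) :=
  exists2 W, weak_div12 D W & forall K, compact K -> trace_class mu3 K W.

(* An ensemble (p_i, Psi_i) representing a mixed state of n.+1 electrons; the
   rows of the argument of Psi_i are the positions of the electrons. *)
Record mixed_state n (p : nat -> R) (Psi : nat -> 'M[R]_(n.+1, 3) -> C) : Prop
  := {
  weight_ge0 : forall i, 0 <= p i;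
  weight_sum : series p @ \oo --> (1 : R);
  state_L2 : forall i, in_L2 (leb_mx n.+1 3) setT (Psi i);
  state_norm : forall i, ip (leb_mx n.+1 3) setT (Psi i) (Psi i) = 1;
  state_sym : forall i,
    (forall s : 'S_n.+1,
       {ae leb_mx n.+1 3, forall x, Psi i (row_perm s x) = Psi i x}) \/
    (forall s : 'S_n.+1,
       {ae leb_mx n.+1 3, forall x,
          Psi i (row_perm s x) = (-1) ^+ odd_perm s * Psi i x}) }.

Section densities.
Context {n : nat} (p : nat -> R).
Variables (Psi : nat -> 'M[R]_(n.+1, 3) -> C).

Definition rdm (q : R3 * R3) : C :=
  n.+1%:R * csum (fun i => (p i)%:C%C *
    cint (leb_mx n 3) setT (fun x =>
      Psi i (col_mx q.1 x) * (Psi i (col_mx q.2 x))^*%C)).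

(* dPsi i k is the derivative of Psi i along the k-th coordinate of the first
   electron; nothing is required of the states of weight 0. *)
Definition weak_grad_state (dPsi : nat -> 'I_3 -> 'M[R]_(n.+1, 3) -> C) :=
  forall i, 0 < p i -> forall k,
    weak_derive (leb_mx n.+1 3) (delta_mx 0 k : 'M[R]_(n.+1, 3))
      (Psi i) (dPsi i k).

Variable dPsi : nat -> 'I_3 -> 'M[R]_(n.+1, 3) -> C.

Definition momentum_integrand i k (r : R3) (x : 'M[R]_(n, 3)) : C :=
  (- 'i%C * dPsi i k (col_mx r x)) * (Psi i (col_mx r x))^*%C.

Definition momentum_term i k (r : R3) : C :=
  (p i)%:C%C * cint (leb_mx n 3) setT (momentum_integrand i k r).

Definition momentum_density k (r : R3) : C :=
  n.+1%:R * csum (fun i => momentum_term i k r).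

(* The integrals and the series in momentum_density converge absolutely. *)
Definition momentum_density_defined :=
  forall k, {ae mu3, forall r,
    (forall i, 0 < p i ->
       cintegrable (leb_mx n 3) setT (momentum_integrand i k r)) /\
    cvgn (series (fun i => Normc.normc (momentum_term i k r)))}.

End densities.

Definition diag_factors m (A : R3 * R3 -> C)
    (P : R3 * 'rV[R]_m -> C) (Q : 'rV[R]_m * R3 -> C) :=
  [/\ forall K : set R3, compact K ->
        in_L2 (mu3 \x leb_rV m)%E (K `*` setT) P,
      forall K : set R3, compact K ->
        in_L2 (leb_rV m \x mu3)%E (setT `*` K) Q &
      {ae mu6, forall p, A p = kmul (leb_rV m) setT P Q p}].

(* diag A is defined and equals a: A has a factorization, and all of them
   yield a. *)
Definition is_diag (A : R3 * R3 -> C) (a : R3 -> C) :=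
  (exists m P Q, @diag_factors m A P Q) /\
  forall m P Q, @diag_factors m A P Q ->
    {ae mu3, forall r, a r = kmul (leb_rV m) setT P Q (r, r)}.

End electrons.

(* Main.v *)
(* Put H(r, u) = G(u, r)^* and F(r, (i, x)) = sqrt (N p_i) Psi_i(r, x), so that
   D = H H^* = F F^* as operators. The map sending int H(r, .) a(r) dr to
   int F(r, .) a(r) dr is then isometric. Weak differentiability of H says that
   int H(r, .) phi'(r) dr = - int (nabla H)(r, .) phi(r) dr for all test functions
   phi; carrying this identity along the isometry, after multiplying nabla H by a
   weight that makes it square integrable, yields a locally square integrable
   weak gradient of F, hence of every Psi_i with p_i > 0. Both (nabla H) H^* and
   (nabla F) F^* are the weak gradient of D in its first argument, so they
   coincide almost everywhere. The diagonal of a product of locally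
   Hilbert-Schmidt kernels depends only on the product, because its integral over
   a bounded set is the trace of a product of Hilbert-Schmidt operators. The
   diagonal of -i (nabla F) F^* is the momentum density, that of
   -i (nabla H) H^* is the right-hand side of the formula. *)

Require Import Defs.
From HB Require Import structures.
From mathcomp Require Import all_boot all_order all_algebra perm.
From mathcomp Require Import complex ring lra.
From mathcomp Require Import all_classical all_reals all_analysis.
From mathcomp Require Import measurable_realfun.
Set Implicit Arguments.
Unset Strict Implicit.
Unset Printing Implicit Defensive.
Import Order.TTheory GRing.Theory Num.Theory.
Import numFieldNormedType.Exports.
Local Open Scope classical_set_scope.
Local Open Scope ring_scope.

(** * Parseval identity in a semi-Hilbert space *)

(** The isometry is not built as an operator. Only pairs of kernels related by it are used: the
    weighted gradient of H is approximated by first components of such pairs, and the second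
    components are then Cauchy. That it can be approximated is a duality argument: it maps a total
    family into the range of the operator with kernel H, so a kernel orthogonal to all first
    components is orthogonal to it. The analysis is done with real functions, not identified modulo
    null sets, whence a form that is only semidefinite. A complex kernel becomes a real one whose
    inner variable carries an index for the real or the imaginary part; the index of the ensemble is
    absorbed in the same way. Hilbert-Schmidt norms and traces are computed with an orthonormal
    basis of L^2(R^3), which comes with the trace of D. Weak derivatives are tested slice by slice
    in the first variable, since the inner variable ranges over a measure space without
    differentiable structure; [rweak_wder] and [wder_rweak] pass between slices and products. *)

Section semi_hilbert.
Context {R : realType} {V : zmodType} (sc : R -> V -> V).
Variables (L : V -> Prop) (B : V -> V -> R).
Hypothesis L0 : L 0.
Hypothesis LD : forall f g, L f -> L g -> L (f + g).
Hypothesis LN : forall f, L f -> L (- f).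
Hypothesis LZ : forall a f, L f -> L (sc a f).
Hypothesis BC : forall f g, B f g = B g f.
Hypothesis BD : forall f g h, L f -> L g -> L h -> B (f + g) h = B f h + B g h.
Hypothesis BZ : forall a f g, L f -> L g -> B (sc a f) g = a * B f g.
Hypothesis B_ge0 : forall f, 0 <= B f f.

Let LB f g : L f -> L g -> L (f - g).
Proof. by move=> Lf Lg; apply: LD => //; exact: LN. Qed.

Let B0l h : L h -> B 0 h = 0.
Proof. by move=> Lh; have := BD L0 L0 Lh; rewrite addr0 => /eqP; lra. Qed.

Let BN f h : L f -> L h -> B (- f) h = - B f h.
Proof.
move=> Lf Lh; have := BD Lf (LN Lf) Lh; rewrite subrr B0l// => /eqP; lra.
Qed.

Let BB f g h : L f -> L g -> L h -> B (f - g) h = B f h - B g h.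
Proof. by move=> Lf Lg Lh; rewrite BD ?BN//; exact: LN. Qed.

Let qB f g : L f -> L g -> B (f - g) (f - g) = B f f - 2 * B f g + B g g.
Proof.
move=> Lf Lg; rewrite BB//; last exact: LB.
rewrite (BC f) (BC g) !BB//; try exact: LB.
by rewrite (BC g f); ring.
Qed.

Let qD f g : L f -> L g -> B (f + g) (f + g) = B f f + 2 * B f g + B g g.
Proof.
move=> Lf Lg; rewrite BD//; last exact: LD.
rewrite (BC f) (BC g) !BD//; try exact: LD.
by rewrite (BC g f); ring.
Qed.

Lemma semi_CS f g : L f -> L g -> B f g ^+ 2 <= B f f * B g g.
Proof.
move=> Lf Lg.
have H t : 0 <= B f f - 2 * t * B f g + t ^+ 2 * B g g.
  have := B_ge0 (f - sc t g); rewrite qB//; last exact: LZ.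
  rewrite (BC f (sc _ _)) !BZ//; last exact: LZ.
  by rewrite (BC g (sc _ _)) BZ// (BC g f); congr (_ <= _); ring.
have [q0|q0] := eqVneq (B g g) 0.
  rewrite q0 mulr0; have [->|b0] := eqVneq (B f g) 0; first by rewrite expr0n.
  (* For a null vector [g] the expression is affine in [t]; this [t] gives it the value -1. *)
  have := H ((B f f + 1) / (2 * B f g)); rewrite q0.
  rewrite (_ : 2 * _ * _ = B f f + 1); last by field.
  by lra.
have q1 : 0 < B g g by rewrite lt_neqAle eq_sym q0 B_ge0.
have := H (B f g / B g g).
rewrite (_ : _ - _ + _ = B f f - B f g ^+ 2 / B g g); last by field.
by rewrite subr_ge0 ler_pdivrMr.
Qed.

Let qD2 f g : L f -> L g ->
  B (f + g) (f + g) <= 2 * B f f + 2 * B g g.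
Proof.
move=> Lf Lg; have := B_ge0 (f - g); rewrite qB// qD//; lra.
Qed.

Hypothesis complete : forall u : nat -> V, (forall n, L (u n)) ->
  (forall e, 0 < e -> exists N, forall m n, (N <= m)%N -> (N <= n)%N ->
     B (u m - u n) (u m - u n) <= e) ->
  exists2 g, L g & forall e, 0 < e -> exists N, forall n, (N <= n)%N ->
     B (u n - g) (u n - g) <= e.

Let eps2P (x : R) : (forall e, 0 < e -> x <= e) -> x <= 0.
Proof.
move=> h; rewrite leNgt; apply/negP => x0.
by have := h (x / 2); rewrite divr_gt0// => /(_ isT); lra.
Qed.

Let B_lim (u : nat -> V) g w c : L g -> L w -> (forall n, L (u n)) ->
  (forall e, 0 < e -> exists N, forall n, (N <= n)%N ->
     B (u n - g) (u n - g) <= e) ->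
  (exists M, forall n, (M <= n)%N -> B (u n) w = c) -> B g w = c.
Proof.
move=> Lg Lw Lu ug [M uM].
apply/eqP; rewrite -subr_eq0 -sqrf_eq0 eq_le sqr_ge0 andbT; apply: eps2P => e e0.
have d0 : 0 < e / (1 + B w w) by rewrite divr_gt0// ltr_pwDl.
have [N HN] := ug _ d0.
have := HN _ (leq_maxl N M); have := uM _ (leq_maxr N M).
set k := maxn N M => uk uk2.
have := semi_CS (LB (Lu k) Lg) Lw; rewrite BB// uk -sqrrN opprB => /le_trans; apply.
have := B_ge0 w => w0.
apply: (@le_trans _ _ (e / (1 + B w w) * B w w)); first by rewrite ler_wpM2r.
rewrite -mulrAC ler_pdivrMr ?ltr_pwDl//; lra.
Qed.

Section approximation.
Variable S : V -> Prop.
Hypothesis SL : forall w, S w -> L w.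
Hypothesis S0 : S 0.
Hypothesis SD : forall f g, S f -> S g -> S (f + g).
Hypothesis SZ : forall a f, S f -> S (sc a f).

(** A minimising sequence in [S] converges to some [g] by completeness. Then [f - g] is orthogonal
    to [S], hence to [f] by assumption and to [g] as a limit of elements of [S]. So [f - g] has norm
    zero, and the minimising sequence itself approximates [f]. *)
Lemma approx_of_orthogonal f : L f ->
  (forall H, L H -> (forall w, S w -> B H w = 0) -> B H f = 0) ->
  forall e, 0 < e -> exists2 w, S w & B (f - w) (f - w) <= e.
Proof.
move=> Lf Hf.
pose E := [set B (f - w) (f - w) | w in S].
have E0 : has_inf E.
  split; first by exists (B (f - 0) (f - 0)), 0.
  by exists 0 => _ [w _ <-].
pose d := inf E.
have dle w : S w -> d <= B (f - w) (f - w).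
  by move=> Sw; apply: ge_inf; [case: E0|exists w].
have ex n : exists w, S w /\ B (f - w) (f - w) < d + n.+1%:R^-1.
  have := @inf_adherent _ E n.+1%:R^-1; rewrite invr_gt0 ltr0n => /(_ isT E0).
  by move=> [_ [w Sw <-]] lt; exists w.
pose u n := projT1 (cid (ex n)).
have uS n : S (u n) by rewrite /u; case: cid => //= ? [].
have ud n : B (f - u n) (f - u n) < d + n.+1%:R^-1.
  by rewrite /u; case: cid => //= ? [].
have uL n : L (u n) by apply: SL.
(* Parallelogram law: the midpoint of [w1] and [w2] lies in [S], so its squared distance to [f] is
   at least [d]. *)
have half w1 w2 : S w1 -> S w2 ->
    B (w1 - w2) (w1 - w2) <=
      2 * (B (f - w1) (f - w1) - d) + 2 * (B (f - w2) (f - w2) - d).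
  move=> S1 S2; have := dle _ (SZ (2^-1) (SD S1 S2)).
  have L1 := SL S1; have L2 := SL S2.
  rewrite !qB//; last exact/LZ/LD.
  rewrite (BC f (sc _ _)) !BZ//; try exact: LD; last exact/LZ/LD.
  rewrite (BC _ (sc _ _)) BZ//; try exact: LD.
  rewrite qD// BD// (BC w1 f) (BC w2 f).
  by lra.
have inv_le (e : R) : 0 < e -> exists N, forall n, (N <= n)%N -> n.+1%:R^-1 <= e.
  move=> e0; have [N _ HN] := near_infty_natSinv_lt (PosNum e0).
  by exists N => n Nn; apply/ltW/HN.
have [|g Lg ug] := complete uL.
  move=> e e0; have [|N HN] := inv_le (e / 4); first by rewrite divr_gt0.
  exists N => m n Nm Nn; apply: (le_trans (half _ _ (uS m) (uS n))).
  have := HN _ Nm; have := HN _ Nn; have := ud m; have := ud n.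
  by set x := n.+1%:R^-1; set y := m.+1%:R^-1; lra.
have LH : L (f - g) by exact: LB.
have HS w : S w -> B (f - g) w = 0.
  move=> Sw; have Lw := SL Sw.
  (* [u k + t w] competes for the infimum [d], which [u k] nearly attains. The tolerance [e] is
     shared between the defect of [u k] and the replacement of [u k] by [g]. *)
  have Ht t : 2 * t * B (f - g) w <= t ^+ 2 * B w w.
    rewrite -subr_le0; apply: eps2P => e e0.
    pose r := e / 2; have r0 : 0 < r by rewrite divr_gt0.
    (* With this bound on [u k - g], Cauchy-Schwarz gives [2 * t * b <= r]; the added ones only
       avoid division by zero. *)
    pose c := (r / (1 + `|2 * t|)) ^+ 2 / (1 + B w w).
    have qw := B_ge0 w.
    have tt : 0 < 1 + `|2 * t| by rewrite ltr_pwDl.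
    have c0 : 0 < c by rewrite divr_gt0 ?exprn_gt0 ?divr_gt0// ltr_pwDl.
    have [N1 H1] := ug _ c0; have [N2 H2] := inv_le _ r0.
    pose k := maxn N1 N2.
    have := H1 k (leq_maxl _ _); have := H2 k (leq_maxr _ _).
    set z := k.+1%:R^-1 => zr uk.
    have := dle _ (SD (uS k) (SZ t Sw)).
    have Luk := uL k.
    rewrite opprD addrA qB//; [|exact: LB|exact: LZ].
    rewrite (BC _ (sc _ _)) !BZ//; try exact: LZ; try exact: LB.
    rewrite (BC w (sc _ _)) BZ// (BC w).
    have := ud k; rewrite -/z.
    rewrite (_ : f - u k = (f - g) - (u k - g)); last by rewrite opprB addrA subrK.
    rewrite [B (_ - _ - _) w]BB//; last exact: LB.
    set b := B (u k - g) w.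
    have : 2 * t * b <= r.
      have bb : b ^+ 2 <= (r / (1 + `|2 * t|)) ^+ 2.
        apply: (le_trans (semi_CS (LB (uL k) Lg) Lw)).
        apply: (@le_trans _ _ (c * B w w)); first by rewrite ler_wpM2r.
        rewrite /c mulrAC ler_pdivrMr ?ltr_pwDl//.
        by rewrite ler_wpM2l ?sqr_ge0//; lra.
      have b1 : `|b| <= r / (1 + `|2 * t|).
        have r1 : 0 <= r / (1 + `|2 * t|) by apply: divr_ge0; exact: ltW.
        by rewrite -(ler_sqr _ r1) ?nnegrE// real_normK ?num_real.
      apply: (le_trans (ler_norm _)); rewrite normrM.
      apply: (@le_trans _ _ ((1 + `|2 * t|) * (r / (1 + `|2 * t|)))).
        by rewrite ler_pM// lerDr.
      by rewrite mulrCA divff ?mulr1// gt_eqF.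
      by move: zr; rewrite /r expr2; lra.
  have [q0|q0] := eqVneq (B w w) 0.
    by have := Ht 1; have := Ht (-1); rewrite q0; lra.
  have q1 : 0 < B w w by rewrite lt_neqAle eq_sym q0 B_ge0.
  have := Ht (B (f - g) w / B w w); set b := B (f - g) w.
  rewrite (_ : 2 * _ * _ = 2 * (b ^+ 2 / B w w)); last by field.
  rewrite (_ : _ ^+ 2 * _ = b ^+ 2 / B w w); last by field.
  have : 0 <= b ^+ 2 / B w w by rewrite divr_ge0// sqr_ge0.
  move=> h1 h2; have /eqP : b ^+ 2 / B w w = 0 by lra.
  by rewrite mulf_eq0 sqrf_eq0 invr_eq0 (negPf q0) orbF => /eqP.
have Hf0 := Hf _ LH HS.
have Hg0 : B (f - g) g = 0.
  by rewrite BC; apply: (B_lim Lg LH uL ug); exists 0%N => n _; rewrite BC HS.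
have q0 : B (f - g) (f - g) = 0.
  by rewrite BB// (BC f) Hf0 (BC g) Hg0 subrr.
move=> e e0; have [|N HN] := ug (e / 2); first by rewrite divr_gt0.
exists (u N) => //.
rewrite (_ : f - u N = (f - g) + - (u N - g)); last by rewrite opprB addrA subrK.
apply: (le_trans (qD2 LH (LN (LB (uL N) Lg)))).
rewrite q0 BN//; [|exact: LB|exact/LN/LB].
rewrite (BC (u N - g)) BN//; try exact: LB.
by have := HN _ (leqnn N); lra.
Qed.

End approximation.

Section parseval.
Variable e : nat -> V.
Hypothesis Le : forall i, L (e i).
Hypothesis e_orth : forall i j, i <> j -> B (e i) (e j) = 0.
Hypothesis e_norm : forall i, B (e i) (e i) = 1 \/ B (e i) (e i) = 0.
Hypothesis e_total : forall f, L f -> (forall i, B (e i) f = 0) -> B f f = 0.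

(** The Fourier sums are Cauchy by Bessel's inequality. Their limit has the coefficients of [f], so
    totality puts it at distance zero from [f]. *)
Lemma parseval_of_total f : L f ->
  series (fun i => B (e i) f ^+ 2) @ \oo --> B f f.
Proof.
move=> Lf; pose c i := B (e i) f.
pose s n : V := \sum_(i < n) sc (c i) (e i).
have sS n : s n.+1 = s n + sc (c n) (e n) by rewrite /s big_ord_recr.
have Ls n : L (s n).
  by elim: n => [|n IH]; rewrite ?sS /s ?big_ord0//; exact/LD/LZ.
(* A basis vector of norm zero is harmless: by Cauchy-Schwarz its coefficient vanishes. *)
have ce i : c i * B (e i) (e i) = c i.
  case: (e_norm i) => E; rewrite E ?mulr1// mulr0.
  apply/esym/eqP; rewrite -sqrf_eq0 eq_le sqr_ge0 andbT.
  by have := semi_CS (Le i) Lf; rewrite E mul0r.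
set p : nat -> R := series (fun i => B (e i) f ^+ 2).
have p0 : p 0%N = 0 by rewrite /p seriesEord/= big_ord0.
have s0 : s 0%N = 0 by rewrite /s big_ord0.
have pS n : p n.+1 = p n + c n ^+ 2 by rewrite /p seriesSr.
have Bse j n : B (e j) (s n) = (j < n)%:R * c j.
  elim: n => [|n IH]; first by rewrite /s big_ord0 BC B0l// mul0r.
  rewrite sS BC BD//; last exact: LZ.
  rewrite BC IH BZ// ltnS; have [->|jn] := eqVneq j n.
    by rewrite ltnn leqnn mul0r add0r mul1r ce.
  rewrite e_orth ?mulr0 ?addr0 ?[(j <= n)%N]leq_eqVlt ?(negPf jn)//.
  by move=> E; rewrite E eqxx in jn.
have Bss n m : (m <= n)%N -> B (s n) (s m) = p m.
  elim: m => [_|m IH mn].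
    by rewrite s0 (BC (s n)) B0l// p0.
  rewrite sS (BC (s n)) BD//; last exact: LZ.
  rewrite (BC (s m)) IH; last exact: ltnW.
  by rewrite BZ// Bse mn mul1r (pS m) expr2.
have Bfs n : B f (s n) = p n.
  elim: n => [|n IH].
    by rewrite s0 BC B0l// p0.
  rewrite sS (BC f) BD//; last exact: LZ.
  by rewrite (BC (s n)) IH BZ// (pS n) expr2.
have qfs n : B (f - s n) (f - s n) = B f f - p n.
  by rewrite qB// Bfs Bss//; ring.
have qss n m : (m <= n)%N -> B (s n - s m) (s n - s m) = p n - p m.
  by move=> mn; rewrite qB// !Bss//; ring.
have pnd : nondecreasing_seq p.
  by apply/nondecreasing_seqP => n; rewrite pS lerDl sqr_ge0.
have pub n : p n <= B f f by rewrite -subr_ge0 -qfs.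
have pcvg : cvgn p.
  apply: nondecreasing_is_cvgn => //.
  by exists (B f f) => _ [n _ <-].
have [|g Lg sg] := complete Ls.
  move=> r r0; have /cvgrPdist_le/(_ r r0)[N _ HN] := pcvg.
  exists N => m n; wlog mn : m n / (m <= n)%N => [H Nm Nn|Nm Nn].
    have [mn|/ltnW mn] := leqP m n; first exact: H.
    by rewrite -opprB BN ?[B _ (- _)]BC ?BN ?opprK//; try exact: H; try exact: LB; exact/LN/LB.
  rewrite -opprB BN ?[B _ (- _)]BC ?BN ?opprK//; try exact: LB; try exact/LN/LB.
  rewrite qss//; have := HN _ Nm; have := nondecreasing_cvgn_le pnd pcvg n.
  by rewrite ler_norml => ? /andP[]; lra.
have Bge i : B (e i) g = B (e i) f.
  rewrite BC; apply: (B_lim Lg (Le i) Ls sg); exists i.+1 => n ni.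
  by rewrite BC Bse ni mul1r.
have q0 : B (f - g) (f - g) = 0.
  apply: e_total; first exact: LB.
  by move=> i; rewrite BC BB// (BC f) (BC g) Bge subrr.
apply/cvgrPdist_le => r r0; have [|N HN] := sg (r / 2); first by rewrite divr_gt0.
exists N => // n /= Nn; rewrite -/(p n) -qfs ger0_norm//.
rewrite (_ : f - s n = (f - g) + - (s n - g)); last by rewrite opprB addrA subrK.
apply: (le_trans (qD2 (LB Lf Lg) (LN (LB (Ls n) Lg)))).
rewrite q0 BN ?[B _ (- _)]BC ?BN ?opprK//; try exact: LB; try exact/LN/LB.
by have := HN _ Nn; lra.
Qed.
End parseval.
End semi_hilbert.

(** * Square integrable functions *)

Lemma lim_cst_of_dvg {R : realType} (u : nat -> R) : ~ cvgn u -> limn u = point.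
Proof.
by move=> nc; apply: dvgP.
Qed.

Section measurable_limn.
Context d (T : measurableType d) (R : realType) (h : nat -> T -> R).
Hypothesis mh : forall n, measurable_fun setT (h n).

(** Cauchy's criterion with the tolerances 1/(m+1) involves only countably many conditions. *)
Lemma measurable_cvgn : measurable [set x | cvgn (h ^~ x)].
Proof.
rewrite (_ : [set x | _] = \bigcap_(m : nat) \bigcup_(N : nat)
    \bigcap_(n : nat) [set x | `|h (n + N)%N x - h N x| <= m.+1%:R^-1]).
  apply: bigcapT_measurable => m; apply: bigcupT_measurable => N.
  apply: bigcapT_measurable => n; rewrite -[X in measurable X]setTI.
  have mf : measurable_fun setT (fun x => `|h (n + N)%N x - h N x|).
    by apply: measurableT_comp => //; exact: measurable_funB.
  rewrite (_ : [set x | _] = (fun x => `|h (n + N)%N x - h N x|) @^-1` [set` `]-oo, m.+1%:R^-1]]).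
    by apply: mf => //; exact: measurable_itv.
  by apply/seteqP; split => x /=; rewrite in_itv.
apply/seteqP; split => x /=.
  move=> /cvg_ex[l /cvgrPdist_le H] m _.
  have [|N _ HN] := H (m.+1%:R^-1 / 2); first by rewrite divr_gt0 ?invr_gt0.
  exists N => // n _ /=; have := HN (n + N)%N (leq_addl _ _); have := HN N (leqnn N).
  rewrite (_ : h (n + N)%N x - h N x = (l - h N x) - (l - h (n + N)%N x)); last by ring.
  by move=> a b; apply: (le_trans (ler_normB _ _)); set z := m.+1%:R^-1 in a b *; lra.
move=> H; apply: cauchy_cvg; apply: cauchy_exP => e e0.
have [m _ Hm] := near_infty_natSinv_lt (PosNum e0).
have [N _ HN] := H m I.
exists (h N x); exists N => // n /= Nn; rewrite /ball/= distrC.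
rewrite -(subnK Nn); apply: (le_lt_trans (HN (n - N)%N I)).
exact: (Hm m (leqnn m)).
Qed.

(** [limn] takes the constant value [point] at the points of divergence, which form a measurable
    set. *)
Lemma measurable_fun_limn : measurable_fun setT (fun x => limn (h ^~ x)).
Proof.
rewrite -(setvU [set x | cvgn (h ^~ x)]) setUC.
apply/measurable_funU; [exact: measurable_cvgn|exact/measurableC/measurable_cvgn|split].
  apply: (@measurable_fun_cvg _ _ _ _ h).
    by move=> n; exact: measurable_funTS.
  by move=> x /= cx.
apply: (eq_measurable_fun (cst point)) => // x; rewrite inE /= => nc.
by rewrite lim_cst_of_dvg.
Qed.

End measurable_limn.

Section sqint.
Context d (T : measurableType d) (R : realType) (mu : {measure set T -> \bar R}).
Implicit Types f g : T -> R.

Definition sqint f :=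
  measurable_fun setT f /\ (\int[mu]_x (f x ^+ 2)%:E < +oo)%E.

Definition rip f g : R := \int[mu]_x (f x * g x).

Lemma sqintP f : measurable_fun setT f ->
  sqint f <-> mu.-integrable setT (fun x => (f x ^+ 2)%:E).
Proof.
move=> mf; split=> [[_ foo]|/integrableP[_ foo]].
  apply/integrableP; split; first exact/measurable_EFinP/measurable_funX.
  by under eq_integral do rewrite gee0_abs ?lee_fin ?sqr_ge0//.
split => //; move: foo.
by under eq_integral do rewrite gee0_abs ?lee_fin ?sqr_ge0//.
Qed.

Lemma sqint_integrable f : sqint f ->
  mu.-integrable setT (fun x => (f x ^+ 2)%:E).
Proof. by move=> [mf foo]; apply/sqintP. Qed.

Lemma sqint_measurable f : sqint f -> measurable_fun setT f.
Proof. by case. Qed.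

Lemma sqint_le f g : measurable_fun setT f -> sqint g ->
  (forall x, `|f x| <= `|g x|) -> sqint f.
Proof.
move=> mf [mg goo] fg; split => //; apply: le_lt_trans goo.
apply: ge0_le_integral => //.
- by move=> x _; rewrite lee_fin sqr_ge0.
- exact/measurable_EFinP/measurable_funX.
- exact/measurable_EFinP/measurable_funX.
- move=> x _; rewrite lee_fin -(real_normK (num_real (f x))).
  by rewrite -(real_normK (num_real (g x))) ler_sqr ?nnegrE.
Qed.

Lemma sqintM_integrable f g : sqint f -> sqint g ->
  mu.-integrable setT (fun x => (f x * g x)%:E).
Proof.
move=> sf sg; have [mf _] := sf; have [mg _] := sg.
apply: (@le_integrable _ _ _ _ _ measurableT _ (fun x => (f x ^+ 2)%:E + (g x ^+ 2)%:E)%E).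
- exact/measurable_EFinP/measurable_funM.
- move=> x _; rewrite abse_EFin -EFinD abse_EFin lee_fin.
  rewrite [leRHS]ger0_norm ?addr_ge0 ?sqr_ge0// ler_norml.
  have := sqr_ge0 (f x - g x); have := sqr_ge0 (f x + g x).
  have := sqr_ge0 (f x); have := sqr_ge0 (g x).
  by rewrite sqrrB sqrrD => *; apply/andP; split; lra.
- exact: (integrableD measurableT (sqint_integrable sf) (sqint_integrable sg)).
Qed.

Lemma sqintZ a f : sqint f -> sqint (fun x => a * f x).
Proof.
move=> [mf foo]; have ma : measurable_fun setT (fun x => a * f x).
  exact: measurable_funM.
split => //; under eq_integral do rewrite exprMn EFinM.
rewrite ge0_integralZl//; last by rewrite lee_fin sqr_ge0.
- by rewrite lte_mul_pinfty ?lee_fin ?sqr_ge0.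
- exact/measurable_EFinP/measurable_funX.
- by move=> x _; rewrite lee_fin sqr_ge0.
Qed.

Lemma sqintN f : sqint f -> sqint (- f).
Proof.
move=> /(sqintZ (-1)); congr sqint; apply/funext => x.
by rewrite mulN1r.
Qed.

Lemma sqintD f g : sqint f -> sqint g -> sqint (f + g).
Proof.
move=> sf sg; have [mf _] := sf; have [mg _] := sg.
apply/sqintP; first exact: measurable_funD.
apply: (@le_integrable _ _ _ _ _ measurableT _
    (fun x => (2 * f x ^+ 2)%:E + (2 * g x ^+ 2)%:E)%E).
- exact/measurable_EFinP/measurable_funX/measurable_funD.
- move=> x _; rewrite abse_EFin -EFinD abse_EFin lee_fin.
  rewrite ger0_norm ?sqr_ge0// ger0_norm; last first.
    by apply: addr_ge0; apply: mulr_ge0; rewrite // sqr_ge0.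
  have := sqr_ge0 (f x - g x).
  by rewrite fctE sqrrB sqrrD; lra.
- have I2 h : sqint h -> mu.-integrable setT (fun x => (2 * h x ^+ 2)%:E).
    move=> sh; under eq_fun do rewrite EFinM.
    by apply: integrableZl => //; exact: sqint_integrable.
  exact: (integrableD measurableT (I2 _ sf) (I2 _ sg)).
Qed.

Lemma sqint0 : sqint 0.
Proof.
split; first exact: measurable_cst.
by under eq_integral do rewrite expr0n; rewrite integral0.
Qed.

Lemma ripC f g : rip f g = rip g f.
Proof. by apply: eq_Rintegral => x _; rewrite mulrC. Qed.

Lemma ripDl f g h : sqint f -> sqint g -> sqint h ->
  rip (f + g) h = rip f h + rip g h.
Proof.
move=> sf sg sh; rewrite /rip -RintegralD//; try exact: sqintM_integrable.
by apply: eq_Rintegral => x _; rewrite -mulrDl.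
Qed.

Lemma ripZl a f g : sqint f -> sqint g -> rip (fun x => a * f x) g = a * rip f g.
Proof.
move=> sf sg; rewrite /rip -RintegralZl//; last exact: sqintM_integrable.
by apply: eq_Rintegral => x _; rewrite mulrA.
Qed.

Lemma rip_ge0 f : 0 <= rip f f.
Proof. by apply: Rintegral_ge0 => x _; rewrite -expr2 sqr_ge0. Qed.

Lemma EFin_rip f : sqint f -> ((rip f f)%:E = \int[mu]_x (f x ^+ 2)%:E)%E.
Proof.
move=> sf; rewrite /rip /Rintegral fineK; first exact: eq_integral.
by apply: integrable_fin_num => //; exact: sqintM_integrable.
Qed.

Lemma rip_eq0 f : sqint f -> rip f f = 0 -> {ae mu, forall x, f x = 0}.
Proof.
move=> sf f0; have := EFin_rip sf; rewrite f0 => /esym I0.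
have [mf _] := sf.
have : ae_eq mu setT (fun x => (f x ^+ 2)%:E) (cst 0%E).
  apply/ae_eq_integral_abs => //; first exact/measurable_EFinP/measurable_funX.
  by under eq_integral do rewrite gee0_abs ?lee_fin ?sqr_ge0//.
apply: filterS => x /(_ I) [] /eqP; rewrite sqrf_eq0 => /eqP//.
Qed.

(** Riesz-Fischer in sequential form: a fast subsequence converges almost everywhere, and Fatou's
    lemma bounds the distance of [u n] to its pointwise limit. *)
Lemma sqint_complete (u : nat -> T -> R) : (forall n, sqint (u n)) ->
  (forall e, 0 < e -> exists N, forall m n, (N <= m)%N -> (N <= n)%N ->
     rip (u m - u n) (u m - u n) <= e) ->
  exists2 g, sqint g & forall e, 0 < e -> exists N, forall n, (N <= n)%N ->
     rip (u n - g) (u n - g) <= e.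
Proof.
move=> su cu; have mu_ n := sqint_measurable (su n).
have sB f g : sqint f -> sqint g -> sqint (f - g).
  by move=> sf sg; exact/sqintD/sqintN.
(* Tolerances 8^-k leave room for a weight 4^k: the weighted squared increments have integrals at
   most 2^-k, which is summable, and the weight makes the increments themselves geometrically small
   at almost every point. *)
pose N k := projT1 (cid (cu (8 ^- k) ltac:(by rewrite invr_gt0 exprn_gt0))).
have HN k m n : (N k <= m)%N -> (N k <= n)%N ->
    rip (u m - u n) (u m - u n) <= 8 ^- k.
  by rewrite /N; case: cid => //= N0 H; exact: H.
pose s k := (\sum_(i < k.+1) (N i).+1)%N.
have sk k : (k <= s k)%N.
  elim: k => // k IH; rewrite /s big_ord_recr/=.
  by rewrite (leq_ltn_trans IH)// -[ltnLHS]addn0 ltn_add2l.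
have sN k : (N k <= s k)%N by rewrite /s big_ord_recr/= (leq_trans (leqnSn _))// leq_addl.
have sS k : (s k <= s k.+1)%N by rewrite /s [leqRHS]big_ord_recr leq_addr.
have snd i j : (i <= j)%N -> (s i <= s j)%N.
  by move=> /subnK <-; elim: (j - i)%N => //= k IH; exact: leq_trans IH (sS _).
pose v k := u (s k).
have mv k : measurable_fun setT (v k) by exact: mu_.
have mvB k l : measurable_fun setT (fun x => v k x - v l x) by exact: measurable_funB.
pose w k (x : T) := (4 ^+ k * (v k.+1 x - v k x) ^+ 2)%:E.
have w0 k x : (0 <= w k x)%E by rewrite lee_fin mulr_ge0 ?sqr_ge0 ?exprn_ge0.
have mw k : measurable_fun setT (w k).
  apply/measurable_EFinP/measurable_funM => //.
  by apply: measurable_funX; try exact: mvB; apply: measurable_funB.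
have Iw k : (\int[mu]_x w k x <= (2 ^- k)%:E)%E.
  rewrite /w; under eq_integral do rewrite EFinM.
  rewrite ge0_integralZl ?lee_fin ?exprn_ge0//; last 2 first.
    by apply/measurable_EFinP/measurable_funX; try exact: mvB; apply: measurable_funB.
    by move=> x _; rewrite lee_fin sqr_ge0.
  rewrite -[X in (_ * X)%E](EFin_rip (sB _ _ (su _) (su _))) -EFinM lee_fin.
  have := HN k _ _ (leq_trans (sN k) (sS k)) (sN k) => h.
  apply: (@le_trans _ _ (4 ^+ k * 8 ^- k)).
    by rewrite ler_wpM2l ?exprn_ge0.
  by rewrite -exprVn -exprMn (_ : 4 * 8^-1 = 2^-1 :> R) ?exprVn//; lra.
have Ioo : (\int[mu]_x (\sum_(0 <= k <oo) w k x) < +oo)%E.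
  rewrite integral_nneseries//.
  apply: (@le_lt_trans _ _ (\sum_(0 <= k <oo) (2 ^- k)%:E)%E).
    by apply: lee_nneseries => // k _ _; exact: integral_ge0.
  apply: (@le_lt_trans _ _ (2 : R)%:E); last by rewrite ltry.
  apply: lime_le; first by apply: is_cvg_nneseries => *; rewrite lee_fin.
  apply: nearW => n; rewrite sumEFin lee_fin.
  rewrite (_ : (\sum_(0 <= k < n) 2 ^- k) = 2 - 2 * 2 ^- n :> R).
    by rewrite gerBl mulr_ge0// invr_ge0 exprn_ge0.
  elim: n => [|n IH]; first by rewrite big_geq// expr0 invr1; ring.
  rewrite big_nat_recr//= IH -exprVn exprS exprVn.
  by rewrite addrAC -addrA; congr (_ + _); field; rewrite expf_neq0.
have aecv : {ae mu, forall x, cvgn (v ^~ x)}.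
  have mW : measurable_fun setT (fun x => \sum_(0 <= k <oo) w k x)%E.
    exact: ge0_emeasurable_sum.
  have : {ae mu, forall x, setT x -> (\sum_(0 <= k <oo) w k x)%E \is a fin_num}.
    apply: integrable_ae => //; apply/integrableP; split => //.
    by under eq_integral do rewrite gee0_abs ?nneseries_ge0//.
  apply: filterS => x /(_ I) fx.
  pose M := fine (\sum_(0 <= k <oo) w k x)%E.
  have wM k : 4 ^+ k * (v k.+1 x - v k x) ^+ 2 <= M.
    rewrite -lee_fin fineK// -/(w k x).
    apply: le_trans (nneseries_lim_ge k.+1 _) => //.
    by rewrite big_nat_recr//= leeDr// sume_ge0.
  have dM k : `|v k.+1 x - v k x| <= Num.sqrt M * 2 ^- k.
    rewrite -ler_sqr ?nnegrE ?mulr_ge0 ?sqrtr_ge0 ?invr_ge0 ?exprn_ge0//.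
    have M0 : 0 <= M.
      by apply: le_trans (wM 0%N); rewrite mulr_ge0 ?sqr_ge0 ?exprn_ge0.
    rewrite real_normK ?num_real// exprMn sqr_sqrtr//.
    rewrite exprVn -exprM mulnC exprM (_ : 2 ^+ 2 = 4 :> R); last by rewrite expr2; lra.
    by rewrite ler_pdivlMr ?exprn_gt0// mulrC.
  have : cvgn (series (telescope (v ^~ x))).
    apply: normed_cvg; apply: (@series_le_cvg _ _ (geometric (Num.sqrt M) (2^-1))).
    - by move=> k /=.
    - by move=> k; rewrite /= mulr_ge0 ?sqrtr_ge0 ?exprn_ge0.
    - by move=> k; rewrite /= /telescope exprVn; exact: dM.
    - by apply: is_cvg_geometric_series; rewrite ger0_norm; lra.
  rewrite telescopeK => /cvg_ex[l vl]; apply/cvg_ex; exists (l + v 0%N x).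
  rewrite (_ : v ^~ x = (fun n => v n x - v 0%N x + v 0%N x)).
    by apply: cvgD => //; exact: cvg_cst.
  by apply/funext => n; rewrite subrK.
pose g x := limn (v ^~ x).
have mg : measurable_fun setT g by apply: measurable_fun_limn => n; exact: mu_.
have key e n k : (forall m, (k <= m)%N -> rip (u n - u m) (u n - u m) <= e) ->
    (\int[mu]_x ((u n x - g x) ^+ 2)%:E <= e%:E)%E.
  move=> H.
  (* The term [v (j + k)] is some [u m] with [k <= m], so the hypothesis bounds the integral of
     every [f j]. *)
  pose f j x := ((u n x - v (j + k)%N x) ^+ 2)%:E.
  have mf j : measurable_fun setT (f j).
    by apply/measurable_EFinP/measurable_funX; try exact: mvB; apply: measurable_funB.
  have -> : (\int[mu]_x ((u n x - g x) ^+ 2)%:E = \int[mu]_x limn_einf (f ^~ x))%E.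
    apply: ge0_ae_eq_integral => //.
    - by apply/measurable_EFinP/measurable_funX; try exact: mvB; apply: measurable_funB.
    - under eq_fun do rewrite -[limn_einf _]oppeK -limn_esupN.
      apply: measurableT_comp => //; apply: measurable_fun_limn_esup => j.
      exact: measurableT_comp.
    - by move=> x _; rewrite lee_fin sqr_ge0.
    - move=> x _; rewrite limn_einf_lim; apply: lime_ge; first exact: is_cvg_einfs.
      by apply: nearW => j; apply: le_ereal_inf_tmp => _ [i _ <-]; rewrite lee_fin sqr_ge0.
    apply: filterS aecv => x cx _; apply/esym.
    apply: (cvg_limn_einf_sup _).1; apply: cvg_EFin; first exact: nearW.
    rewrite /f /= (_ : _ \o _ = (fun j => (u n x - v (j + k)%N x) ^+ 2))//.
    have cv : (fun j => u n x - v (j + k)%N x) @ \oo --> u n x - g x.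
      apply: cvgB; first exact: cvg_cst.
      by rewrite (@cvg_shiftn _ _ (v ^~ x)).
    exact: (cvgM cv cv).
  apply: (le_trans (fatou _ _ _ _)) => //.
    by move=> *; rewrite lee_fin sqr_ge0.
  rewrite limn_einf_lim; apply: lime_le; first exact: is_cvg_einfs.
  apply: nearW => j; apply: ge_ereal_inf.
  exists (\int[mu]_x f j x)%E; first by exists j => /=.
  rewrite /f -[leLHS](EFin_rip (sB _ _ (su _) (su _))) lee_fin.
  by apply: H; rewrite (leq_trans _ (sk _))// leq_addl.
have key2 e n k : (forall m, (k <= m)%N -> rip (u n - u m) (u n - u m) <= e) ->
    sqint (u n - g) /\ rip (u n - g) (u n - g) <= e.
  move=> H; have ug : sqint (u n - g).
    split; first exact: measurable_funB.
    by apply: le_lt_trans (key _ _ _ H) _; rewrite ltry.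
  by split => //; rewrite -lee_fin EFin_rip//; exact: key H.
have sg : sqint g.
  have [N1 H1] := cu 1 ltr01.
  have [] := @key2 1 N1 N1; first by move=> m Nm; exact: H1.
  move=> /sqintN; rewrite opprB => /sqintD/(_ (su N1)).
  by rewrite subrK.
exists g => // e e0; have [N1 H1] := cu e e0; exists N1 => n Nn.
by apply: (key2 _ _ N1 _).2 => m Nm; exact: H1.
Qed.

End sqint.

Section prodm.
Context d1 d2 (X : measurableType d1) (Y : measurableType d2) (R : realType).
Variables (mu : {sigma_finite_measure set X -> \bar R}).
Variables (rho : {sigma_finite_measure set Y -> \bar R}).

(* The library's instance does not present [mu \x rho] as a sigma-finite
   measure, which iterated products require. *)
Definition prodm : set (X * Y)%type -> \bar R := (mu \x rho)%E.

HB.instance Definition _ := Measure.copy prodm (mu \x rho)%E.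

Let prodm_sigma_finite : sigma_finite setT prodm.
Proof.
have /sigma_finiteP[F [TF ndF Foo]] := sigma_finiteT mu.
have /sigma_finiteP[G [TG ndG Goo]] := sigma_finiteT rho.
exists (fun n => F n `*` G n).
  rewrite -setXTT TF TG predeqE => -[x y]; split.
    move=> [/= [n _ Fnx] [k _ Gky]]; exists (maxn n k) => //; split.
    - by move: x Fnx; exact/subsetPset/ndF/leq_maxl.
    - by move: y Gky; exact/subsetPset/ndG/leq_maxr.
  by move=> [n _ []/= ? ?]; split; exists n.
move=> k; have [? ?] := Foo k; have [? ?] := Goo k.
split; first exact: measurableX.
by rewrite /prodm product_measure1E// lte_mul_pinfty// ge0_fin_numE.
Qed.

HB.instance Definition _ := Measure_isSigmaFinite.Build _ _ _ prodm
  prodm_sigma_finite.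

End prodm.

Section ae_Rintegral.
Context d (T : measurableType d) (R : realType) (mu : {measure set T -> \bar R}).

Lemma ae_eq_Rintegral (f g : T -> R) :
  measurable_fun setT f -> measurable_fun setT g ->
  {ae mu, forall x, f x = g x} -> \int[mu]_x f x = \int[mu]_x g x.
Proof.
move=> mf mg fg; congr fine; apply: ae_eq_integral => //.
- exact/measurable_EFinP.
- exact/measurable_EFinP.
- by apply: filterS fg => x -> _.
Qed.

Lemma ae_integrable (f g : T -> R) : measurable_fun setT g ->
  {ae mu, forall x, f x = g x} ->
  mu.-integrable setT (EFin \o f) -> mu.-integrable setT (EFin \o g).
Proof.
move=> mg fg /integrableP[mf foo]; apply/integrableP; split.
  exact/measurable_EFinP.
rewrite (_ : integral _ _ _ = \int[mu]_x `|(EFin \o f) x|)%E//.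
apply: ge0_ae_eq_integral => //.
- by apply: measurableT_comp => //; exact/measurable_EFinP.
- by apply: measurableT_comp => //; exact/measurable_EFinP.
- by apply: filterS fg => x /= -> _.
Qed.

End ae_Rintegral.

(** * Fubini's theorem for real-valued integrals *)

Section fubini_real.
Context d1 d2 (X : measurableType d1) (Z : measurableType d2) (R : realType).
Variables (mu : {sigma_finite_measure set X -> \bar R}).
Variables (nu : {sigma_finite_measure set Z -> \bar R}).
Implicit Types h : X * Z -> R.

Lemma measurable_secx h z : measurable_fun setT h ->
  measurable_fun setT (fun x => h (x, z)).
Proof. by move=> mh; exact: measurableT_comp mh (pair2_measurable z). Qed.

Lemma measurable_secy h x : measurable_fun setT h ->
  measurable_fun setT (fun z => h (x, z)).
Proof. by move=> mh; exact: measurableT_comp mh (pair1_measurable x). Qed.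

(** Tonelli applies to the positive and negative parts, and [fine] is measurable; slices whose
    integral is not finite are included, with the value that [fine] assigns to them. *)
Lemma measurable_intx h : measurable_fun setT h ->
  measurable_fun setT (fun z => \int[mu]_x h (x, z)).
Proof.
move=> mh; apply: (measurableT_comp (fine_measurable measurableT)).
under eq_fun do rewrite integralE.
apply: emeasurable_funB.
  have mp : measurable_fun setT ((EFin \o h)^\+)%E.
    exact/measurable_funepos/measurable_EFinP.
  have := @measurable_fun_fubini_tonelli_G _ _ _ _ _ mu _ mp (fun=> funepos_ge0 _ _).
  by congr measurable_fun; apply/funext => t; apply: eq_integral => u _; rewrite !funeposE.
have mp : measurable_fun setT ((EFin \o h)^\-)%E.
  exact/measurable_funeneg/measurable_EFinP.
have := @measurable_fun_fubini_tonelli_G _ _ _ _ _ mu _ mp (fun=> funeneg_ge0 _ _).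
by congr measurable_fun; apply/funext => t; apply: eq_integral => u _; rewrite !funenegE.
Qed.

Lemma measurable_inty h : measurable_fun setT h ->
  measurable_fun setT (fun x => \int[nu]_z h (x, z)).
Proof.
move=> mh; apply: (measurableT_comp (fine_measurable measurableT)).
under eq_fun do rewrite integralE.
apply: emeasurable_funB.
  have mp : measurable_fun setT ((EFin \o h)^\+)%E.
    exact/measurable_funepos/measurable_EFinP.
  have := @measurable_fun_fubini_tonelli_F _ _ _ _ _ nu _ mp (fun=> funepos_ge0 _ _).
  by congr measurable_fun; apply/funext => t; apply: eq_integral => u _; rewrite !funeposE.
have mp : measurable_fun setT ((EFin \o h)^\-)%E.
  exact/measurable_funeneg/measurable_EFinP.
have := @measurable_fun_fubini_tonelli_F _ _ _ _ _ nu _ mp (fun=> funeneg_ge0 _ _).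
by congr measurable_fun; apply/funext => t; apply: eq_integral => u _; rewrite !funenegE.
Qed.

Section integrable.
Variable h : X * Z -> R.
Hypothesis ih : (mu \x nu)%E.-integrable setT (EFin \o h).

Let mh : measurable_fun setT h.
Proof. by apply/measurable_EFinP; case/integrableP: ih. Qed.

Lemma ae_integrable_secx : {ae nu, forall z, mu.-integrable setT (fun x => (h (x, z))%:E)}.
Proof. exact: (ae_integrable2 ih). Qed.

Lemma ae_integrable_secy : {ae mu, forall x, nu.-integrable setT (fun z => (h (x, z))%:E)}.
Proof. exact: (ae_integrable1 ih). Qed.

Let aex : {ae nu, forall z, (\int[mu]_x h (x, z))%R%:E = (\int[mu]_x (h (x, z))%:E)%E}.
Proof.
apply: filterS ae_integrable_secx => z iz.
by rewrite /Rintegral fineK// integrable_fin_num.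
Qed.

Let aey : {ae mu, forall x, (\int[nu]_z h (x, z))%R%:E = (\int[nu]_z (h (x, z))%:E)%E}.
Proof.
apply: filterS ae_integrable_secy => z iz.
by rewrite /Rintegral fineK// integrable_fin_num.
Qed.

Lemma Rfubini_intx : \int[(mu \x nu)%E]_p h p = \int[nu]_z (\int[mu]_x h (x, z)).
Proof.
rewrite [in LHS]/Rintegral -(integral21_prod_meas1 ih) {1}/Rintegral.
congr fine; apply: ae_eq_integral => //.
- exact: (measurable_fubini_G ih).
- exact/measurable_EFinP/measurable_intx.
- by apply: filterS aex => z -> _.
Qed.

Lemma Rfubini_inty : \int[(mu \x nu)%E]_p h p = \int[mu]_x (\int[nu]_z h (x, z)).
Proof.
rewrite [in LHS]/Rintegral -(integral12_prod_meas1 ih) {1}/Rintegral.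
congr fine; apply: ae_eq_integral => //.
- exact: (measurable_fubini_F ih).
- exact/measurable_EFinP/measurable_inty.
- by apply: filterS aey => z -> _.
Qed.

Lemma integrable_intx : nu.-integrable setT (fun z => (\int[mu]_x h (x, z))%:E).
Proof.
have mE : measurable_fun setT (fun z => (\int[mu]_x h (x, z))%R%:E).
  exact/measurable_EFinP/measurable_intx.
apply/integrableP; split => //.
rewrite (_ : integral _ _ _ =
    (\int[nu]_z `|\int[mu]_x (h (x, z))%:E|)%E); last first.
  apply: ge0_ae_eq_integral => //.
  - exact: measurableT_comp.
  - by apply: measurableT_comp => //; exact: (measurable_fubini_G ih).
  - by apply: filterS aex => z -> _.
have /integrable21ltyP := ih => /(_ (measurable_int _ ih)) /(le_lt_trans _); apply.
apply: ge0_le_integral => //.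
- by apply: measurableT_comp => //; exact: (measurable_fubini_G ih).
- apply: (measurable_fun_fubini_tonelli_G (fun p => `|(EFin \o h) p|)%E) => //.
  by apply: measurableT_comp => //; exact/measurable_EFinP.
- move=> z _; apply: le_abse_integral => //.
  by apply/measurable_EFinP; exact: measurable_secx.
Qed.

Lemma integrable_inty : mu.-integrable setT (fun x => (\int[nu]_z h (x, z))%:E).
Proof.
have mE : measurable_fun setT (fun x => (\int[nu]_z h (x, z))%R%:E).
  exact/measurable_EFinP/measurable_inty.
apply/integrableP; split => //.
rewrite (_ : integral _ _ _ =
    (\int[mu]_x `|\int[nu]_z (h (x, z))%:E|)%E); last first.
  apply: ge0_ae_eq_integral => //.
  - exact: measurableT_comp.
  - by apply: measurableT_comp => //; exact: (measurable_fubini_F ih).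
  - by apply: filterS aey => z -> _.
have /integrable12ltyP := ih => /(_ (measurable_int _ ih)) /(le_lt_trans _); apply.
apply: ge0_le_integral => //.
- by apply: measurableT_comp => //; exact: (measurable_fubini_F ih).
- apply: (measurable_fun_fubini_tonelli_F (fun p => `|(EFin \o h) p|)%E) => //.
  by apply: measurableT_comp => //; exact/measurable_EFinP.
- move=> z _; apply: le_abse_integral => //.
  by apply/measurable_EFinP; exact: measurable_secy.
Qed.

End integrable.

Lemma ae_prodx (P : X -> Prop) : {ae mu, forall x, P x} ->
  {ae (mu \x nu)%E, forall p, P p.1}.
Proof.
move=> [N [mN N0 PN]]; exists (N `*` setT); split.
- exact: measurableX.
- by rewrite product_measure1E// [X in (X * _)%E](_ : _ = 0%E) ?mul0e.
- by move=> [x z] /= nP; split => //=; exact: PN.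
Qed.

Lemma ae_prody (P : Z -> Prop) : {ae nu, forall z, P z} ->
  {ae (mu \x nu)%E, forall p, P p.2}.
Proof.
move=> [N [mN N0 PN]]; exists (setT `*` N); split.
- exact: measurableX.
- by rewrite product_measure1E// [X in (_ * X)%E](_ : _ = 0%E) ?mule0.
- by move=> [x z] /= nP; split => //=; exact: PN.
Qed.

Lemma ae_secy (P : X * Z -> Prop) : {ae (mu \x nu)%E, forall p, P p} ->
  {ae mu, forall x, {ae nu, forall z, P (x, z)}}.
Proof.
move=> [N [mN N0 PN]].
have H : (\int[mu]_x `|(nu \o xsection N) x|)%E = 0%E.
  by rewrite -[RHS]N0; apply: eq_integral => x _; rewrite gee0_abs.
have mX : measurable_fun setT (nu \o xsection N) by exact: measurable_fun_xsection.
have := (ae_eq_integral_abs mu measurableT mX).1 H.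
apply: filterS => x /(_ I) /= Nx; exists (xsection N x); split => //.
  exact: measurable_xsection.
by move=> z /= nP; rewrite /xsection /= inE; exact: PN.
Qed.

End fubini_real.

(** * Hilbert-Schmidt kernels *)

Lemma eseries_EFin {R : realType} (u : nat -> R) (l : R) :
  series u @ \oo --> l -> (\sum_(0 <= k <oo) (u k)%:E = l%:E)%E.
Proof.
move=> ul; apply: cvg_lim => //; apply: cvg_EFin; first by apply: nearW => n; rewrite sumEFin.
apply: cvg_trans ul; apply: near_eq_cvg; apply: nearW => n.
by rewrite /= sumEFin.
Qed.

Lemma cvg_series_EFin {R : realType} (u : nat -> R) (l : R) :
  (forall k, 0 <= u k) -> (\sum_(0 <= k <oo) (u k)%:E = l%:E)%E ->
  series u @ \oo --> l.
Proof.
move=> u0 ul.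
have : (fun n => \sum_(0 <= k < n) (u k)%:E)%E @ \oo --> l%:E.
  by rewrite -ul; apply: is_cvg_nneseries => *; rewrite lee_fin.
move=> /fine_cvg; apply: cvg_trans; apply: near_eq_cvg; apply: nearW => n.
by rewrite /= sumEFin.
Qed.

Section sqint_more.
Context d (T : measurableType d) (R : realType) (mu : {measure set T -> \bar R}).
Implicit Types f g : T -> R.

Lemma sqintB f g : sqint mu f -> sqint mu g -> sqint mu (f - g).
Proof. by move=> sf sg; exact/sqintD/sqintN. Qed.

Lemma rip_CS f g : sqint mu f -> sqint mu g ->
  rip mu f g ^+ 2 <= rip mu f f * rip mu g g.
Proof.
move=> sf sg.
apply: (@semi_CS R _ (fun a f x => a * f x) (sqint mu) (rip mu)) => //.
- exact: sqint0.
- exact: sqintD.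
- exact: sqintN.
- exact: sqintZ.
- exact: ripC.
- exact: ripDl.
- exact: ripZl.
- exact: rip_ge0.
Qed.

Lemma ripDr f g h : sqint mu f -> sqint mu g -> sqint mu h ->
  rip mu h (f + g) = rip mu h f + rip mu h g.
Proof. by move=> *; rewrite ripC ripDl// !(ripC _ h). Qed.

Lemma ripNl f g : sqint mu f -> sqint mu g -> rip mu (- f) g = - rip mu f g.
Proof.
move=> sf sg; rewrite -[RHS]mulN1r -ripZl//; congr rip; apply/funext => x.
by rewrite mulN1r.
Qed.

Lemma ripBl f g h : sqint mu f -> sqint mu g -> sqint mu h ->
  rip mu (f - g) h = rip mu f h - rip mu g h.
Proof. by move=> sf sg sh; rewrite ripDl ?ripNl//; exact: sqintN. Qed.

Lemma ripBr f g h : sqint mu f -> sqint mu g -> sqint mu h ->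
  rip mu h (f - g) = rip mu h f - rip mu h g.
Proof. by move=> *; rewrite ripC ripBl// !(ripC _ h). Qed.

Lemma rip_sqrD f g : sqint mu f -> sqint mu g ->
  rip mu (f + g) (f + g) = rip mu f f + 2 * rip mu f g + rip mu g g.
Proof.
by move=> sf sg; have sfg := sqintD sf sg; rewrite ripDl// !ripDr// (ripC mu g f); ring.
Qed.

Lemma rip_sqrB f g : sqint mu f -> sqint mu g ->
  rip mu (f - g) (f - g) = rip mu f f - 2 * rip mu f g + rip mu g g.
Proof.
by move=> sf sg; have sfg := sqintB sf sg; rewrite ripBl// !ripBr// (ripC mu g f); ring.
Qed.

Lemma ae_eq_rip f f' g g' : measurable_fun setT f -> measurable_fun setT f' ->
  measurable_fun setT g -> measurable_fun setT g' ->
  {ae mu, forall x, f x = f' x} -> {ae mu, forall x, g x = g' x} ->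
  rip mu f g = rip mu f' g'.
Proof.
move=> mf mf' mg mg' ff gg; apply: ae_eq_Rintegral; try exact: measurable_funM.
by apply: filterS2 ff gg => x -> ->.
Qed.

End sqint_more.

Section product.
Context d1 d2 (X : measurableType d1) (Z : measurableType d2) (R : realType).
Variables (mu : {sigma_finite_measure set X -> \bar R}).
Variables (nu : {sigma_finite_measure set Z -> \bar R}).
Local Notation mn := (mu \x nu)%E.
Implicit Types (w : X * Z -> R) (a : X -> R) (b : Z -> R).

Definition tens a b : X * Z -> R := fun p => a p.1 * b p.2.
(** For square integrable [w] these are the Hilbert-Schmidt operator with kernel [w], from functions
    on X to functions on Z, and its transpose [opT']. *)
Definition opT w a : Z -> R := fun z => \int[mu]_x (w (x, z) * a x).
Definition opT' w b : X -> R := fun x => \int[nu]_z (w (x, z) * b z).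

Lemma measurable_tens a b : measurable_fun setT a -> measurable_fun setT b ->
  measurable_fun setT (tens a b).
Proof. by move=> ma mb; apply: measurable_funM; exact: measurableT_comp. Qed.

Lemma tens_integrable a b : mu.-integrable setT (EFin \o a) ->
  nu.-integrable setT (EFin \o b) -> mn.-integrable setT (EFin \o tens a b).
Proof.
move=> /integrableP[/measurable_EFinP ma aoo] /integrableP[/measurable_EFinP mb boo].
apply/integrable12ltyP; first by apply/measurable_EFinP; exact: measurable_tens.
rewrite (_ : integral _ _ _ = ((\int[nu]_y `|(b y)%:E|) * \int[mu]_x `|(a x)%:E|)%E).
  by rewrite lte_mul_pinfty// ?integral_ge0// ge0_fin_numE// integral_ge0.
rewrite -ge0_integralZl//; last 2 first.
  by apply: measurableT_comp => //; exact/measurable_EFinP.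
  by rewrite integral_ge0.
apply: eq_integral => x _; rewrite muleC -ge0_integralZl//; last first.
  by apply: measurableT_comp => //; exact/measurable_EFinP.
by apply: eq_integral => z _; rewrite -abseM.
Qed.

Lemma Rintegral_tens a b : mu.-integrable setT (EFin \o a) ->
  nu.-integrable setT (EFin \o b) ->
  \int[mn]_p tens a b p = (\int[mu]_x a x) * (\int[nu]_z b z).
Proof.
move=> ia ib; rewrite Rfubini_inty; last exact: tens_integrable.
rewrite mulrC -RintegralZl//; apply: eq_Rintegral => x _.
by rewrite /tens /= RintegralZl// mulrC.
Qed.

Lemma sqint_tens a b : sqint mu a -> sqint nu b -> sqint mn (tens a b).
Proof.
move=> sa sb; apply/sqintP.
  by apply: measurable_tens; [exact: sqint_measurable sa|exact: sqint_measurable sb].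
rewrite (_ : (fun _ => _) = EFin \o tens (fun x => a x ^+ 2) (fun z => b z ^+ 2)).
  by apply: tens_integrable; exact: sqint_integrable.
by apply/funext => p /=; rewrite exprMn.
Qed.

Lemma sqint_secx w : sqint mn w -> {ae nu, forall z, sqint mu (fun x => w (x, z))}.
Proof.
move=> sw; have mw := sqint_measurable sw.
apply: filterS (ae_integrable_secx (sqint_integrable sw)) => z /= iz.
by apply/sqintP => //; exact: measurable_secx.
Qed.

Lemma sqint_secy w : sqint mn w -> {ae mu, forall x, sqint nu (fun z => w (x, z))}.
Proof.
move=> sw; have mw := sqint_measurable sw.
apply: filterS (ae_integrable_secy (sqint_integrable sw)) => z /= iz.
by apply/sqintP => //; exact: measurable_secy.
Qed.

Lemma rip_secx w : sqint mn w ->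
  nu.-integrable setT (fun z => (rip mu (fun x => w (x, z)) (fun x => w (x, z)))%:E) /\
  rip mn w w = \int[nu]_z rip mu (fun x => w (x, z)) (fun x => w (x, z)).
Proof.
by move=> sw; have i := sqintM_integrable sw sw; split;
  [exact: (integrable_intx i)|exact: (Rfubini_intx i)].
Qed.

Lemma measurable_opT w a : measurable_fun setT w -> measurable_fun setT a ->
  measurable_fun setT (opT w a).
Proof.
move=> mw ma.
apply: (@measurable_intx _ _ _ _ _ mu (fun p => w p * a p.1)).
by apply: measurable_funM => //; exact: measurableT_comp.
Qed.

Lemma measurable_opT' w b : measurable_fun setT w -> measurable_fun setT b ->
  measurable_fun setT (opT' w b).
Proof.
move=> mw mb.
apply: (@measurable_inty _ _ _ _ _ nu (fun p => w p * b p.2)).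
by apply: measurable_funM => //; exact: measurableT_comp.
Qed.

Lemma sqint_opT w a : sqint mn w -> sqint mu a ->
  sqint nu (opT w a) /\
  rip nu (opT w a) (opT w a) <= rip mn w w * rip mu a a.
Proof.
move=> sw sa; have [iw wE] := rip_secx sw.
have mT := measurable_opT (sqint_measurable sw) (sqint_measurable sa).
pose W z := rip mu (fun x => w (x, z)) (fun x => w (x, z)).
have WT : {ae nu, forall z, (opT w a z) ^+ 2 <= rip mu a a * W z}.
  apply: filterS (sqint_secx sw) => z sz; rewrite mulrC.
  exact: (rip_CS sz sa).
have iW : nu.-integrable setT (fun z => (rip mu a a * W z)%:E).
  by under eq_fun do rewrite EFinM; exact: integrableZl.
have mW := measurable_int _ iW.
have leI : (\int[nu]_z (opT w a z ^+ 2)%:E <= \int[nu]_z (rip mu a a * W z)%:E)%E.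
  apply: ae_ge0_le_integral => //.
  - by move=> z _; rewrite lee_fin sqr_ge0.
  - exact/measurable_EFinP/measurable_funX.
  - by move=> z _; rewrite lee_fin mulr_ge0// rip_ge0.
  - by apply: filterS WT => z h _; rewrite lee_fin.
have sT : sqint nu (opT w a).
  split => //; apply: le_lt_trans leI _.
  by apply: integrable_lty.
split => //; rewrite -lee_fin EFin_rip//; apply: (le_trans leI).
rewrite wE mulrC -RintegralZl// /Rintegral fineK// integrable_fin_num//.
Qed.

Lemma rip_tens_opT w a b : sqint mn w -> sqint mu a -> sqint nu b ->
  rip mn w (tens a b) = rip nu (opT w a) b.
Proof.
move=> sw sa sb; rewrite /rip Rfubini_intx; last first.
  exact: (sqintM_integrable sw (sqint_tens sa sb)).
apply: ae_eq_Rintegral.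
- apply: (@measurable_intx _ _ _ _ _ mu (fun p => w p * tens a b p)).
  apply: measurable_funM; first exact: sqint_measurable sw.
  exact: sqint_measurable (sqint_tens sa sb).
- apply: measurable_funM; last exact: sqint_measurable sb.
  by apply: measurable_opT; [exact: sqint_measurable sw|exact: sqint_measurable sa].
apply: filterS (sqint_secx sw) => z sz; rewrite mulrC -RintegralZl//.
  by apply: eq_Rintegral => x _; rewrite /tens /=; ring.
exact: (sqintM_integrable sz sa).
Qed.

Lemma rip_tens_opT' w a b : sqint mn w -> sqint mu a -> sqint nu b ->
  rip mn w (tens a b) = rip mu (opT' w b) a.
Proof.
move=> sw sa sb; rewrite /rip Rfubini_inty; last first.
  exact: (sqintM_integrable sw (sqint_tens sa sb)).
apply: ae_eq_Rintegral.
- apply: (@measurable_inty _ _ _ _ _ nu (fun p => w p * tens a b p)).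
  apply: measurable_funM; first exact: sqint_measurable sw.
  exact: sqint_measurable (sqint_tens sa sb).
- apply: measurable_funM; last exact: sqint_measurable sa.
  by apply: measurable_opT'; [exact: sqint_measurable sw|exact: sqint_measurable sb].
apply: filterS (sqint_secy sw) => x sx; rewrite mulrC -RintegralZl//.
  by apply: eq_Rintegral => z _; rewrite /tens /=; ring.
exact: (sqintM_integrable sx sb).
Qed.

Lemma opTDl w w' a : sqint mn w -> sqint mn w' -> sqint mu a ->
  {ae nu, forall z, opT (w + w') a z = opT w a z + opT w' a z}.
Proof.
move=> sw sw' sa; apply: filterS2 (sqint_secx sw) (sqint_secx sw') => z sz sz'.
rewrite /opT -RintegralD//; [|exact: (sqintM_integrable sz sa)|
  exact: (sqintM_integrable sz' sa)].
by apply: eq_Rintegral => x _; rewrite -mulrDl.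
Qed.

Lemma opTNl w a : sqint mn w -> sqint mu a ->
  {ae nu, forall z, opT (- w) a z = - opT w a z}.
Proof.
move=> sw sa; apply: filterS (sqint_secx sw) => z sz.
rewrite /opT -[RHS]mulN1r -RintegralZl//; last exact: (sqintM_integrable sz sa).
by apply: eq_Rintegral => x _; rewrite mulN1r -mulNr.
Qed.

Lemma opTZl c w a : sqint mn w -> sqint mu a ->
  {ae nu, forall z, opT (fun p => c * w p) a z = c * opT w a z}.
Proof.
move=> sw sa; apply: filterS (sqint_secx sw) => z sz.
rewrite /opT -RintegralZl//; last exact: (sqintM_integrable sz sa).
by apply: eq_Rintegral => x _; rewrite mulrA.
Qed.

Lemma opTDr w a a' : sqint mn w -> sqint mu a -> sqint mu a' ->
  {ae nu, forall z, opT w (a + a') z = opT w a z + opT w a' z}.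
Proof.
move=> sw sa sa'; apply: filterS (sqint_secx sw) => z sz.
rewrite /opT -RintegralD//; [|exact: (sqintM_integrable sz sa)|
  exact: (sqintM_integrable sz sa')].
by apply: eq_Rintegral => x _; rewrite -mulrDr.
Qed.

Lemma opTZr c w a : sqint mn w -> sqint mu a ->
  {ae nu, forall z, opT w (fun x => c * a x) z = c * opT w a z}.
Proof.
move=> sw sa; apply: filterS (sqint_secx sw) => z sz.
rewrite /opT -RintegralZl//; last exact: (sqintM_integrable sz sa).
by apply: eq_Rintegral => x _; ring.
Qed.

(* The real parts of [e j] and [i e j], for an orthonormal basis [e] of complex
   functions, form a Parseval frame but not a basis. *)
Definition frame (h : nat -> X -> R) :=
  (forall k, sqint mu (h k)) /\
  forall f, sqint mu f -> series (fun k => rip mu (h k) f ^+ 2) @ \oo --> rip mu f f.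

(** The squared Hilbert-Schmidt norm: Parseval in almost every slice of [w], integrated over [z] and
    exchanged with the sum by monotone convergence. *)
Lemma frame_product (h : nat -> X -> R) w : frame h -> sqint mn w ->
  series (fun k => rip nu (opT w (h k)) (opT w (h k))) @ \oo --> rip mn w w.
Proof.
move=> [sh hP] sw; have [iw wE] := rip_secx sw.
have sT k := (sqint_opT sw (sh k)).1.
have mT2 k : measurable_fun setT (fun z => (opT w (h k) z ^+ 2)%:E).
  exact/measurable_EFinP/measurable_funX/(sqint_measurable (sT k)).
have E : ((rip mn w w)%:E = \sum_(0 <= k <oo) (rip nu (opT w (h k)) (opT w (h k)))%:E)%E.
  under eq_eseriesr do rewrite EFin_rip//.
  rewrite -integral_nneseries//; last by move=> *; rewrite lee_fin sqr_ge0.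
  rewrite wE /Rintegral fineK; last exact: integrable_fin_num.
  apply: ae_eq_integral => //; first exact: measurable_int iw.
    by apply: ge0_emeasurable_sum => // *; rewrite lee_fin sqr_ge0.
  apply: filterS (sqint_secx sw) => z sz _.
  rewrite -(eseries_EFin (hP _ sz)); apply: eq_eseriesr => k _.
  by rewrite ripC.
by apply: cvg_series_EFin => // k; exact: rip_ge0.
Qed.

End product.

Section etens.
Context d1 d2 (X : measurableType d1) (Y : measurableType d2) (R : realType).
Variables (mu : {sigma_finite_measure set X -> \bar R}).
Variables (rho : {sigma_finite_measure set Y -> \bar R}).
Local Open Scope ereal_scope.

Lemma integral_etens (f : X -> \bar R) (g : Y -> \bar R) :
  measurable_fun setT f -> measurable_fun setT g ->
  (forall x, 0 <= f x) -> (forall y, 0 <= g y) ->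
  \int[mu \x rho]_p (f p.1 * g p.2) = (\int[mu]_x f x) * (\int[rho]_y g y).
Proof.
move=> mf mg f0 g0; rewrite fubini_tonelli1; last 2 first.
- by apply: emeasurable_funM; exact: measurableT_comp.
- by move=> p; rewrite mule_ge0.
rewrite muleC -ge0_integralZl//; last exact: integral_ge0.
by apply: eq_integral => x _; rewrite /fubini_F /= ge0_integralZl// muleC.
Qed.

End etens.

Section iterated.
Context d1 d2 (X : measurableType d1) (Z : measurableType d2) (R : realType).
Variables (mu : {sigma_finite_measure set X -> \bar R}).
Variables (nu : {sigma_finite_measure set Z -> \bar R}).
Variable w : X * Z -> R.
Hypothesis mw : measurable_fun setT w.

Let mw2 : measurable_fun setT (fun p => (w p ^+ 2)%:E).
Proof. by apply/measurable_EFinP; exact: measurable_funX. Qed.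

Let w2_ge0 p : (0 <= (w p ^+ 2)%:E)%E.
Proof. by rewrite lee_fin sqr_ge0. Qed.

Lemma sqint_iterP : sqint (mu \x nu)%E w <->
  (\int[mu]_x \int[nu]_z (w (x, z) ^+ 2)%:E < +oo)%E.
Proof. by rewrite /sqint fubini_tonelli1//; split=> [[]|]. Qed.

Lemma measurable_iter :
  measurable_fun setT (fun x => \int[nu]_z (w (x, z) ^+ 2)%:E)%E.
Proof. exact: (measurable_fun_fubini_tonelli_F (m2 := nu) _ mw2 w2_ge0). Qed.

End iterated.

Section kernel_product.
Context d1 d2 d3 (X : measurableType d1) (Y : measurableType d2)
  (Z : measurableType d3) (R : realType).
Variables (mu : {sigma_finite_measure set X -> \bar R}).
Variables (rho : {sigma_finite_measure set Y -> \bar R}).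
Variables (nu : {sigma_finite_measure set Z -> \bar R}).
Variables (K : X * Z -> R) (Q : Y * Z -> R).

Definition kerp (p : X * Y) : R := \int[nu]_z (K (p.1, z) * Q (p.2, z)).

Lemma measurable_kerp : measurable_fun setT K -> measurable_fun setT Q ->
  measurable_fun setT kerp.
Proof.
move=> mK mQ.
apply: (@measurable_inty _ _ (X * Y)%type Z R nu
  (fun q : (X * Y) * Z => K (q.1.1, q.2) * Q (q.1.2, q.2))).
apply: measurable_funM.
  apply: (measurableT_comp mK); apply/measurable_fun_pairP; split => /=.
    exact: (measurableT_comp measurable_fst measurable_fst).
  exact: measurable_snd.
apply: (measurableT_comp mQ); apply/measurable_fun_pairP; split => /=.
  exact: (measurableT_comp measurable_snd measurable_fst).
exact: measurable_snd.
Qed.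

Hypotheses (sK : sqint (mu \x nu)%E K) (sQ : sqint (rho \x nu)%E Q).
Let mK := sqint_measurable sK.
Let mQ := sqint_measurable sQ.

Lemma sqint_kerp : sqint (mu \x rho)%E kerp.
Proof.
split; first exact: measurable_kerp.
pose k x := rip nu (fun z => K (x, z)) (fun z => K (x, z)).
pose q y := rip nu (fun z => Q (y, z)) (fun z => Q (y, z)).
have ik : mu.-integrable setT (EFin \o k) by exact: (integrable_inty (sqintM_integrable sK sK)).
have iq : rho.-integrable setT (EFin \o q) by exact: (integrable_inty (sqintM_integrable sQ sQ)).
have it := tens_integrable ik iq.
apply: (@le_lt_trans _ _ (\int[(mu \x rho)%E]_p (EFin \o tens k q) p)%E).
  apply: ae_ge0_le_integral => //.
  - by move=> p _; rewrite lee_fin sqr_ge0.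
  - by apply/measurable_EFinP/measurable_funX; exact: measurable_kerp.
  - by move=> p _; rewrite lee_fin mulr_ge0// rip_ge0.
  - exact: measurable_int it.
  - apply: filterS2 (ae_prodx rho (sqint_secy sK)) (ae_prody mu (sqint_secy sQ)).
    by move=> p sk sq _; rewrite lee_fin; exact: rip_CS.
exact: integrable_lty.
Qed.

(** If [opT K] is the transpose K^T, this says that the inner product of K^T a and Q^T b equals that
    of a and K Q^T b. Inner products of images therefore depend on the kernel product only. *)
Lemma rip_opT_kerp a b : sqint mu a -> sqint rho b ->
  rip nu (opT mu K a) (opT rho Q b) = rip (mu \x rho)%E kerp (tens a b).
Proof.
move=> sa sb; have ma := sqint_measurable sa; have mb := sqint_measurable sb.
(* The integrand a(x) K(x,z) Q(y,z) b(y) is split crosswise: each factor is then square integrable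
   on the triple product, so the integrand is integrable and Fubini applies in both orders. *)
pose W1 (q : (X * Y) * Z) := a q.1.1 * Q (q.1.2, q.2).
pose W2 (q : (X * Y) * Z) := b q.1.2 * K (q.1.1, q.2).
pose m12 := [the {sigma_finite_measure set _ -> \bar R} of prodm mu rho].
have mW1 : measurable_fun setT W1.
  apply: measurable_funM.
    by apply: (measurableT_comp ma); exact: (measurableT_comp measurable_fst measurable_fst).
  apply: (measurableT_comp mQ); apply/measurable_fun_pairP; split => /=.
    exact: (measurableT_comp measurable_snd measurable_fst).
  exact: measurable_snd.
have mW2 : measurable_fun setT W2.
  apply: measurable_funM.
    by apply: (measurableT_comp mb); exact: (measurableT_comp measurable_snd measurable_fst).
  apply: (measurableT_comp mK); apply/measurable_fun_pairP; split => /=.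
    exact: (measurableT_comp measurable_fst measurable_fst).
  exact: measurable_snd.
have fin3 d (T : measurableType d) (m : {sigma_finite_measure set T -> \bar R}) (c : T -> R) :
    sqint m c -> (\int[m]_x (c x ^+ 2)%:E \is a fin_num)%E.
  by move=> sc; apply: integrable_fin_num => //; exact: sqint_integrable.
have mX2 d (T : measurableType d) (c : T -> R) : measurable_fun setT c ->
    measurable_fun setT (fun x => (c x ^+ 2)%:E).
  by move=> mc; apply/measurable_EFinP; exact: measurable_funX.
have sW1 : sqint (m12 \x nu)%E W1.
  apply: (sqint_iterP m12 nu mW1).2.
  rewrite (_ : integral _ _ _ = \int[(mu \x rho)%E]_p
      ((a p.1 ^+ 2)%:E * \int[nu]_z (Q (p.2, z) ^+ 2)%:E))%E; last first.
    apply: eq_integral => p _; rewrite /W1 /=; under eq_integral do rewrite exprMn EFinM.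
    rewrite ge0_integralZl//.
    - by apply: mX2; exact: measurable_secy.
    - by move=> *; rewrite lee_fin sqr_ge0.
    - by rewrite lee_fin sqr_ge0.
  have qoo := (sqint_iterP rho nu mQ).1 sQ.
  rewrite (integral_etens mu rho (mX2 _ _ _ ma) (measurable_iter nu mQ)).
  - rewrite lte_mul_pinfty ?fin3//; apply: integral_ge0 => x _; rewrite lee_fin sqr_ge0//.
  - by move=> x; rewrite lee_fin sqr_ge0.
  - by move=> y; apply: integral_ge0 => x _; rewrite lee_fin sqr_ge0.
have sW2 : sqint (m12 \x nu)%E W2.
  apply: (sqint_iterP m12 nu mW2).2.
  rewrite (_ : integral _ _ _ = \int[(mu \x rho)%E]_p
      ((\int[nu]_z (K (p.1, z) ^+ 2)%:E) * (b p.2 ^+ 2)%:E))%E; last first.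
    apply: eq_integral => p _; rewrite /W2 /=; under eq_integral do rewrite exprMn EFinM.
    rewrite ge0_integralZl//; first by rewrite muleC.
    - by apply: mX2; exact: measurable_secy.
    - by move=> *; rewrite lee_fin sqr_ge0.
    - by rewrite lee_fin sqr_ge0.
  have qoo := (sqint_iterP mu nu mK).1 sK.
  rewrite (integral_etens mu rho (measurable_iter nu mK) (mX2 _ _ _ mb)).
  - rewrite muleC lte_mul_pinfty ?fin3//; apply: integral_ge0 => x _; rewrite lee_fin sqr_ge0//.
  - by move=> y; apply: integral_ge0 => x _; rewrite lee_fin sqr_ge0.
  - by move=> x; rewrite lee_fin sqr_ge0.
have iW := sqintM_integrable sW1 sW2.
transitivity (\int[(m12 \x nu)%E]_q (W1 q * W2 q)).
  rewrite Rfubini_intx//; apply: ae_eq_Rintegral.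
  - apply: measurable_funM; exact: measurable_opT.
  - by apply: (@measurable_intx _ _ _ _ _ m12 (fun q => W1 q * W2 q)); exact: measurable_funM.
  apply: filterS2 (sqint_secx sK) (sqint_secx sQ) => z sk sq.
  rewrite -Rintegral_tens; [|exact: (sqintM_integrable sk sa)|exact: (sqintM_integrable sq sb)].
  by apply: eq_Rintegral => p _; rewrite /tens /W1 /W2 /=; ring.
rewrite Rfubini_inty//; apply: ae_eq_Rintegral.
- by apply: (@measurable_inty _ _ _ _ _ nu (fun q => W1 q * W2 q)); exact: measurable_funM.
- apply: measurable_funM; first exact: measurable_kerp.
  exact: measurable_tens.
apply: filterS2 (ae_prodx rho (sqint_secy sK)) (ae_prody mu (sqint_secy sQ)) => -[x y] /= sk sq.
rewrite /kerp /= mulrC -RintegralZl//; last exact: (sqintM_integrable sk sq).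
by apply: eq_Rintegral => z _; rewrite /W1 /W2 /tens /=; ring.
Qed.

End kernel_product.

Section frame.
Context d1 d2 (X : measurableType d1) (Z : measurableType d2) (R : realType).
Variables (mu : {sigma_finite_measure set X -> \bar R}).
Variables (nu : {sigma_finite_measure set Z -> \bar R}).
Variable h : nat -> X -> R.
Hypothesis hF : frame mu h.
Local Notation mn := (mu \x nu)%E.

(** Polarisation of [frame_product]. *)
Lemma frame_rip (w v : X * Z -> R) : sqint mn w -> sqint mn v ->
  series (fun k => rip nu (opT mu w (h k)) (opT mu v (h k))) @ \oo --> rip mn w v.
Proof.
move=> sw sv; have sh := hF.1.
have P := frame_product hF (sqintD sw sv).
have M := frame_product hF (sqintB sw sv).
have E k : rip nu (opT mu w (h k)) (opT mu v (h k)) =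
   4^-1 * (rip nu (opT mu (w + v) (h k)) (opT mu (w + v) (h k)) -
           rip nu (opT mu (w - v) (h k)) (opT mu (w - v) (h k))).
  have sT u : sqint mn u -> sqint nu (opT mu u (h k)).
    by move=> su; exact: (sqint_opT su (sh k)).1.
  have mT u : sqint mn u -> measurable_fun setT (opT mu u (h k)).
    by move=> su; exact: (sqint_measurable (sT _ su)).
  have mS u u' : sqint mn u -> sqint mn u' ->
      measurable_fun setT (opT mu u (h k) + opT mu u' (h k)).
    by move=> su su'; apply: measurable_funD; exact: mT.
  have sv' := sqintN sv.
  have aD : {ae nu, forall z, opT mu (w + v) (h k) z = (opT mu w (h k) + opT mu v (h k)) z}.
    exact: (opTDl sw sv (sh k)).
  have aB : {ae nu, forall z, opT mu (w - v) (h k) z = (opT mu w (h k) - opT mu v (h k)) z}.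
    by apply: filterS2 (opTDl sw sv' (sh k)) (opTNl sv (sh k)) => z -> ->.
  have mB : measurable_fun setT (opT mu w (h k) - opT mu v (h k)).
    by apply: sqint_measurable (sqintB (sT _ sw) (sT _ sv)).
  rewrite (ae_eq_rip _ _ _ _ aD aD); try exact: mS; try exact/mT/sqintD.
  rewrite (ae_eq_rip _ _ _ _ aB aB)//; try exact/mT/sqintD.
  rewrite (rip_sqrD (sT _ sw) (sT _ sv)) (rip_sqrB (sT _ sw) (sT _ sv)).
  by move: (rip nu _ _) (rip nu _ _) (rip nu _ _) => x y z; field.
have L : rip mn w v = 4^-1 * (rip mn (w + v) (w + v) - rip mn (w - v) (w - v)).
  by rewrite rip_sqrD// rip_sqrB//; field.
rewrite L (_ : series _ = (fun n => 4^-1 *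
  (series (fun k => rip nu (opT mu (w + v) (h k)) (opT mu (w + v) (h k))) n -
   series (fun k => rip nu (opT mu (w - v) (h k)) (opT mu (w - v) (h k))) n))); last first.
  apply/funext => n; rewrite /series /= -sumrB big_distrr/=.
  by apply: eq_bigr => k _; rewrite E.
by apply: cvgM; [exact: cvg_cst|exact: cvgB].
Qed.

End frame.

(* The trace of a product of two Hilbert-Schmidt operators only depends on the
   kernel of the product. *)
Lemma rip_of_kerp d1 d2 d3 (X : measurableType d1) (Z : measurableType d2)
  (Z' : measurableType d3) (R : realType)
  (mu : {sigma_finite_measure set X -> \bar R})
  (nu : {sigma_finite_measure set Z -> \bar R})
  (nu' : {sigma_finite_measure set Z' -> \bar R})
  (h : nat -> X -> R) (K Q : X * Z -> R) (K' Q' : X * Z' -> R) :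
  frame mu h ->
  sqint (mu \x nu)%E K -> sqint (mu \x nu)%E Q ->
  sqint (mu \x nu')%E K' -> sqint (mu \x nu')%E Q' ->
  {ae (mu \x mu)%E, forall p, kerp nu K Q p = kerp nu' K' Q' p} ->
  rip (mu \x nu)%E K Q = rip (mu \x nu')%E K' Q'.
Proof.
move=> hF sK sQ sK' sQ' E.
have := frame_rip hF sK' sQ'; have := frame_rip hF sK sQ.
rewrite [X in X @ \oo --> _ -> _](_ : _ = series (fun k => rip nu' (opT mu K' (h k)) (opT mu Q' (h k)))).
  exact: cvg_unique.
congr series; apply/funext => k; have sh := hF.1 k.
rewrite !rip_opT_kerp//; have mt := measurable_tens (sqint_measurable sh) (sqint_measurable sh).
apply: ae_eq_rip => //; [exact: (measurable_kerp _ (sqint_measurable sK) (sqint_measurable sQ))|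
  exact: (measurable_kerp _ (sqint_measurable sK') (sqint_measurable sQ'))|exact: aeW].
Qed.

(** * Complex square integrable functions as pairs of real ones *)

Section complex_parts.
Context {R : realType}.
Implicit Types x y : R[i].

Lemma Re_mul x y : complex.Re (x * y) =
  complex.Re x * complex.Re y - complex.Im x * complex.Im y.
Proof. by case: x; case: y. Qed.

Lemma Im_mul x y : complex.Im (x * y) =
  complex.Re x * complex.Im y + complex.Im x * complex.Re y.
Proof. by case: x => a b; case: y => c e /=. Qed.

Lemma Re_conjc x : complex.Re (x^*)%C = complex.Re x.
Proof. by case: x. Qed.

Lemma Im_conjc x : complex.Im (x^*)%C = - complex.Im x.
Proof. by case: x. Qed.

Lemma sqr_normc x : Normc.normc x ^+ 2 = complex.Re x ^+ 2 + complex.Im x ^+ 2.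
Proof. by case: x => a b /=; rewrite sqr_sqrtr// addr_ge0 ?sqr_ge0. Qed.

Lemma complex_eq x y : complex.Re x = complex.Re y -> complex.Im x = complex.Im y -> x = y.
Proof. by case: x => a b; case: y => c e /= -> ->. Qed.

End complex_parts.

Section in_L2.
Context d (T : measurableType d) (R : realType) (mu : {measure set T -> \bar R}).
Implicit Types f g : T -> R[i].
Local Notation Re f := (fun x => complex.Re (f x)).
Local Notation Im f := (fun x => complex.Im (f x)).

Lemma in_L2P f : in_L2 mu setT f <-> sqint mu (Re f) /\ sqint mu (Im f).
Proof.
have E : (fun x => (Normc.normc (f x) ^+ 2)%:E) =
    (fun x => (complex.Re (f x) ^+ 2)%:E + (complex.Im (f x) ^+ 2)%:E)%E.
  by apply/funext => x; rewrite sqr_normc.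
split=> [[mr mi foo]|[[mr roo] [mi ioo]]].
  have le0 (g : T -> R) : measurable_fun setT g ->
      (forall x, g x ^+ 2 <= Normc.normc (f x) ^+ 2) -> sqint mu g.
    move=> mg gf; split => //; apply: le_lt_trans foo; apply: ge0_le_integral => //.
    - by move=> x _; rewrite lee_fin sqr_ge0.
    - by apply/measurable_EFinP; exact: measurable_funX.
    - by rewrite E; apply: emeasurable_funD; apply/measurable_EFinP; exact: measurable_funX.
    - by move=> x _; rewrite lee_fin.
  by split; apply: le0 => // x; rewrite sqr_normc ?lerDl ?lerDr sqr_ge0.
suff H : (\int[mu]_x (Normc.normc (f x) ^+ 2)%:E < +oo)%E by split.
rewrite E ge0_integralD//.
- by rewrite lte_add_pinfty.
- by move=> x _; rewrite lee_fin sqr_ge0.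
- by apply/measurable_EFinP; exact: measurable_funX.
- by move=> x _; rewrite lee_fin sqr_ge0.
- by apply/measurable_EFinP; exact: measurable_funX.
Qed.

Lemma Re_ip f g : in_L2 mu setT f -> in_L2 mu setT g ->
  complex.Re (ip mu setT f g) = rip mu (Re f) (Re g) + rip mu (Im f) (Im g).
Proof.
move=> /in_L2P[rf jf] /in_L2P[rg jg]; rewrite /= /rip -RintegralD//.
- by apply: eq_Rintegral => x _; rewrite Re_mul Re_conjc Im_conjc mulNr opprK.
- exact: sqintM_integrable.
- exact: sqintM_integrable.
Qed.

Lemma Im_ip f g : in_L2 mu setT f -> in_L2 mu setT g ->
  complex.Im (ip mu setT f g) = rip mu (Re f) (Im g) - rip mu (Im f) (Re g).
Proof.
move=> /in_L2P[rf jf] /in_L2P[rg jg]; rewrite /= /rip -RintegralB//.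
- by apply: eq_Rintegral => x _; rewrite Im_mul Re_conjc Im_conjc mulNr.
- exact: sqintM_integrable.
- exact: sqintM_integrable.
Qed.

End in_L2.

Section frame_of_onb.
Context d (X : measurableType d) (R : realType).
Variable mu : {sigma_finite_measure set X -> \bar R}.
Variable e : nat -> X -> R[i].
Hypothesis onbe : onb mu setT e.

Let V := ((X -> R) * (X -> R))%type.
Let L (u : V) := sqint mu u.1 /\ sqint mu u.2.
Let B (u v : V) := rip mu u.1 v.1 + rip mu u.2 v.2.

(* [e j] and [i e j], as pairs of a real and an imaginary part *)
Let ee n : V := let f := e n./2 in
  if odd n then (- (fun x => complex.Im (f x)), fun x => complex.Re (f x))
  else (fun x => complex.Re (f x), fun x => complex.Im (f x)).

Let L2e j : in_L2 mu setT (e j). Proof. by case: onbe. Qed.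
Let sr j : sqint mu (fun x => complex.Re (e j x)). Proof. by have /in_L2P[] := L2e j. Qed.
Let si j : sqint mu (fun x => complex.Im (e j x)). Proof. by have /in_L2P[] := L2e j. Qed.

Let Lee n : L (ee n).
Proof. by rewrite /ee; case: ifP => _; split => //=; exact: sqintN. Qed.

Let Bee m n : B (ee m) (ee n) =
  if odd m == odd n then complex.Re (ip mu setT (e m./2) (e n./2))
  else (if odd m then 1 else -1) * complex.Im (ip mu setT (e m./2) (e n./2)).
Proof.
rewrite /B /ee Re_ip// Im_ip//.
have ripNr f g : sqint mu f -> sqint mu g -> rip mu f (- g) = - rip mu f g.
  by move=> sf sg; rewrite ripC ripNl// ripC.
case: (odd m); case: (odd n) => //=.
- by rewrite ripNl// ?ripNr// ?opprK 1?addrC//; exact: sqintN.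
- by rewrite ripNl// addrC mul1r.
- by rewrite ripNr// mulN1r opprB addrC.
Qed.

(** In the real Hilbert space of pairs, the [ee n] are orthogonal, of norm 0 or 1, and total,
    because real orthogonality to both [e j] and [i e j] means that the complex inner product
    vanishes. Parseval for [(f, 0)] sees only the first components. *)
Lemma frame_of_onb : frame mu (fun n => (ee n).1).
Proof.
split=> [n|f sf]; first by case: (Lee n).
have [_ orth nrm tot] := onbe.
have := @parseval_of_total R V (fun a u => (fun x => a * u.1 x, fun x => a * u.2 x)) L B.
move=> /(_ _ _ _ _ _ _ _ _ _ ee Lee) P.
have {}P : series (fun i => B (ee i) (f, 0) ^+ 2) @ \oo --> B (f, 0) (f, 0).
  apply: P.
  - by split; exact: sqint0.
  - by move=> u v [? ?] [? ?]; split; exact: sqintD.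
  - by move=> u [? ?]; split; exact: sqintN.
  - by move=> a u [? ?]; split; exact: sqintZ.
  - by move=> u v; rewrite /B !(ripC _ v.1) !(ripC _ v.2).
  - by move=> u v w [? ?] [? ?] [? ?]; rewrite /B !ripDl//; ring.
  - by move=> a u v [? ?] [? ?]; rewrite /B !ripZl//; ring.
  - by move=> u; rewrite addr_ge0 ?rip_ge0.
  - move=> u Lu cu.
    have c1 v w : L v -> L w -> rip mu (v.1 - w.1) (v.1 - w.1) <= B (v - w) (v - w).
      by move=> _ _; rewrite lerDl rip_ge0.
    have c2 v w : L v -> L w -> rip mu (v.2 - w.2) (v.2 - w.2) <= B (v - w) (v - w).
      by move=> _ _; rewrite lerDr rip_ge0.
    have [||g1 sg1 H1] := @sqint_complete _ _ _ mu (fun n => (u n).1).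
    + by move=> n; case: (Lu n).
    + move=> r r0; have [N HN] := cu r r0; exists N => m n Nm Nn.
      exact: le_trans (c1 _ _ (Lu m) (Lu n)) (HN _ _ Nm Nn).
    have [||g2 sg2 H2] := @sqint_complete _ _ _ mu (fun n => (u n).2).
    + by move=> n; case: (Lu n).
    + move=> r r0; have [N HN] := cu r r0; exists N => m n Nm Nn.
      exact: le_trans (c2 _ _ (Lu m) (Lu n)) (HN _ _ Nm Nn).
    exists (g1, g2) => // r r0; have r2 : 0 < r / 2 by rewrite divr_gt0.
    have [N1 HN1] := H1 _ r2; have [N2 HN2] := H2 _ r2.
    exists (maxn N1 N2) => n; rewrite geq_max => /andP[n1 n2].
    by have := HN1 _ n1; have := HN2 _ n2; rewrite /B /=; lra.
  - move=> m n mn; rewrite Bee; have [eo|no] := eqVneq (odd m) (odd n).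
      rewrite orth// => h; apply: mn.
      by rewrite -(odd_double_half m) -(odd_double_half n) eo h.
    (* The real pairing of [e j] and [i e j] is, up to sign, the imaginary part of the real number
       [ip (e j) (e j)]. *)
    have [->|h] := eqVneq m./2 n./2; last by rewrite orth ?mulr0//; exact/eqP.
    by rewrite Im_ip// (ripC mu (fun x => complex.Re _)) subrr mulr0.
  - by move=> n; rewrite Bee eqxx; case: (nrm n./2) => ->; [left|right].
  - move=> u [s1 s2] H; pose F x := Complex (u.1 x) (u.2 x).
    have LF : in_L2 mu setT F by apply/in_L2P.
    have : ip mu setT F F = 0.
      apply: tot => // j; apply: complex_eq.
      + rewrite Re_ip//; have := H j.*2.
        by rewrite /B /ee odd_double doubleK.
      + rewrite Im_ip//; have := H j.*2.+1.
        rewrite /B /ee /= odd_double/= uphalf_double ripNl// addrC.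
        by [].
    by move=> /(congr1 (@complex.Re R)); rewrite Re_ip.
  - by split => //; exact: sqint0.
have z0 g : rip mu g 0 = 0.
  by rewrite /rip; under eq_Rintegral do rewrite mulr0; rewrite /Rintegral integral0.
have BE g u : B (u, g) (f, 0) = rip mu u f by rewrite /B /= z0 addr0.
have BE0 : B (f, 0) (f, 0) = rip mu f f by rewrite BE.
move: P; rewrite BE0 (_ : (fun i => _) = (fun i => rip mu (ee i).1 f ^+ 2))//.
by apply/funext => i; rewrite (surjective_pairing (ee i)) BE.
Qed.

End frame_of_onb.

Section adjoint.
Context d1 d2 (X : measurableType d1) (Z : measurableType d2) (R : realType).
Variables (mu : {sigma_finite_measure set X -> \bar R}).
Variables (nu : {sigma_finite_measure set Z -> \bar R}).

Lemma sqint_opT' (w : X * Z -> R) b : sqint (mu \x nu)%E w -> sqint nu b ->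
  sqint mu (opT' nu w b).
Proof.
move=> sw sb.
pose W x := rip nu (fun z => w (x, z)) (fun z => w (x, z)).
have iW0 : mu.-integrable setT (EFin \o W) by exact: (integrable_inty (sqintM_integrable sw sw)).
have WT : {ae mu, forall x, (opT' nu w b x) ^+ 2 <= rip nu b b * W x}.
  apply: filterS (sqint_secy sw) => z sz; rewrite mulrC.
  exact: (rip_CS sz sb).
have iW : mu.-integrable setT (fun z => (rip nu b b * W z)%:E).
  by under eq_fun do rewrite EFinM; exact: integrableZl.
have mT := measurable_opT' nu (sqint_measurable sw) (sqint_measurable sb).
split => //.
apply: (@le_lt_trans _ _ (\int[mu]_x (rip nu b b * W x)%:E)%E).
  apply: ae_ge0_le_integral => //.
  - by move=> z _; rewrite lee_fin sqr_ge0.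
  - by apply/measurable_EFinP; exact: measurable_funX.
  - by move=> z _; rewrite lee_fin mulr_ge0// rip_ge0.
  - exact: measurable_int iW.
  - by apply: filterS WT => z h _; rewrite lee_fin.
exact: integrable_lty.
Qed.

Lemma opT_tens a b a' : sqint mu a -> sqint mu a' ->
  opT mu (tens a b : X * Z -> R) a' = (fun z => rip mu a a' * b z).
Proof.
move=> sa sa'; apply/funext => z; rewrite /opT mulrC -RintegralZl//.
  by apply: eq_Rintegral => x _; rewrite /tens /=; ring.
exact: sqintM_integrable.
Qed.

End adjoint.

Lemma ae_eq_sqrip d (T : measurableType d) (R : realType)
    (m : {measure set T -> \bar R}) (f g : T -> R) :
  sqint m f -> sqint m g -> {ae m, forall x, f x = g x} -> rip m f f = rip m g g.
Proof.
by move=> [mf _] [mg _] fg; apply: ae_eq_rip.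
Qed.

(** * Transfer of a weak derivative along the isometry *)

Section transfer_weak_derivative.
Context d1 d2 d3 (X : measurableType d1) (U : measurableType d2)
  (Y : measurableType d3) (R : realType).
Variables (mu : {sigma_finite_measure set X -> \bar R}).
Variables (ups : {sigma_finite_measure set U -> \bar R}).
Variables (rho : {sigma_finite_measure set Y -> \bar R}).
Variable h : nat -> X -> R.
Hypothesis hF : frame mu h.
Variables (G : X * U -> R) (F : X * Y -> R).
Hypotheses (sG : sqint (mu \x ups)%E G) (sF : sqint (mu \x rho)%E F).
Hypothesis GF : {ae (mu \x mu)%E, forall p, kerp ups G G p = kerp rho F F p}.

Let opT_iso a : sqint mu a ->
  rip ups (opT mu G a) (opT mu G a) = rip rho (opT mu F a) (opT mu F a).
Proof.
move=> sa; rewrite !rip_opT_kerp//.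
have mt := measurable_tens (sqint_measurable sa) (sqint_measurable sa).
apply: ae_eq_rip => //; [exact: (measurable_kerp _ (sqint_measurable sG) (sqint_measurable sG))|
  exact: (measurable_kerp _ (sqint_measurable sF) (sqint_measurable sF))|exact: aeW].
Qed.

(* [w] and [v] are related by the map [opT G a |-> opT F a], which is isometric
   because [G] and [F] have the same kernel product. *)
Let S (w : X * U -> R) (v : X * Y -> R) :=
  [/\ sqint (mu \x ups)%E w, sqint (mu \x rho)%E v & forall a, sqint mu a ->
    exists eta, [/\ sqint mu eta,
      {ae ups, forall u, opT mu w a u = opT mu G eta u} &
      {ae rho, forall y, opT mu v a y = opT mu F eta y}]].

Let mopT d (Z : measurableType d) (nu : {sigma_finite_measure set Z -> \bar R})
  (w : X * Z -> R) a : sqint (mu \x nu)%E w -> sqint mu a ->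
  measurable_fun setT (opT mu w a).
Proof. by move=> sw sa; exact: (sqint_measurable (sqint_opT sw sa).1). Qed.

(** On each frame vector [h k] the two kernels act as [G] and [F] on one and the same [eta], where
    the norms agree by [opT_iso]. Summing over the frame gives the two Hilbert-Schmidt norms. *)
Let S_iso w v : S w v -> rip (mu \x ups)%E w w = rip (mu \x rho)%E v v.
Proof.
move=> [sw sv H]; have := frame_product hF sw; have := frame_product hF sv.
rewrite [X in X @ \oo --> _ -> _](_ : _ =
  series (fun k => rip ups (opT mu w (h k)) (opT mu w (h k)))).
  by move=> /cvg_lim <- // /cvg_lim <-.
congr series; apply/funext => k; have sh := hF.1 k.
have [eta [se we ve]] := H _ sh.
transitivity (rip ups (opT mu G eta) (opT mu G eta)).
  rewrite (opT_iso se); apply: ae_eq_sqrip ve.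
    exact: (sqint_opT sv sh).1.
  exact: (sqint_opT sF se).1.
apply/esym; apply: ae_eq_sqrip we.
  exact: (sqint_opT sw sh).1.
exact: (sqint_opT sG se).1.
Qed.

Let S0 : S 0 0.
Proof.
split; [exact: sqint0|exact: sqint0|move=> a sa; exists 0].
have z d (Z : measurableType d) (w : X * Z -> R) (z : Z) : opT mu 0 a z = opT mu w 0 z.
  rewrite /opT (_ : (fun x => _) = cst 0); last by apply/funext => x; rewrite mul0r.
  by congr Rintegral; apply/funext => x; rewrite mulr0.
by split; [exact: sqint0|apply: aeW => u; exact: z|apply: aeW => u; exact: z].
Qed.

Let SD w v w' v' : S w v -> S w' v' -> S (w + w') (v + v').
Proof.
move=> [sw sv H] [sw' sv' H']; split; [exact: sqintD|exact: sqintD|move=> a sa].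
have [e [se we ve]] := H _ sa; have [e' [se' we' ve']] := H' _ sa.
exists (e + e'); split; first exact: sqintD.
  near=> u.
  rewrite (near (opTDl sw sw' sa) u)// (near (opTDr sG se se') u)//.
  by rewrite (near we u)// (near we' u).
near=> u.
rewrite (near (opTDl sv sv' sa) u)// (near (opTDr sF se se') u)//.
by rewrite (near ve u)// (near ve' u).
Unshelve. all: by end_near. Qed.

Let SZ c w v : S w v -> S (fun p => c * w p) (fun p => c * v p).
Proof.
move=> [sw sv H]; split; [exact: sqintZ|exact: sqintZ|move=> a sa].
have [e [se we ve]] := H _ sa.
exists (fun x => c * e x); split; first exact: sqintZ.
  near=> u; rewrite (near (opTZl c sw sa) u)// (near (opTZr c sG se) u)//.
  by rewrite (near we u).
near=> u; rewrite (near (opTZl c sv sa) u)// (near (opTZr c sF se) u)//.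
by rewrite (near ve u).
Unshelve. all: by end_near. Qed.

Let SB w v w' v' : S w v -> S w' v' -> S (w - w') (v - v').
Proof.
move=> s s'; have := SD s (SZ (-1) s').
by congr S; apply/funext => p; rewrite !fctE mulN1r.
Qed.

(** These rank one pairs suffice to exploit orthogonality in [orth_f]. *)
Let S_tens a eta : sqint mu a -> sqint mu eta ->
  S (tens a (opT mu G eta)) (tens a (opT mu F eta)).
Proof.
move=> sa se; split.
- by apply: sqint_tens => //; exact: (sqint_opT sG se).1.
- by apply: sqint_tens => //; exact: (sqint_opT sF se).1.
move=> b sb; exists (fun x => rip mu a b * eta x); split; first exact: sqintZ.
- by rewrite opT_tens//; apply: filterS (opTZr (rip mu a b) sG se) => u ->.
- by rewrite opT_tens//; apply: filterS (opTZr (rip mu a b) sF se) => u ->.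
Qed.

Variables (I : Type) (psi dphi : I -> X -> R) (f : X * U -> R).
Hypothesis spsi : forall i, sqint mu (psi i).
Hypothesis sdphi : forall i, sqint mu (dphi i).
Hypothesis sf : sqint (mu \x ups)%E f.
Hypothesis fG : forall i, {ae ups, forall u, opT mu f (psi i) u = - opT mu G (dphi i) u}.
Hypothesis psi_total : forall g, sqint mu g -> (forall i, rip mu (psi i) g = 0) ->
  {ae mu, forall x, g x = 0}.

(** Over the frame, the pairing of [H] and [f] is the sum of those of c = [opT H (h k)] and
    [opT f (h k)]. Each c is orthogonal to the range of [opT G], by rank one pairs. Since [fG] puts
    [opT f (psi i)] in that range up to a null set, the transpose of [f] maps c to a function
    orthogonal to all [psi i], which is zero by totality. *)
Let orth_f H : sqint (mu \x ups)%E H ->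
  (forall w, (exists v, S w v) -> rip (mu \x ups)%E H w = 0) ->
  rip (mu \x ups)%E H f = 0.
Proof.
move=> sH HS.
suff E k : rip ups (opT mu H (h k)) (opT mu f (h k)) = 0.
  have := frame_rip hF sH sf; rewrite (_ : series _ = cst 0).
    by move/cvg_lim => <- //; rewrite lim_cst.
  by apply/funext => n; rewrite /series/= big1.
have sh := hF.1 k; have sc := (sqint_opT sH sh).1.
have cG eta : sqint mu eta -> rip ups (opT mu H (h k)) (opT mu G eta) = 0.
  move=> se; rewrite -(rip_tens_opT sH sh (sqint_opT sG se).1).
  by apply: HS; eexists; exact: S_tens.
rewrite ripC -(rip_tens_opT sf sh sc) (rip_tens_opT' sf sh sc).
have sT := sqint_opT' sf sc.
have T0 : {ae mu, forall x, opT' ups f (opT mu H (h k)) x = 0}.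
  apply: psi_total => // i.
  rewrite ripC -(rip_tens_opT' sf (spsi i) sc) (rip_tens_opT sf (spsi i) sc) ripC.
  have mc := sqint_measurable sc.
  have mG := mopT sG (sdphi i).
  rewrite (ae_eq_rip mc mc (mopT sf (spsi i)) _ _ (fG i)).
  - have sGd := (sqint_opT sG (sdphi i)).1.
    by rewrite ripC (ripNl sGd sc) ripC (cG _ (sdphi i)) oppr0.
  - exact: (measurableT_comp (@oppr_measurable _ _) mG).
  - exact: aeW.
have mh := sqint_measurable sh; have mT := sqint_measurable sT.
rewrite (ae_eq_rip mT (@measurable_cst _ _ _ _ _ (0 : R)) mh mh T0 (aeW _ (fun=> erefl))).
  by rewrite /rip; under eq_Rintegral do rewrite mul0r; rewrite /Rintegral integral0.
Qed.

(** By [orth_f], [f] is a limit of kernels [W n] with partners [V n]. The partners are Cauchy by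
    [S_iso], and [g] is their limit. *)
Lemma transfer_weak_derivative : exists2 g, sqint (mu \x rho)%E g &
  forall i, {ae rho, forall y, opT mu g (psi i) y = - opT mu F (dphi i) y}.
Proof.
have app n : exists wv : (X * U -> R) * (X * Y -> R), S wv.1 wv.2 /\
    rip (mu \x ups)%E (f - wv.1) (f - wv.1) <= n.+1%:R^-1.
  have [] // := @approx_of_orthogonal R _ (fun c w p => c * w p)
    (sqint (mu \x ups)%E) (rip (mu \x ups)%E) _ _ _ _ _ _ _ _ _
    (fun w => exists v, S w v) _ _ _ _ f sf orth_f n.+1%:R^-1 _.
  - exact: sqint0.
  - exact: sqintD.
  - exact: sqintN.
  - exact: sqintZ.
  - exact: ripC.
  - exact: ripDl.
  - exact: ripZl.
  - exact: rip_ge0.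
  - exact: sqint_complete.
  - by move=> w [v []].
  - by exists 0.
  - by move=> w w' [v s] [v' s']; exists (v + v'); exact: SD.
  - by move=> c w [v s]; exists (fun p => c * v p); exact: SZ.
  - by move=> w [v s] le; exists (w, v).
pose W n := (projT1 (cid (app n))).1; pose V n := (projT1 (cid (app n))).2.
have SW n : S (W n) (V n) by rewrite /W /V; case: cid => /= ? [].
have fW n : rip (mu \x ups)%E (f - W n) (f - W n) <= n.+1%:R^-1.
  by rewrite /W; case: cid => /= ? [].
have sW n : sqint (mu \x ups)%E (W n) by case: (SW n).
have sV n : sqint (mu \x rho)%E (V n) by case: (SW n).
have inv_le (e : R) : 0 < e -> exists N, forall n, (N <= n)%N -> n.+1%:R^-1 <= e.
  move=> e0; have [N _ HN] := near_infty_natSinv_lt (PosNum e0).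
  by exists N => n Nn; apply/ltW/HN.
have sum2 d (T : measurableType d) (m : {measure set T -> \bar R}) (a b : T -> R) :
    sqint m a -> sqint m b -> rip m (a - b) (a - b) <= 2 * rip m a a + 2 * rip m b b.
  by move=> sa sb; have := rip_ge0 m (a + b); rewrite rip_sqrD// rip_sqrB//; lra.
have [|g sg gV] := @sqint_complete _ _ _ (mu \x rho)%E V sV.
  move=> e e0; have [|N HN] := inv_le (e / 4); first by rewrite divr_gt0.
  exists N => m n Nm Nn; rewrite -(S_iso (SB (SW m) (SW n))).
  rewrite (_ : W m - W n = (f - W n) - (f - W m)); last first.
    by apply/funext => p; rewrite !fctE; ring.
  apply: le_trans (sum2 _ _ _ _ _ (sqintB sf (sW n)) (sqintB sf (sW m))) _.
  have := HN _ Nm; have := HN _ Nn; have := fW m; have := fW n.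
  by set x := n.+1%:R^-1; set y := m.+1%:R^-1; lra.
exists g => // i; set a := psi i; have sa : sqint mu a := spsi i.
set b := dphi i; have sb : sqint mu b := sdphi i.
have sTg := (sqint_opT sg sa).1; have sTF := (sqint_opT sF sb).1.
suff : rip rho (opT mu g a + opT mu F b) (opT mu g a + opT mu F b) = 0.
  move/(rip_eq0 (sqintD sTg sTF)); apply: filterS => y /eqP.
  by rewrite fctE addr_eq0 => /eqP.
(* Since [opT f a] is minus [opT G b], the kernel [f - W n] sends [a] to minus the image of
   [eta + b] under [G]. This has the norm of the image of [eta + b] under [F], which is
   [opT (V n) a + opT F b]. The other error is that of [V n] against [g]. *)
have bound n : rip rho (opT mu g a + opT mu F b) (opT mu g a + opT mu F b) <=
   2 * rip mu a a * (rip (mu \x rho)%E (V n - g) (V n - g) +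
      rip (mu \x ups)%E (f - W n) (f - W n)).
  have [_ _ /(_ _ sa)[eta [se we ve]]] := SW n.
  have sTV := (sqint_opT (sV n) sa).1; have sTW := (sqint_opT (sW n) sa).1.
  have sTf := (sqint_opT sf sa).1.
  have sVg := sqintB (sV n) sg; have sfW := sqintB sf (sW n).
  have E1 : rip rho (opT mu (V n) a + opT mu F b) (opT mu (V n) a + opT mu F b) =
            rip ups (opT mu (f - W n) a) (opT mu (f - W n) a).
    have seb := sqintD se sb.
    have A1 : {ae rho, forall y, (opT mu (V n) a + opT mu F b) y = opT mu F (eta + b) y}.
      by near=> y; rewrite fctE (near (opTDr sF se sb) y)// (near ve y).
    have A2 : {ae ups, forall u, opT mu (f - W n) a u = - opT mu G (eta + b) u}.
      near=> u; rewrite (near (opTDl sf (sqintN (sW n)) sa) u)//.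
      rewrite (near (opTNl (sW n) sa) u)// (near (opTDr sG se sb) u)//.
      by rewrite -(near we u)// (near (fG i) u)//; ring.
    have sGe := (sqint_opT sG seb).1; have sNGe := sqintN sGe.
    rewrite (ae_eq_sqrip (sqintD sTV sTF) (sqint_opT sF seb).1 A1).
    rewrite (ae_eq_sqrip (sqint_opT sfW sa).1 sNGe A2).
    by rewrite (ripNl sGe sNGe) (ripC _ _ (- _)) (ripNl sGe sGe) opprK opT_iso.
  have E2 : rip rho (opT mu (V n) a - opT mu g a) (opT mu (V n) a - opT mu g a) =
            rip rho (opT mu (V n - g) a) (opT mu (V n - g) a).
    have A : {ae rho, forall y, (opT mu (V n) a - opT mu g a) y = opT mu (V n - g) a y}.
      near=> y; rewrite (near (opTDl (sV n) (sqintN sg) sa) y)//.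
      by rewrite (near (opTNl sg sa) y).
    exact: (ae_eq_sqrip (sqintB sTV sTg) (sqint_opT sVg sa).1 A).
  rewrite (_ : opT mu g a + opT mu F b =
    (opT mu (V n) a + opT mu F b) - (opT mu (V n) a - opT mu g a)); last first.
    by apply/funext => y; rewrite !fctE; ring.
  apply: le_trans (sum2 _ _ _ _ _ (sqintD sTV sTF) (sqintB sTV sTg)) _.
  rewrite E1 E2; have := (sqint_opT sVg sa).2; have := (sqint_opT sfW sa).2.
  by lra.
apply/eqP; rewrite eq_le rip_ge0 andbT leNgt; apply/negP.
set r := rip _ _ _ in bound *; move=> r0; have qa := rip_ge0 mu a.
(* With both errors at most [e], the bound is 4 |a|^2 e, which is at most r/2. *)
pose e := r / (8 * (1 + rip mu a a)).
have e0 : 0 < e by rewrite divr_gt0// mulr_gt0// ltr_pwDl.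
have [N1 H1] := inv_le _ e0; have [N2 H2] := gV _ e0.
have := bound (maxn N1 N2); have := H2 _ (leq_maxr N1 N2).
have := H1 _ (leq_maxl N1 N2); have := fW (maxn N1 N2).
set x := _.+1%:R^-1; set A := rip _ _ _; set C := rip _ (V _ - _) _.
move=> Ax xe Ce rle.
have : r <= 2 * rip mu a a * (e + e).
  apply: le_trans rle _; rewrite ler_wpM2l ?mulr_ge0//; lra.
have ee : e * (1 + rip mu a a) = r / 8.
  by rewrite /e; field; rewrite gt_eqF// ltr_pwDl.
nra.
Unshelve. all: by end_near. Qed.

End transfer_weak_derivative.

(** * Test functions *)

Section flat.
Context {R : realType}.
Implicit Types (t : R) (m : nat).

(* The functions [t^-m exp(-1/t)], whose derivatives are combinations of
   functions of the same family. *)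
Definition flat m t : R := if 0 < t then t^-1 ^+ m * expR (- t^-1) else 0.

Lemma flat_gt0E m t : 0 < t -> flat m t = t^-1 ^+ m * expR (- t^-1).
Proof. by rewrite /flat => ->. Qed.

Lemma flat_le0 m t : t <= 0 -> flat m t = 0.
Proof. by rewrite /flat ltNge => ->. Qed.

Lemma flat_ge0 m t : 0 <= flat m t.
Proof.
rewrite /flat; case: ifPn => // t0.
by rewrite mulr_ge0 ?expR_ge0// exprn_ge0// invr_ge0 ltW.
Qed.

Lemma flat0_le1 t : flat 0 t <= 1.
Proof.
rewrite /flat; case: ifPn => [t0|]; last by rewrite ler01.
by rewrite expr0 mul1r expR_le1 oppr_le0 invr_ge0 ltW.
Qed.

(** exp(1/t) exceeds the term of degree m+2 of its series. The factor t^2 left over makes the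
    difference quotients at the origin tend to zero. *)
Lemma flat_bound m t : flat m t <= (m.+2)`!%:R * t ^+ 2.
Proof.
have [t0|t0] := ltP 0 t; last by rewrite flat_le0// mulr_ge0// sqr_ge0.
rewrite flat_gt0E// expRN ler_pdivrMr ?expR_gt0//.
have i0 : 0 <= t^-1 by rewrite invr_ge0 ltW.
have := expR_ge1Dxn m.+1 i0; set E := expR _ => h.
have f0 : 0 < (m.+2)`!%:R :> R by rewrite ltr0n fact_gt0.
have : t^-1 ^+ m.+2 / (m.+2)`!%:R <= E by lra.
rewrite ler_pdivrMr// => h2.
have -> : t^-1 ^+ m = t ^+ 2 * t^-1 ^+ m.+2.
  by rewrite -[m.+2]addn2 exprD mulrCA -exprMn divff ?gt_eqF// expr1n mulr1.
rewrite [leRHS](_ : _ = t ^+ 2 * (E * (m.+2)`!%:R)); last by ring.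
by rewrite ler_wpM2l ?sqr_ge0.
Qed.

Lemma is_derive_flat m t :
  is_derive t 1 (flat m) (flat m.+2 t - m%:R * flat m.+1 t).
Proof.
have [t0|t0|->] := ltrgtP t 0.
- rewrite !flat_le0 ?ltW// mulr0 subrr.
  apply: (@near_eq_is_derive R R R (cst 0)).
  by near=> x; rewrite flat_le0// ltW//; near: x; exact: lt_nbhsl.
- have nt0 : t != 0 by rewrite gt_eqF.
  apply: (@near_eq_is_derive R R R (fun x => (x^-1) ^+ m * expR (- x^-1))).
    by near=> x; rewrite flat_gt0E//; near: x; exact: lt_nbhsr.
  have d1 : is_derive t (1 : R) (fun x : R => x^-1) (- t ^- 2 *: 1).
    exact: is_deriveV.
  have d2 := is_deriveX m d1.
  have d3 : is_derive t 1 (fun x => expR (- x^-1)) (expR (- t^-1) * - (- t ^- 2 *: 1)).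
    apply: (@is_derive1_comp _ expR (fun x : R => - x^-1)).
  have := is_deriveM d2 d3; rewrite (_ : _ * _ = (fun x => x^-1 ^+ m * expR (- x^-1))).
    move/is_derive_eq; apply; rewrite !flat_gt0E//=.
    rewrite /GRing.scale /= ?mulr1 exprfctE.
    case: m d2 => [|m] d2 /=; rewrite ?expr0 ?mul0r ?mulr0 ?subr0 ?exprS ?expr0 ?addr0; field => //.
  by apply/funext => x /=; rewrite !fctE.
- rewrite !flat_le0// mulr0 subrr.
  have C : h^-1 *: ((flat m \o shift 0) (h *: 1) - flat m 0) @[h --> 0^'] --> (0 : R).
    apply/cvgr0Pnorm_le => e e0; near=> h.
    have h0 : h != 0 by near: h; exact: nbhs_dnbhs_neq.
    rewrite /= addr0 (@flat_le0 m 0)// subr0 -[h *: 1]/(h * 1) mulr1.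
    rewrite -[h^-1 *: _]/(h^-1 * _) normrM normfV ler_pdivrMl ?normr_gt0//.
    rewrite ger0_norm ?flat_ge0//; apply: le_trans (flat_bound _ _) _.
    rewrite -(real_normK (num_real h)) expr2 mulrCA ler_wpM2l//.
    rewrite -ler_pdivlMl ?ltr0n ?fact_gt0//.
    by near: h; apply: dnbhs0_le; rewrite mulr_gt0// invr_gt0 ltr0n fact_gt0.
  by apply: DeriveDef; [apply/cvg_ex; exists 0|exact: cvg_lim].
Unshelve. all: by end_near. Qed.
End flat.

(** A directional derivative depends only on the values along a line, so [f] may be traded for a
    function on another space with the same difference quotients. *)
Lemma is_derive_of_quotient {R : realType} {V V' W : normedModType R}
    (f : V -> W) (g : V' -> W) x v y u df :
  (forall h : R, (f \o shift x) (h *: v) = (g \o shift y) (h *: u)) ->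
  is_derive y u g df -> is_derive x v f df.
Proof.
move=> fg [cg dg].
have E : (fun h : R => h^-1 *: ((g \o shift y) (h *: u) - g y)) =
         (fun h : R => h^-1 *: ((f \o shift x) (h *: v) - f x)).
  apply/funext => h; rewrite fg; have := fg 0.
  by rewrite /= !scale0r !add0r => ->.
by apply: DeriveDef; [rewrite /derivable -E|rewrite /derive -E].
Qed.

Section smooth_class.
Context d (R : realType) (V : measNormedModType d R).
Implicit Types f g : V -> R.

(** Induction on the list of directions is done here once: for a class closed under directional
    derivatives only first derivatives have to be examined. *)
Lemma smooth_of_class (C : (V -> R) -> Prop) :
  (forall f, C f -> continuous f) -> (forall f, C f -> forall x v, derivable f x v) ->
  (forall f v, C f -> C (fun x => 'D_v f x)) -> forall f, C f -> smooth f.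
Proof.
move=> Cc Cd CD f Cf vs.
have H : C (iter_derive f vs) by elim: vs => //= v vs IH; exact: CD.
by split => [|v x]; [exact: Cc|exact: Cd].
Qed.

Lemma smooth_continuous f : smooth f -> continuous f.
Proof. by move=> /(_ [::])[]. Qed.

Lemma smooth_derivable f x v : smooth f -> derivable f x v.
Proof. by move=> /(_ [::])[_]. Qed.

Lemma smooth_derive f v : smooth f -> smooth (fun x => 'D_v f x).
Proof.
move=> sf vs; have := sf (rcons vs v).
by rewrite /iter_derive foldr_rcons.
Qed.

(** Products of smooth functions are not stable under derivatives; by the Leibniz rule their finite
    sums are. *)
Inductive sum_of_products : (V -> R) -> Prop :=
| sop_mul f g : smooth f -> smooth g -> sum_of_products (f * g)
| sop_add f g : sum_of_products f -> sum_of_products g -> sum_of_products (f + g).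

Lemma sum_of_productsP f : sum_of_products f ->
  [/\ continuous f, forall x v, derivable f x v &
      forall v, sum_of_products (fun x => 'D_v f x)].
Proof.
elim=> {f} [f g sf sg|f g _ [cf df Df] _ [cg dg Dg]].
  have df x v := @smooth_derivable f x v sf; have dg x v := @smooth_derivable g x v sg.
  split=> [x|x v|v].
  - by apply: continuousM; exact: smooth_continuous.
  - exact: derivableM.
  - rewrite (_ : (fun x => _) = f * (fun x => 'D_v g x) + g * (fun x => 'D_v f x)).
      apply: sop_add; first exact: (sop_mul sf (smooth_derive v sg)).
      exact: (sop_mul sg (smooth_derive v sf)).
    by apply/funext => x; rewrite deriveM.
split=> [x|x v|v].
- exact: (continuousD (cf x) (cg x)).
- exact: derivableD.
- rewrite (_ : (fun x => _) = (fun x => 'D_v f x) + (fun x => 'D_v g x)).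
    exact: sop_add.
  by apply/funext => x; rewrite deriveD.
Qed.

Lemma smoothM f g : smooth f -> smooth g -> smooth (f * g).
Proof.
move=> sf sg; apply: (@smooth_of_class sum_of_products); last exact: sop_mul.
- by move=> h /sum_of_productsP[].
- by move=> h /sum_of_productsP[].
- by move=> h v /sum_of_productsP[].
Qed.

Definition affine_form (l L : V -> R) :=
  continuous l /\ forall h v x, l (h *: v + x) = h * L v + l x.

(* This class contains the bump functions and is closed under directional
   derivatives, hence consists of smooth functions. *)
Inductive flat_algebra : (V -> R) -> Prop :=
| fa_cst c : flat_algebra (cst c)
| fa_flat m l L : affine_form l L -> flat_algebra (flat m \o l)
| fa_add f g : flat_algebra f -> flat_algebra g -> flat_algebra (f + g)
| fa_mul f g : flat_algebra f -> flat_algebra g -> flat_algebra (f * g).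

Lemma flat_algebra_smooth f : flat_algebra f -> smooth f.
Proof.
have P f0 : flat_algebra f0 -> continuous f0 /\
    forall v, exists2 df, flat_algebra df & forall x, is_derive x v f0 (df x).
  elim=> {f0} [c|m l L lL|f0 g fa [cf df] ga [cg dg]|f0 g fa [cf df] ga [cg dg]].
  - split=> [x|v]; first exact: cvg_cst.
    by exists (cst 0) => [|x]; [exact: fa_cst|exact: is_derive_cst].
  - have [cl lE] := lL; split=> [x|v].
      apply: continuous_comp; first exact: cl.
      apply/differentiable_continuous/derivable1_diffP.
      exact: (@ex_derive _ _ _ _ _ _ _ (is_derive_flat m (l x))).
    exists (((flat m.+2 \o l) + cst (- m%:R) * (flat m.+1 \o l)) * cst (L v)).
      apply: fa_mul; last exact: fa_cst.
      apply: fa_add; first exact: fa_flat lL.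
      by apply: fa_mul; [exact: fa_cst|exact: fa_flat lL].
    move=> x; rewrite !fctE mulNr.
    apply: (@is_derive_of_quotient _ _ _ _ _ (flat m \o (fun h : R => h * L v + l x))
        _ _ (0 : R) (1 : R)).
      by move=> h /=; rewrite lE addr0 -[h *: 1]/(h * 1) mulr1.
    have dl : is_derive (0 : R) 1 (fun h : R => h * L v + l x) (L v).
      by apply: is_derive_eq; rewrite addr0 scale0r add0r -[_ *: _]/(_ * _) mulr1.
    by apply: (is_derive_eq (is_derive1_comp (is_derive_flat m _) dl)); rewrite mul0r add0r.
  - split=> [x|v]; first exact: (continuousD (cf x) (cg x)).
    have [f' f'a fD] := df v; have [g' g'a gD] := dg v.
    by exists (f' + g') => [|x]; [exact: fa_add|exact: is_deriveD].
  - split=> [x|v]; first exact: (continuousM (cf x) (cg x)).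
    have [f' f'a fD] := df v; have [g' g'a gD] := dg v.
    exists (f0 * g' + g * f') => [|x]; last exact: is_deriveM.
    by apply: fa_add; exact: fa_mul.
move=> fa; apply: (@smooth_of_class flat_algebra) => // [g /P[]//|g ga x v|g v ga].
  by have [_ /(_ v)[dg _ /(_ x)[]]] := P _ ga.
have [_ /(_ v)[dg dga gD]] := P _ ga.
rewrite (_ : (fun x => _) = dg)//; apply/funext => x.
by have [_ ->] := gD x.
Qed.

End smooth_class.

Section smooth_comp.
Context d d' (R : realType) (V : measNormedModType d R) (W : measNormedModType d' R).
Variables (A L : V -> W).
Hypothesis cA : continuous A.
Hypothesis AE : forall (h : R) v x, A (h *: v + x) = h *: L v + A x.

(** The chain rule in the case that is used: insertion of a slice, the projections of a product and
    [mx_cons] are affine, with linear part [L]. *)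
Lemma iter_derive_comp_affine (f : W -> R) vs :
  iter_derive (f \o A) vs = iter_derive f (map L vs) \o A.
Proof.
elim: vs => //= v vs ->; apply/funext => x /=; rewrite /derive.
set u := (fun h : R => _); set w := (fun h : R => _).
by have -> : u = w by apply/funext => h; rewrite /u /w /= AE.
Qed.

Lemma smooth_comp_affine (f : W -> R) : smooth f -> smooth (f \o A).
Proof.
move=> sf vs; rewrite iter_derive_comp_affine; have [cf df] := sf (map L vs).
split=> [x|v x]; first by apply: continuous_comp; [exact: cA|exact: cf].
apply: ex_derive.
apply: (@is_derive_of_quotient _ _ _ _ _ (iter_derive f (map L vs)) _ _ (A x) (L v)).
  by move=> h /=; rewrite AE.
exact/derivableP.
Qed.

End smooth_comp.

(** * The fundamental lemma of the calculus of variations *)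

Section pi_system.
Context d (T : measurableType d) (R : realType) (mu : {measure set T -> \bar R}).
Variable P : set (set T).
Hypotheses (genP : d.-measurable = <<s P>>) (PI : setI_closed P).
Variable B : nat -> set T.
Hypotheses (PB : forall n, P (B n)) (BT : \bigcup_n B n = setT).

Let mP A : P A -> measurable A.
Proof. by move=> PA; rewrite genP; exact: sub_sigma_algebra. Qed.

(** On each [B n], the sets over which the restriction of [f] has integral zero form a Dynkin system
    containing [P]. *)
Lemma ae0_of_pi_system (f : T -> R) :
  (forall n, mu.-integrable (B n) (EFin \o f)) ->
  (forall n A, P A -> A `<=` B n -> \int[mu]_(x in A) f x = 0) ->
  {ae mu, forall x, f x = 0}.
Proof.
move=> fi f0.
have H n : {ae mu, forall x, B n x -> f x = 0}.
  have mB := mP (PB n).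
  pose g := (EFin \o f) \_ (B n).
  have gi : mu.-integrable setT g by apply/(integrable_mkcond (EFin \o f) mB); exact: fi.
  have giA A : measurable A -> mu.-integrable A g by move=> mA; exact: integrableS gi.
  have gP A : P A -> (\int[mu]_(x in A) g x = 0)%E.
    move=> PA; have mA := mP PA; rewrite -integral_mkcondr.
    have := f0 n (A `&` B n) (PI PA (PB n)) (@subIsetr _ _ _).
    rewrite /Rintegral => e; rewrite -[LHS]fineK ?e//.
    apply: integrable_fin_num; first exact: measurableI.
    by apply: integrableS (fi n) => //; exact: measurableI.
  (* The stability under complements requires the total integral to vanish; for the restriction this
     is the integral over [B n]. *)
  have gT : (\int[mu]_x g x = 0)%E.
    by rewrite -[RHS](gP _ (PB n)) /g -!integral_mkcondr setTI setIid.
  have zero A : measurable A -> (\int[mu]_(x in A) g x = 0)%E.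
    rewrite {1}genP; move: A; apply: (dynkin_induction genP PI) => //.
    - move=> S mS S0; have := gT; rewrite -(setUv S) integral_setU//.
      + by rewrite S0 add0e.
      + exact: measurableC.
      + by rewrite setUv; exact: measurable_int gi.
      + by apply/disj_setPLR; rewrite setCK.
    - move=> F mF tF F0; rewrite integral_bigcup//.
        by rewrite eseries0// => k _ _; exact: F0.
      by apply: giA; exact: bigcupT_measurable.
  have : ae_eq mu setT g (cst 0%E).
    apply: integral_ae_eq => // E _ mE.
    by rewrite (zero _ mE) integral0.
  apply: filterS => x /(_ I); rewrite /g patchE => h Bx.
  by move: h; rewrite mem_set// => -[].
have := ae_foralln H; apply: filterS => x h.
by have : setT x by []; rewrite -BT => -[n _ Bx]; exact: h Bx.
Qed.

End pi_system.
Section boxes.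
Context d (V : measurableType d) (R : realType) (J : finType).
Variable l : J -> V -> R.
Hypothesis ml : forall j, measurable_fun setT (l j).

Definition cylinders : set (set V) :=
  [set A | exists j, exists2 B : set R, measurable B & A = l j @^-1` B].

Definition box (a b : J -> R) : set V := [set v | forall j, a j < l j v < b j].

Definition boxes : set (set V) := [set A | exists a b, A = box a b].

Definition cube (n : nat) : set V := box (fun=> - n%:R) (fun=> n%:R).

(** A smooth approximation of the indicator of the open box: it vanishes off the box and tends to 1
    on it as [k] grows. *)
Definition bump (a b : J -> R) (k : nat) (v : V) : R :=
  \prod_j (flat 0 (k.+1%:R * (l j v - a j)) * flat 0 (k.+1%:R * (b j - l j v))).

Lemma measurable_box a b : measurable (box a b).
Proof.
rewrite (_ : box a b = \bigcap_(j in [set: J]) (l j @^-1` `]a j, b j[)).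
  apply: fin_bigcap_measurable; first exact: finite_finset.
  by move=> j _; rewrite -[X in measurable X]setTI; apply: ml => //; exact: measurable_itv.
by apply/seteqP; split => [v bv j _|v bv j] /=; [rewrite in_itv/=|
  have := bv j I; rewrite /= in_itv].
Qed.

Lemma boxes_setI : setI_closed boxes.
Proof.
move=> _ _ [a [b ->]] [a' [b' ->]].
exists (fun j => Num.max (a j) (a' j)), (fun j => Num.min (b j) (b' j)).
apply/seteqP; split => [v [h h'] j|v h].
  have /andP[h1 h2] := h j; have /andP[h3 h4] := h' j.
  by rewrite gt_max lt_min h1 h2 h3 h4.
by split => j; have := h j; rewrite gt_max lt_min => /andP[/andP[? ?] /andP[? ?]]; apply/andP.
Qed.

Lemma ex_cube v : exists n, forall j, `|l j v| < n%:R.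
Proof.
pose s := \sum_j `|l j v|.
have s0 : 0 <= s by exact: sumr_ge0.
exists (Num.bound s) => j; apply: le_lt_trans (archi_boundP s0).
by rewrite /s (bigD1 j)//= lerDl sumr_ge0.
Qed.

Lemma bigcup_cube : \bigcup_n cube n = setT.
Proof.
apply/seteqP; split => // v _; have [n Hn] := ex_cube v.
by exists n => // j; rewrite -ltr_norml.
Qed.

Lemma measurable_boxes : d.-measurable `<=` <<s cylinders >> -> d.-measurable = <<s boxes >>.
Proof.
move=> gen; apply/seteqP; split; last first.
  apply: smallest_sub; first exact: sigma_algebra_measurable.
  by move=> _ [a [b ->]]; exact: measurable_box.
move=> A /gen; apply: smallest_sub; first exact: smallest_sigma_algebra.
move=> _ [j [B mB ->]].
have mj : @measurable_fun _ _ (g_sigma_algebraType boxes) _ setT (l j).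
  apply: (@measurability _ _ _ _ _ _ (@RGenOInfty.G R)).
    exact: RGenOInfty.measurableE.
  move=> _ [_ [x ->] <-]; rewrite setTI.
  (* An open half-space is exhausted by boxes: the bound [x] is kept and all the other bounds go to
     infinity with [n]. *)
  rewrite (_ : _ @^-1` _ = \bigcup_n box (fun i => if i == j then x else - n%:R)
     (fun=> n%:R)).
    by apply: bigcupT_measurable => n; apply: sub_sigma_algebra; eexists; eexists.
  apply/seteqP; split => [v /=|v [n _ /(_ j)] /=]; rewrite in_itv/= andbT; last first.
    by rewrite eqxx => /andP[].
  move=> xv; have [n Hn] := ex_cube v; exists n => // i.
  by have := Hn i; rewrite ltr_norml => /andP[h ->]; rewrite andbT; case: eqP => // ->.
by have := mj measurableT _ mB; rewrite setTI.
Qed.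

Lemma bump_ge0 a b k v : 0 <= bump a b k v.
Proof. by apply: prodr_ge0 => j _; rewrite mulr_ge0 ?flat_ge0. Qed.

Lemma bump_le1 a b k v : bump a b k v <= 1.
Proof.
suff /andP[//] : 0 <= bump a b k v <= 1.
rewrite /bump; elim/big_ind : _ => [|x y /andP[? ?] /andP[? ?]|j _].
- by rewrite ler01 lexx.
- by rewrite mulr_ge0// mulr_ile1.
- by rewrite mulr_ge0 ?flat_ge0// mulr_ile1 ?flat_ge0 ?flat0_le1.
Qed.

Lemma bump_out a b k v : ~ box a b v -> bump a b k v = 0.
Proof.
move=> nb; have [j] : exists j, ~ (a j < l j v < b j).
  by apply/not_existsP => h; apply: nb => j; apply: contrapT; exact: h.
move=> /negP; rewrite negb_and -!leNgt => h.
rewrite /bump (bigD1 j)//=; case/orP: h => h.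
  by rewrite (@flat_le0 _ _ (_ * (l j v - _))) ?mul0r// mulr_ge0_le0// subr_le0.
by rewrite (@flat_le0 _ _ (_ * (_ - l j v))) ?mulr0 ?mul0r// mulr_ge0_le0// subr_le0.
Qed.

Lemma cvg_flat0 (s : R) : 0 < s -> flat 0 (k.+1%:R * s) @[k --> \oo] --> (1 : R).
Proof.
move=> s0; rewrite (_ : (fun k => _) = fun k => expR (- (harmonic k * s^-1))).
  rewrite -[X in _ --> X](@expR0 R) -[X in expR X]oppr0 -[X in - X](mul0r s^-1).
  apply: continuous_cvg; first exact: continuous_expR.
  by apply: cvgN; apply: cvgM; [exact: cvg_harmonic|exact: cvg_cst].
apply/funext => k; rewrite flat_gt0E ?mulr_gt0// expr0 mul1r.
by rewrite invfM.
Qed.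

Lemma cvg_bump a b v : box a b v -> bump a b k v @[k --> \oo] --> (1 : R).
Proof.
move=> bv; rewrite /bump.
pose F k j := flat 0 (k.+1%:R * (l j v - a j)) * flat 0 (k.+1%:R * (b j - l j v)).
have F1 j : F^~ j @ \oo --> (1 : R).
  have /andP[h1 h2] := bv j.
  have := cvgM (@cvg_flat0 (l j v - a j) _) (@cvg_flat0 (b j - l j v) _).
  by rewrite !subr_gt0 mulr1; apply.
have {}F1 (s : seq J) : (fun k => \prod_(j <- s) F k j) @ \oo --> (1 : R).
  elim: s => [|j s IH].
    by under eq_fun do rewrite big_nil; exact: cvg_cst.
  have : (fun k => F k j * \prod_(i <- s) F k i) @ \oo --> (1 : R).
    by rewrite -[X in _ --> X]mulr1; exact: cvgM.
  by under [in X in _ -> X]eq_fun do rewrite big_cons.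
exact: F1.
Qed.

Lemma measurable_bump a b k : measurable_fun setT (bump a b k).
Proof.
have mflat : measurable_fun setT (@flat R 0).
  apply: continuous_measurable_fun => t.
  apply/differentiable_continuous/derivable1_diffP.
  exact: (@ex_derive _ _ _ _ _ _ _ (is_derive_flat 0 t)).
apply: measurable_prod => j _; apply: measurable_funM.
  by apply: (measurableT_comp mflat); apply: measurable_funM => //; exact: measurable_funB.
by apply: (measurableT_comp mflat); apply: measurable_funM => //; exact: measurable_funB.
Qed.

Section fundamental_lemma.
Variable mu : {measure set V -> \bar R}.
Hypothesis gen : d.-measurable `<=` <<s cylinders >>.

(** As [k] grows, the integrals against [bump] tend to the integral over the box, by dominated
    convergence with bound |f|; boxes are a generating pi-system. *)
Lemma fundamental_lemma (f : V -> R) :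
  (forall n, mu.-integrable (cube n) (EFin \o f)) ->
  (forall a b k, \int[mu]_x (f x * bump a b k x) = 0) ->
  {ae mu, forall x, f x = 0}.
Proof.
move=> fi f0.
apply: (ae0_of_pi_system (measurable_boxes gen) boxes_setI (B := cube)) => //.
- by move=> n; exists (fun=> - n%:R), (fun=> n%:R).
- exact: bigcup_cube.
move=> n _ [a [b ->]] An; have mA := measurable_box a b.
have fA : mu.-integrable (box a b) (EFin \o f).
  by apply: integrableS (fi n) => //; exact: measurable_box.
have mf : measurable_fun (box a b) f by apply/measurable_EFinP; exact: measurable_int fA.
have I0 k : (\int[mu]_(x in box a b) (f x * bump a b k x)%:E = 0)%E.
  have fk : mu.-integrable (box a b) (fun x => (f x * bump a b k x)%:E).
    apply: le_integrable fA => //.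
      apply/measurable_EFinP/measurable_funM => //.
      exact/measurable_funTS/measurable_bump.
    move=> x _; rewrite !abse_EFin lee_fin normrM ler_piMr//.
    by rewrite ger0_norm ?bump_ge0// bump_le1.
  rewrite -[LHS]fineK; last exact: integrable_fin_num.
  congr EFin; rewrite -[RHS](f0 a b k) [RHS]Rintegral_mkcond.
  rewrite -[LHS]/(Rintegral _ _ _) Rintegral_mkcond.
  congr Rintegral; apply/funext => x; rewrite !patchE in_setT.
  case: ifPn => //; rewrite notin_setE => nb.
  by rewrite bump_out// mulr0.
have [|||||_ _] := @dominated_convergence _ _ _ mu (box a b) mA
  (fun k x => (f x * bump a b k x)%:E) (EFin \o f) (fun x => `|(f x)%:E|)%E.
- by move=> k; apply/measurable_EFinP/measurable_funM => //; exact/measurable_funTS/measurable_bump.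
- exact: measurable_int fA.
- apply: aeW => x bx; apply: cvg_EFin; first exact: nearW.
  rewrite -[X in _ --> X]mulr1.
  by apply: (@cvgM _ _ _ _ (fun=> f x) (fun k => bump a b k x)); [exact: cvg_cst|exact: cvg_bump].
- exact: integrable_abse.
- apply: aeW => x k _; rewrite !abse_EFin lee_fin normrM ler_piMr//.
  by rewrite ger0_norm ?bump_ge0// bump_le1.
under eq_fun do rewrite I0.
by move=> /cvg_lim E; rewrite /Rintegral -[X in fine X]E// lim_cst.
Qed.

End fundamental_lemma.
End boxes.

(** * Matrix spaces, their products, and their closed cubes *)

Section coordinates.
Context d (R : realType) (V : measNormedModType d R) (J : finType).
Variable l : J -> V -> R.

(* The closed cubes are used both as a compact exhaustion and as the domains of
   local integrability. *)
Definition ccube (c : R) : set V := [set v | forall j, `|l j v| <= c].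

(** Shared by matrix spaces and their products, so that the theory of test functions is developed
    once for points, pairs of points and configurations of electrons. *)
Record coordinates : Prop := {
  coordinate_continuous : forall j, continuous (l j);
  coordinate_linear : forall j (h : R) v x, l j (h *: v + x) = h * l j v + l j x;
  coordinate_measurable : forall j, measurable_fun setT (l j);
  coordinate_gen : d.-measurable `<=` <<s cylinders l >>;
  coordinate_compact : forall c, compact (ccube c) }.

Hypothesis cl : coordinates.

Lemma bounded_in_ccube (K : set V) : compact K -> exists n : nat, K `<=` ccube n%:R.
Proof.
move=> cK.
have /choice[M HM] : forall j, exists M : R, forall v, K v -> `|l j v| <= M.
  move=> j.
  have : compact (l j @` K).
    by apply: continuous_compact => //; exact/continuous_subspaceT/(coordinate_continuous cl).
  move=> /compact_bounded[M [_ HM]]; exists (M + 1) => v Kv.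
  by apply: HM; [rewrite ltrDl|exists v].
pose s := \sum_j `|M j|; have s0 : 0 <= s by exact: sumr_ge0.
exists (Num.bound s) => v Kv j; apply: le_trans (HM j v Kv) _.
apply: le_trans (ltW (archi_boundP s0)).
by rewrite /s (bigD1 j)//=; apply: le_trans (ler_norm _) _; rewrite lerDl sumr_ge0.
Qed.

Lemma measurable_ccube c : measurable (ccube c).
Proof.
rewrite (_ : ccube c = \bigcap_(j in [set: J]) (l j @^-1` `[- c, c])).
  apply: fin_bigcap_measurable; first exact: finite_finset.
  move=> j _; rewrite -[X in measurable X]setTI; have mj := coordinate_measurable cl j.
  by apply: mj => //; exact: measurable_itv.
by apply/seteqP; split => [v bv j _|v bv j] /=; [rewrite in_itv/= -ler_norml|
  have := bv j I; rewrite /= in_itv/= -ler_norml].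
Qed.

Lemma test_function_bump a b k : test_function (bump l a b k).
Proof.
split.
  apply: flat_algebra_smooth.
  pose f j v := flat 0 (k.+1%:R * (l j v - a j)) * flat 0 (k.+1%:R * (b j - l j v)).
  have fa j : flat_algebra (f j).
    apply: fa_mul.
      apply: (@fa_flat _ _ _ 0%N (fun v => k.+1%:R * (l j v - a j)) (fun v => k.+1%:R * l j v)).
      split=> [v|h v x]; last by rewrite (coordinate_linear cl); ring.
      apply: (@continuousM _ _ (fun=> k.+1%:R) (fun v => l j v - a j)); first exact: cvg_cst.
      by apply: (@continuousB _ _ _ (l j) (fun=> a j)); [exact: coordinate_continuous cl j v|exact: cvg_cst].
    apply: (@fa_flat _ _ _ 0%N (fun v => k.+1%:R * (b j - l j v)) (fun v => - (k.+1%:R * l j v))).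
    split=> [v|h v x]; last by rewrite (coordinate_linear cl); ring.
    apply: (@continuousM _ _ (fun=> k.+1%:R) (fun v => b j - l j v)); first exact: cvg_cst.
    by apply: (@continuousB _ _ _ (fun=> b j) (l j)); [exact: cvg_cst|exact: coordinate_continuous cl j v].
  suff H (s : seq J) : flat_algebra (fun v => \prod_(j <- s) f j v) by exact: H.
  elim: s => [|j s IH].
    rewrite (_ : (fun v => _) = cst 1); first exact: fa_cst.
    by apply/funext => v; rewrite big_nil.
  rewrite (_ : (fun v => _) = f j * (fun v => \prod_(j <- s) f j v)).
    exact: fa_mul (fa j) IH.
  by apply/funext => v; rewrite big_cons.
pose c := \sum_j (`|a j| + `|b j|).
exists (ccube c); first exact: coordinate_compact cl c.
move=> v nv; apply: bump_out => bv; apply: nv => j.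
have /andP[h1 h2] := bv j.
apply: (@le_trans _ _ (`|a j| + `|b j|)).
  rewrite ler_norml; have := ler_norm (b j); have := ler_norm (- a j); rewrite normrN.
  by have := normr_ge0 (a j); have := normr_ge0 (b j) => *; apply/andP; split; lra.
by rewrite /c (bigD1 j)//= lerDl sumr_ge0// => i _; rewrite addr_ge0.
Qed.

Variable mu : {measure set V -> \bar R}.

Lemma ae0_of_tests (f : V -> R) :
  (forall n : nat, mu.-integrable (ccube n%:R) (EFin \o f)) ->
  (forall phi, test_function phi -> \int[mu]_x (f x * phi x) = 0) ->
  {ae mu, forall x, f x = 0}.
Proof.
move=> fi f0; have ml := coordinate_measurable cl.
apply: (fundamental_lemma ml (coordinate_gen cl)).
  move=> n; apply: integrableS (fi n).
  - exact: measurable_ccube.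
  - exact: measurable_box.
  - by move=> v bv j; rewrite ltW// ltr_norml; exact: bv.
by move=> a b k; apply: f0; exact: test_function_bump.
Qed.

End coordinates.

Section separable.
Context d (R : realType) (V : measNormedModType d R).

Definition dense_seq (q : nat -> V) := forall x (e : R), 0 < e -> exists k, ball x e (q k).

Variable q : nat -> V.
Hypothesis dq : dense_seq q.
Hypothesis mball : forall x (e : R), d.-measurable (ball x e : set V).

(** The sigma-algebra is not defined by open sets. An open set is the union of the countably many
    balls contained in it with centre in the dense sequence and radius 1/(m+1). *)
Lemma measurable_open (A : set V) : open A -> measurable A.
Proof.
move=> oA.
pose P (p : nat * nat) := ball (q p.1) (p.2.+1%:R^-1) `<=` A.
rewrite (_ : A = \bigcup_(p in P) ball (q p.1) (p.2.+1%:R^-1 : R)).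
  rewrite bigcup_mkcond; apply: countable_bigcupT_measurable => [|p].
    exact: countableP.
  by case: ifP => _; [exact: mball|exact: measurable0].
apply/seteqP; split => [x Ax|x [p Pp px]]; last exact: Pp.
have /nbhs_ballP[e /= e0 eA] : nbhs x A by exact: open_nbhs_nbhs.
have e2 : 0 < e / 2 by rewrite divr_gt0.
have [m _ Hm] := near_infty_natSinv_lt (PosNum e2).
have [k xk] := @dq x m.+1%:R^-1 ltac:(by rewrite invr_gt0).
exists (k, m); last exact: ball_sym.
move=> y /= ky; apply: eA.
apply: (@le_ball _ _ _ (m.+1%:R^-1 + m.+1%:R^-1)).
  by have := Hm m (leqnn m) => /=; set z := m.+1%:R^-1; lra.
exact: ball_triangle xk ky.
Qed.

Lemma measurable_compact (K : set V) : compact K -> measurable K.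
Proof.
move=> cK; rewrite -(setCK K); apply/measurableC/measurable_open.
rewrite openC; apply: compact_closed => //; exact: norm_hausdorff.
Qed.

Lemma dense_seq_cvg x : exists k : nat -> nat, (fun n => q (k n) : V) @ \oo --> (x : V).
Proof.
have H n : exists k, ball x n.+1%:R^-1 (q k) by apply: dq; rewrite invr_gt0.
have [k Hk] := choice H; exists k.
apply/cvg_ballP => e e0; have [m _ Hm] := near_infty_natSinv_lt (PosNum e0).
exists m => // n /= mn; apply: le_ball (Hk n); exact/ltW/Hm.
Qed.

End separable.

Section matrix_space.
Context (R : realType) (m n : nat).
Local Notation M := 'M[R]_(m, n).
Local Notation MJ := ('I_m * 'I_n)%type.

Definition entry (ij : MJ) (A : M) : R := A ij.1 ij.2.

Lemma mx_continuous (T : topologicalType) (f : T -> M) :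
  (forall i j, continuous (fun x => f x i j : R)) -> continuous f.
Proof.
move=> cf x; apply/cvg_ballP => e e0.
have : \forall y \near x, forall ij : MJ, ball (f x ij.1 ij.2) e (f y ij.1 ij.2).
  by apply: filter_forall => ij; have /cvg_ballP := cf ij.1 ij.2 x; apply.
by apply: filterS => y H; split => // i j; exact: (H (i, j)).
Qed.

Lemma mx_coordinates : coordinates (entry : MJ -> M -> R).
Proof.
split.
- by move=> j; exact: coord_continuous.
- by move=> j h v x; rewrite /entry !mxE.
- by move=> j; exact: measurable_entry.
- move=> A; rewrite /measurable /=; apply: smallest_sub; first exact: smallest_sigma_algebra.
  move=> _ [i [j [B mB ->]]]; apply: sub_sigma_algebra; exists (i, j).
  by exists B.
(* The closed cube is the image under [vec_mx] of a product of segments, which is compact. *)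
- move=> c; pose A (_ : 'I_(m * n)) := `[- c, c]%classic : set R.
  have cA := @rV_compact _ _ A (fun=> @segment_compact _ _ _).
  have cf : continuous (vec_mx : 'rV[R]_(m * n) -> M).
    apply: mx_continuous => i j.
    rewrite (_ : (fun x => _) = (fun x : 'rV[R]_(m * n) => x 0 (mxvec_index i j))).
      exact: coord_continuous.
    by apply/funext => x; rewrite mxE.
  have := continuous_compact (continuous_subspaceT cf) cA.
  rewrite (_ : _ @` _ = ccube entry c)//; apply/seteqP; split.
    by move=> _ [v Av <-] [i j]; rewrite /entry /= mxE ler_norml; have := Av (mxvec_index i j); rewrite /A /= in_itv.
  move=> v cv; exists (mxvec v); last exact: mxvecK.
  move=> k; case/mxvec_indexP: k => i j; rewrite /A /= in_itv/= -ler_norml mxvecE.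
  exact: cv (i, j).
Qed.

Lemma measurable_mx_ball (x : M) (e : R) : measurable (ball x e).
Proof.
have [e0|e0] := ltP 0 e; last first.
  rewrite (_ : ball x e = set0); first exact: measurable0.
  by apply/seteqP; split => // y [e1 _]; move: e0; rewrite leNgt e1.
rewrite (_ : ball x e = \bigcap_(ij in [set: MJ]) (entry ij @^-1` (ball (entry ij x) e))).
  apply: fin_bigcap_measurable; first exact: finite_finset.
  move=> ij _; rewrite -[X in measurable X]setTI; have mj := coordinate_measurable mx_coordinates ij.
  by apply: mj => //; exact: measurable_ball.
apply/seteqP; split => [y [_ xy] ij _|y xy]; first exact: xy.
by split => // i j; exact: (xy (i, j) I).
Qed.

Lemma mx_dense : exists q : nat -> M, dense_seq q.
Proof.
pose q k : M := if unpickle k is Some A then map_mx ratr (A : 'M[rat]_(m, n)) else 0.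
exists q => x e e0.
have H (ij : MJ) : exists r : rat, ratr r \in `](entry ij x - e), (entry ij x + e)[.
  by apply: rat_in_itvoo; lra.
have [r Hr] := choice H.
exists (pickle (\matrix_(i, j) r (i, j))); split => // i j.
rewrite /q pickleK !mxE; have := Hr (i, j).
by rewrite in_itv/= /entry/= /ball/= ltr_distlC.
Qed.

End matrix_space.

Section product_space.
Context d1 d2 (R : realType) (V : measNormedModType d1 R) (W : measNormedModType d2 R).
Variables (J1 J2 : finType) (l1 : J1 -> V -> R) (l2 : J2 -> W -> R).

Definition pair_coord (j : J1 + J2) (p : V * W) : R :=
  match j with inl a => l1 a p.1 | inr b => l2 b p.2 end.

Hypotheses (c1 : coordinates l1) (c2 : coordinates l2).

Let gen d (X : measNormedModType d R) (J : finType) (l : J -> X -> R) :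
  coordinates l -> d.-measurable = <<s cylinders l >>.
Proof.
move=> c; apply/seteqP; split; first exact: coordinate_gen c.
apply: smallest_sub; first exact: sigma_algebra_measurable.
move=> _ [j [B mB ->]]; rewrite -[X in measurable X]setTI.
exact: (coordinate_measurable c j).
Qed.

Lemma ccube_pair c : ccube pair_coord c = ccube l1 c `*` ccube l2 c.
Proof.
apply/seteqP; split => [p H|p [H1 H2] [j|j]]; last 2 first.
- exact: H1.
- exact: H2.
by split => j; [exact: (H (inl j))|exact: (H (inr j))].
Qed.

Lemma pair_coordinates : coordinates pair_coord.
Proof.
split.
- move=> [j|j] x /=.
    apply: (@continuous_comp _ _ _ fst (l1 j)); first exact: cvg_fst.
    exact: coordinate_continuous c1 j _.
  apply: (@continuous_comp _ _ _ snd (l2 j)); first exact: cvg_snd.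
  exact: coordinate_continuous c2 j _.
- by move=> [j|j] h v x /=; [exact: coordinate_linear c1 j _ _ _|exact: coordinate_linear c2 j _ _ _].
- move=> [j|j] /=.
    exact: measurableT_comp (coordinate_measurable c1 j) measurable_fst.
  exact: measurableT_comp (coordinate_measurable c2 j) measurable_snd.
- have m1 : @measurable_fun _ _ (g_sigma_algebraType (cylinders pair_coord)) V setT fst.
    apply: (@measurability _ _ _ _ _ _ (cylinders l1)); first exact: gen c1.
    move=> _ [_ [j [B mB ->]] <-]; rewrite setTI; apply: sub_sigma_algebra.
    by exists (inl j); exists B.
  have m2 : @measurable_fun _ _ (g_sigma_algebraType (cylinders pair_coord)) W setT snd.
    apply: (@measurability _ _ _ _ _ _ (cylinders l2)); first exact: gen c2.
    move=> _ [_ [j [B mB ->]] <-]; rewrite setTI; apply: sub_sigma_algebra.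
    by exists (inr j); exists B.
  rewrite [X in X `<=` _](measurable_prod_measurableType V W).
  apply: smallest_sub; first exact: smallest_sigma_algebra.
  move=> _ [A mA [B mB <-]]; rewrite (_ : A `*` B = (setT `&` fst @^-1` A) `&` (setT `&` snd @^-1` B)).
    apply: (@measurableI _ (g_sigma_algebraType (cylinders pair_coord))); [exact: m1|exact: m2].
  by rewrite !setTI.
- move=> c; rewrite ccube_pair; apply: compact_setX; exact: coordinate_compact.
Qed.

Lemma measurable_pair_ball :
  (forall (x : V) (e : R), d1.-measurable (ball x e : set V)) ->
  (forall (x : W) (e : R), d2.-measurable (ball x e : set W)) ->
  forall (x : V * W) (e : R), measurable (ball x e : set (V * W)).
Proof.
move=> m1 m2 x e; rewrite (_ : ball x e = ball x.1 e `*` ball x.2 e).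
  exact: measurableX.
by apply/seteqP; split => [y []|y []].
Qed.

Lemma pair_dense : (exists q : nat -> V, dense_seq q) ->
  (exists q : nat -> W, dense_seq q) -> exists q : nat -> V * W, dense_seq q.
Proof.
move=> [q1 D1] [q2 D2].
exists (fun k => if unpickle k is Some (i, j) then (q1 i, q2 j) else (0, 0)) => x e e0.
have [i Hi] := D1 x.1 _ e0; have [j Hj] := D2 x.2 _ e0.
by exists (pickle (i, j)); rewrite pickleK; split.
Qed.

End product_space.

Section finite_cubes.
Context {R : realType}.

Lemma leb_rV_ccube n (c : R) : (leb_rV n (ccube (@entry R 1 n) c) < +oo)%E.
Proof.
elim: n => [|n IH] /=.
  by rewrite diracE; case: (_ \in _); rewrite ltry.
have m1 : measurable (`[- c, c]%classic : set R) by exact: measurable_itv.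
have m2 := measurable_ccube (mx_coordinates R 1 n) c.
apply: (@le_lt_trans _ _ ((lebesgue_measure \x leb_rV n)%E (`[- c, c]%classic `*` ccube (@entry R 1 n) c))).
  rewrite /image_prod /pushforward; apply: le_measure; rewrite ?inE.
  - rewrite -[X in measurable X]setTI; apply: measurable_row_cons => //.
    exact: (measurable_ccube (mx_coordinates R 1 n.+1)).
  - exact: measurableX.
  - move=> [x v] /= H; split => /=.
      rewrite in_itv/= -ler_norml; have := H (ord0, @lshift 1 n ord0).
      change (`|row_cons (x, v) ord0 (@lshift 1 n ord0)| <= c -> `|x| <= c).
      by rewrite /row_cons row_mxEl mxE.
    move=> [i j]; have := H (i, @rshift 1 n j).
    change (`|row_cons (x, v) i (@rshift 1 n j)| <= c -> `|v i j| <= c).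
    by rewrite /row_cons row_mxEr.
have li : (lebesgue_measure ([set` `[(- c)%R, c%R]] : set R) < +oo)%E.
  by rewrite lebesgue_measure_itv/=; case: ifP => _; rewrite ?ltry// -EFinD ltry.
rewrite product_measure1E//; apply: lte_mul_pinfty => //.
by rewrite ge0_fin_numE.
Qed.

Lemma leb_mx_ccube m n (c : R) : (leb_mx m n (ccube (@entry R m n) c) < +oo)%E.
Proof.
elim: m => [|m IH] /=.
  by rewrite diracE; case: (_ \in _); rewrite ltry.
have m1 := measurable_ccube (mx_coordinates R 1 n) c.
have m2 := measurable_ccube (mx_coordinates R m n) c.
apply: (@le_lt_trans _ _ ((leb_rV n \x leb_mx m n)%E (ccube (@entry R 1 n) c `*` ccube (@entry R m n) c))).
  rewrite /image_prod /pushforward; apply: le_measure; rewrite ?inE.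
  - rewrite -[X in measurable X]setTI; apply: measurable_mx_cons => //.
    exact: (measurable_ccube (mx_coordinates R m.+1 n)).
  - exact: measurableX.
  - move=> [x v] /= H; split => /= -[i j].
      have := H (@lshift 1 m i, j).
      change (`|mx_cons (x, v) (@lshift 1 m i) j| <= c -> `|x i j| <= c).
      by rewrite /mx_cons col_mxEu.
    have := H (@rshift 1 m i, j).
    change (`|mx_cons (x, v) (@rshift 1 m i) j| <= c -> `|v i j| <= c).
    by rewrite /mx_cons col_mxEd.
rewrite product_measure1E//; apply: lte_mul_pinfty => //.
by rewrite ge0_fin_numE// leb_rV_ccube.
Qed.

End finite_cubes.

(** * Weak derivatives *)

Section local_space.
Context d (R : realType) (V : measNormedModType d R) (J : finType).
Variables (l : J -> V -> R) (mu : {measure set V -> \bar R}).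

(** [ls_finite] makes bounded functions supported in a cube integrable. [ls_dense] and [ls_ball]
    make open and compact sets measurable, and the dense sequence also reduces uncountably many
    slices to countably many. *)
Record lebesgue_space : Prop := {
  ls_coordinates : coordinates l;
  ls_finite : forall c, (mu (ccube l c) < +oo)%E;
  ls_dense : exists q : nat -> V, dense_seq q;
  ls_ball : forall (x : V) (e : R), d.-measurable (ball x e : set V) }.

Hypothesis ls : lebesgue_space.
Local Notation cube n := (ccube l n%:R).
Implicit Types (phi f g : V -> R) (n : nat).

Lemma ls_open (A : set V) : open A -> measurable A.
Proof. by move=> oA; have [q dq] := ls_dense ls; apply: (measurable_open dq (ls_ball ls)). Qed.

Lemma ls_compact (K : set V) : compact K -> measurable K.
Proof. by move=> cK; have [q dq] := ls_dense ls; apply: (measurable_compact dq (ls_ball ls)). Qed.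

Lemma ls_cube n : measurable (cube n).
Proof. exact: measurable_ccube (ls_coordinates ls) _. Qed.

Lemma bigcup_ccube : \bigcup_n cube n = setT.
Proof.
apply/seteqP; split => // v _; have [n Hn] := ex_cube l v.
by exists n => // j; exact: ltW.
Qed.

Lemma continuous_measurable phi : continuous phi -> measurable_fun setT phi.
Proof.
move=> cp; apply: (@measurability _ _ _ _ _ _ (@RGenOpens.G R)).
  exact: RGenOpens.measurableE.
move=> _ [_ [a [b ->]] <-]; rewrite setTI; apply: ls_open.
by apply: open_comp => // x _; exact: cp.
Qed.

Lemma test_measurable phi : test_function phi -> measurable_fun setT phi.
Proof. by move=> [/smooth_continuous cp _]; exact: continuous_measurable. Qed.

Lemma test_bounded phi : test_function phi -> exists M : R, forall x, `|phi x| <= M.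
Proof.
move=> [sp [K cK K0]]; have cp := smooth_continuous sp.
have : compact (phi @` K) by apply: continuous_compact => //; exact: continuous_subspaceT.
move=> /compact_bounded[M [_ HM]]; exists (Num.max 0 (M + 1)) => x.
have [Kx|nK] := pselect (K x); last by rewrite K0// normr0 le_max lexx.
rewrite le_max; apply/orP; right; apply: HM; first by rewrite ltrDl.
by exists x.
Qed.

Lemma test_support phi : test_function phi -> exists n, forall x, ~ cube n x -> phi x = 0.
Proof.
move=> [sp [K cK K0]]; have [n Kn] := bounded_in_ccube (ls_coordinates ls) cK.
by exists n => x nx; apply: K0 => /Kn.
Qed.

Lemma test_derive phi v : test_function phi -> test_function (fun x => 'D_v phi x).
Proof.
move=> [sp [K cK K0]]; split; first exact: smooth_derive.
exists K => // x nK.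
have oK : open (~` K) by rewrite openC; apply: compact_closed => //; exact: norm_hausdorff.
have n0 : \forall y \near x, phi y = cst (0 : R) y.
  have : nbhs x (~` K) by exact: open_nbhs_nbhs.
  by apply: filterS => y ny; rewrite K0.
by rewrite (near_eq_derive _ n0) derive_cst.
Qed.

Lemma integrable_bounded phi n (M : R) : measurable_fun setT phi ->
  (forall x, `|phi x| <= M) -> (forall x, ~ cube n x -> phi x = 0) ->
  mu.-integrable setT (EFin \o phi).
Proof.
move=> mp pM p0; have mc := ls_cube n.
have : mu.-integrable (cube n) (EFin \o phi).
  apply: measurable_bounded_integrable => //; first exact: ls_finite ls _.
    exact: measurable_funTS.
  exists M; split; first exact: num_real.
  by move=> y My x _; apply: le_trans (ltW My).
move=> /(integrable_mkcond _ mc); congr integrable; apply/funext => x.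
rewrite patchE; case: ifPn => //; rewrite notin_setE => nx.
by rewrite /= p0.
Qed.

Lemma sqint_bounded phi n (M : R) : measurable_fun setT phi ->
  (forall x, `|phi x| <= M) -> (forall x, ~ cube n x -> phi x = 0) -> sqint mu phi.
Proof.
move=> mp pM p0; apply/sqintP => //.
apply: (@integrable_bounded (fun x => phi x ^+ 2) n (M ^+ 2)).
- exact: measurable_funX.
- by move=> x; rewrite normrX lerXn2r ?nnegrE//; apply: le_trans (pM x).
- by move=> x nx; rewrite p0// expr0n.
Qed.

Lemma test_sqint phi : test_function phi -> sqint mu phi.
Proof.
move=> tp; have [M HM] := test_bounded tp; have [n Hn] := test_support tp.
exact: sqint_bounded (test_measurable tp) HM Hn.
Qed.

Lemma ae0_of_tests_loc f :
  (forall n, mu.-integrable (cube n) (EFin \o f)) ->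
  (forall phi, test_function phi -> \int[mu]_x (f x * phi x) = 0) ->
  {ae mu, forall x, f x = 0}.
Proof. exact: ae0_of_tests (ls_coordinates ls) _ _. Qed.

Lemma sqint_loc_integrable f n : sqint mu f -> mu.-integrable (cube n) (EFin \o f).
Proof.
move=> sf; have mc := ls_cube n.
have s1 : sqint mu (\1_(cube n) : V -> R).
  apply: (@sqint_bounded _ n 1) => //.
  - by move=> x; rewrite indicE; case: (_ \in _); rewrite ?normr1 ?normr0.
  - by move=> x nx; rewrite indicE memNset.
apply/(integrable_mkcond _ mc); have := sqintM_integrable s1 sf.
congr integrable; apply/funext => x; rewrite patchE indicE.
by case: ifP => _; rewrite /= ?mul1r ?mul0r.
Qed.

End local_space.

(** * Kernels locally square integrable in the first variable *)

Section local_L2.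
Context d (R : realType) (V : measNormedModType d R) (J : finType).
Variables (l : J -> V -> R) (mu : {sigma_finite_measure set V -> \bar R}).
Hypothesis ls : lebesgue_space l mu.
Local Notation cube n := (ccube l n%:R).

Section one_factor.
Context d' (Z : measurableType d').
Variable nu : {sigma_finite_measure set Z -> \bar R}.
Implicit Types (g w : V * Z -> R) (phi a : V -> R).

Definition cut (S : set V) g : V * Z -> R := fun p => \1_S p.1 * g p.

(** Square integrability over K x Z for compact K, tested on the exhausting cubes; it is global in
    the second variable. *)
Definition sqloc g := measurable_fun setT g /\
  forall n : nat, sqint (mu \x nu)%E (cut (cube n) g).

Lemma measurable_cut S g : measurable S -> measurable_fun setT g ->
  measurable_fun setT (cut S g).
Proof.
move=> mS mg; apply: measurable_funM => //.
by apply: measurableT_comp => //; exact: measurable_indic.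
Qed.

Lemma sqint_cut S g : measurable S -> sqint (mu \x nu)%E g -> sqint (mu \x nu)%E (cut S g).
Proof.
move=> mS sg; apply: (sqint_le _ sg).
  exact: measurable_cut (sqint_measurable sg).
move=> p; rewrite /cut normrM indicE ler_piMl//.
by case: (_ \in _); rewrite ?normr1 ?normr0.
Qed.

Lemma sqloc_cut S n g : sqloc g -> measurable S -> S `<=` cube n ->
  sqint (mu \x nu)%E (cut S g).
Proof.
move=> [mg sg] mS Sn; have := sqint_cut mS (sg n).
congr sqint; apply/funext => p; rewrite /cut mulrA; congr (_ * _).
rewrite !indicE; have [pS|] := boolP (p.1 \in S); last by rewrite mul0r.
by rewrite mul1r mem_set//; apply: Sn; exact: set_mem.
Qed.

Lemma sqint_sqloc g : sqint (mu \x nu)%E g -> sqloc g.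
Proof.
move=> sg; split; first exact: sqint_measurable sg.
by move=> n; apply: sqint_cut => //; exact: ls_cube ls n.
Qed.

(** Makes the results on square integrable kernels available for a locally square integrable one,
    cut to a cube that supports [phi]. *)
Lemma opT_cut (S : set V) g phi : (forall x, ~ S x -> phi x = 0) ->
  opT mu (cut S g) phi = opT mu g phi.
Proof.
move=> p0; apply/funext => z; apply: eq_Rintegral => x _.
rewrite /cut indicE /=; have [xS|] := boolP (x \in S); first by rewrite mul1r.
by rewrite notin_setE => /p0 ->; rewrite !mulr0.
Qed.

(* A weight makes [g] square integrable and remains invertible on compact sets. *)
Lemma ex_weight g : sqloc g -> exists theta : V -> R,
  [/\ measurable_fun setT theta, forall x, 0 < theta x,
      sqint (mu \x nu)%E (fun p => theta p.1 * g p) &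
      forall n : nat, exists2 c : R, 0 < c & forall x, cube n x -> c <= theta x].
Proof.
move=> [mg sg].
pose a n := rip (mu \x nu)%E (cut (cube n) g) (cut (cube n) g).
have a0 n : 0 <= a n by exact: rip_ge0.
(* The weight [theta] will be the sum of [b n] times the indicator of the n-th cube. This choice
   bounds both the sum of the [b n] and that of the [b n * a n] by 2. *)
pose b n : R := 2 ^- n / (1 + a n).
have b0 n : 0 < b n by rewrite divr_gt0 ?invr_gt0 ?exprn_gt0// ltr_pwDl.
have b2 n : b n <= 2 ^- n.
  rewrite ler_pdivrMr ?ltr_pwDl// ler_peMr ?invr_ge0 ?exprn_ge0//.
  by rewrite lerDl.
pose u x n : R := b n * \1_(cube n) x.
have u0 x n : 0 <= u x n by rewrite mulr_ge0// ltW.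
have ub x n : u x n <= 2 ^- n.
  apply: le_trans (b2 n); rewrite /u indicE.
  by case: (_ \in _); rewrite ?mulr1 ?mulr0// ltW.
have geo n : series (fun k => 2 ^- k : R) n <= 2.
  rewrite (_ : series _ n = 2 - 2 * 2 ^- n).
    by rewrite gerBl mulr_ge0// invr_ge0 exprn_ge0.
  elim: n => [|n IH]; first by rewrite /series/= big_geq// expr0 invr1; ring.
  rewrite seriesSr IH -exprVn exprS exprVn.
  by field; rewrite expf_neq0.
have und x : nondecreasing_seq (series (u x)).
  by apply/nondecreasing_seqP => n; rewrite seriesSr lerDl.
have u2 x n : series (u x) n <= 2.
  by apply: le_trans (geo n); apply: ler_sum => k _; exact: ub.
have uc x : cvgn (series (u x)).
  by apply: nondecreasing_is_cvgn => //; exists 2 => _ [n _ <-].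
pose theta x := limn (series (u x)).
have tb x n : cube n x -> b n <= theta x.
  move=> nx; apply: le_trans (nondecreasing_cvgn_le (und x) (uc x) n.+1).
  rewrite seriesSr /u indicE mem_set// mulr1 lerDr.
  by apply: sumr_ge0 => k _; exact: u0.
have t0 x : 0 < theta x.
  have : setT x by []; rewrite -(bigcup_ccube l) => -[n _ nx].
  exact: lt_le_trans (b0 n) (tb x n nx).
have t2 x : theta x <= 2 by apply: limr_le => //; exact: nearW.
have mt : measurable_fun setT theta.
  apply: (measurable_fun_limn (h := fun n x => series (u x) n)) => n.
  apply: measurable_sum => k; apply: measurable_funM => //.
  by apply: measurable_indic; exact: ls_cube ls k.
exists theta; split => //; last by move=> n; exists (b n) => // x; exact: tb.
have mtg : measurable_fun setT (fun p : V * Z => theta p.1 * g p).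
  by apply: measurable_funM => //; exact: measurableT_comp.
split => //.
(* As [theta] is at most 2, theta^2 g^2 is at most 2 theta g^2, the sum of the [w n]; their
   integrals are 2 b_n a_n and add up to at most 4. *)
pose w n (p : V * Z) := (2 * b n * cut (cube n) g p ^+ 2)%:E.
have mw n : measurable_fun setT (w n).
  apply/measurable_EFinP/measurable_funM => //; apply: measurable_funX.
  exact: sqint_measurable (sg n).
have w0 n p : (0 <= w n p)%E by rewrite lee_fin mulr_ge0 ?sqr_ge0// mulr_ge0// ltW.
apply: (@le_lt_trans _ _ (\int[(mu \x nu)%E]_p \sum_(0 <= n <oo) w n p)%E).
  apply: ge0_le_integral => //.
  - by move=> p _; rewrite lee_fin sqr_ge0.
  - by apply/measurable_EFinP; exact: measurable_funX.
  - exact: ge0_emeasurable_sum.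
  move=> p _; have -> : (\sum_(0 <= n <oo) w n p = (2 * g p ^+ 2 * theta p.1)%:E)%E.
    apply: eseries_EFin; rewrite (_ : series _ = (fun n => 2 * g p ^+ 2 * series (u p.1) n)).
      by apply: cvgM; [exact: cvg_cst|exact: uc].
    apply/funext => n; rewrite /series/= big_distrr/=; apply: eq_bigr => k _.
    rewrite /u /cut indicE; case: (_ \in _); rewrite ?mul1r ?mul0r ?mulr1 ?mulr0 ?expr0n/= ?mulr0//.
    by ring.
  rewrite lee_fin exprMn [leLHS](_ : _ = theta p.1 * (g p ^+ 2 * theta p.1)); last by ring.
  rewrite [leRHS](_ : _ = 2 * (g p ^+ 2 * theta p.1)); last by ring.
  by rewrite ler_wpM2r// mulr_ge0 ?sqr_ge0// ltW.
rewrite integral_nneseries//.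
apply: (@le_lt_trans _ _ (4 : R)%:E); last by rewrite ltry.
apply: lime_le; first by apply: is_cvg_nneseries => n _ _; exact: integral_ge0.
apply: nearW => n.
apply: (@le_trans _ _ (\sum_(0 <= k < n) (2 * 2 ^- k)%:E)%E).
  apply: lee_sum => k _; rewrite /w; under eq_integral do rewrite EFinM.
  have bk : 0 <= 2 * b k by rewrite mulr_ge0// ltW.
  rewrite ge0_integralZl ?lee_fin//; last 2 first.
    apply/measurable_EFinP; apply: measurable_funX; exact: sqint_measurable (sg k).
    by move=> p _; rewrite lee_fin sqr_ge0.
  rewrite -[X in (_ * X)%E](EFin_rip (sg k)) -EFinM lee_fin -mulrA ler_wpM2l//.
  rewrite /b mulrAC ler_pdivrMr ?ltr_pwDl// ler_wpM2l ?invr_ge0 ?exprn_ge0//.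
  by rewrite lerDr.
rewrite sumEFin lee_fin -big_distrr/= (_ : 4 = 2 * 2); last by ring.
by rewrite ler_wpM2l//; exact: geo n.
Qed.

End one_factor.
End local_L2.

Section opT_kernel.
Context d1 d2 d3 (X : measurableType d1) (Y : measurableType d2)
  (Z : measurableType d3) (R : realType).
Variables (mu : {sigma_finite_measure set X -> \bar R}).
Variables (rho : {sigma_finite_measure set Y -> \bar R}).
Variables (nu : {sigma_finite_measure set Z -> \bar R}).

(** By [rip_opT_kerp] both sides have the same pairing with every square integrable function;
    testing with their difference [D] shows that it vanishes. *)
Lemma opT_kerp (K : X * Z -> R) (Q : Y * Z -> R) a :
  sqint (mu \x nu)%E K -> sqint (rho \x nu)%E Q -> sqint mu a ->
  {ae rho, forall y, opT mu (kerp nu K Q) a y = opT' nu Q (opT mu K a) y}.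
Proof.
move=> sK sQ sa; have skq := sqint_kerp sK sQ.
have s1 := (sqint_opT skq sa).1.
have sKa := (sqint_opT sK sa).1; have s2 := sqint_opT' sQ sKa.
have sD := sqintB s1 s2.
suff : rip rho (opT mu (kerp nu K Q) a - opT' nu Q (opT mu K a))
               (opT mu (kerp nu K Q) a - opT' nu Q (opT mu K a)) = 0.
  by move/(rip_eq0 sD); apply: filterS => y /eqP; rewrite subr_eq0 => /eqP.
move: sD; set D := _ - _ => sD.
rewrite {1}/D (ripBl s1 s2 sD) -(rip_tens_opT skq sa sD) -(rip_tens_opT' sQ sD sKa).
rewrite (rip_tens_opT sQ sD sKa) (ripC _ (opT rho Q D)).
by rewrite (rip_opT_kerp sK sQ sa sD) subrr.
Qed.

End opT_kernel.

Lemma measurable_inv_gt0 d (T : measurableType d) (R : realType) (f : T -> R) :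
  measurable_fun setT f -> (forall x, 0 < f x) -> measurable_fun setT (fun x => (f x)^-1).
Proof.
move=> mf f0; apply: (@measurability _ _ _ _ _ _ (@RGenOInfty.G R)).
  exact: RGenOInfty.measurableE.
move=> _ [_ [a ->] <-]; rewrite setTI; have [a0|a0] := leP a 0.
  rewrite (_ : _ @^-1` _ = setT)//; apply/seteqP; split => // x _ /=.
  by rewrite in_itv/= andbT (le_lt_trans a0)// invr_gt0.
have := mf measurableT `]-oo, a^-1[%classic (measurable_itv _); rewrite setTI.
congr measurable; apply/seteqP; split => x /=; rewrite !in_itv/= andbT => xa.
  by rewrite -[a]invrK ltf_pV2 ?posrE ?invr_gt0.
by rewrite -[f x]invrK ltf_pV2 ?posrE ?invr_gt0.
Qed.

(** * Slicewise weak derivatives of kernels *)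

Section weak_kernels.
Context d (R : realType) (V : measNormedModType d R) (J : finType).
Variables (l : J -> V -> R) (mu : {sigma_finite_measure set V -> \bar R}).
Hypothesis ls : lebesgue_space l mu.
Variable v : V.
Local Notation cube n := (ccube l n%:R).

(* Slicewise weak derivative. [Z] is an arbitrary measure space; when it is a
   Euclidean space, [rweak_wder] and [wder_rweak] relate this notion to weak
   derivatives on the product. *)
Definition rweak d' (Z : measurableType d') (nu : {measure set Z -> \bar R})
    (G g : V * Z -> R) := forall phi : V -> R, test_function phi ->
  {ae nu, forall z, opT mu G (fun x => 'D_v phi x) z = - opT mu g phi z}.

Lemma kerp_cut d' d'' (Y : measurableType d'') (Z : measurableType d')
    (nu : {sigma_finite_measure set Z -> \bar R}) (S : set V)
    (g : V * Z -> R) (Q : Y * Z -> R) :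
  kerp nu (cut S g) Q = cut S (kerp nu g Q).
Proof.
apply/funext => -[x y]; rewrite /kerp /cut /= indicE.
case: (x \in S); rewrite ?mul1r ?mul0r.
  by apply: eq_Rintegral => z _; rewrite mul1r.
by under eq_Rintegral do rewrite !mul0r; rewrite /Rintegral integral0.
Qed.

Lemma sqloc_kerp d' (Z : measurableType d') (nu : {sigma_finite_measure set Z -> \bar R})
    (g Q : V * Z -> R) :
  sqloc l mu nu g -> sqint (mu \x nu)%E Q -> sqloc l mu mu (kerp nu g Q).
Proof.
move=> [mg sg] sQ; split; first exact: measurable_kerp _ mg (sqint_measurable sQ).
by move=> n; rewrite -kerp_cut; exact: sqint_kerp (sg n) sQ.
Qed.

(** The identity between [G] and [g], valid for almost every [z], survives integration against the
    slices of [Q]. Cutting [g] to a cube that supports [phi] makes [opT_kerp] applicable. *)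
Lemma rweak_kerp d' (Z : measurableType d') (nu : {sigma_finite_measure set Z -> \bar R})
    (G g Q : V * Z -> R) :
  sqint (mu \x nu)%E G -> sqloc l mu nu g -> rweak nu G g -> sqint (mu \x nu)%E Q ->
  rweak mu (kerp nu G Q) (kerp nu g Q).
Proof.
move=> sG sg Gg sQ phi tp.
have [n pn] := test_support ls tp.
have sgn := sg.2 n; have sphi := test_sqint ls tp.
have sdphi := test_sqint ls (test_derive v tp).
have h1 := opT_kerp sG sQ sdphi; have h2 := opT_kerp sgn sQ sphi.
have sTg := (sqint_opT sgn sphi).1.
have h3 : {ae nu, forall z, opT mu G (fun x => 'D_v phi x) z = (- opT mu (cut (cube n) g) phi) z}.
  by apply: filterS (Gg phi tp) => z ->; rewrite (opT_cut mu _ pn).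
have h4 : {ae mu, forall y, opT' nu Q (opT mu G (fun x => 'D_v phi x)) y =
    - opT' nu Q (opT mu (cut (cube n) g) phi) y}.
  apply: filterS (sqint_secy sQ) => y sy; rewrite /opT'.
  rewrite -[RHS]mulN1r -RintegralZl//; last exact: (sqintM_integrable sy sTg).
  apply: ae_eq_Rintegral.
  - exact: measurable_funM (sqint_measurable sy) (sqint_measurable (sqint_opT sG sdphi).1).
  - apply: measurable_funM => //.
    exact: measurable_funM (sqint_measurable sy) (sqint_measurable sTg).
  - by apply: filterS h3 => z ->; rewrite fctE; ring.
apply: filterS3 h1 h2 h4 => y -> e2 ->.
by rewrite -e2 kerp_cut (opT_cut mu _ pn).
Qed.

(** The transfer is applied to theta g, which is square integrable. The weight is compensated in the
    test functions, [psi] being phi / theta, and is finally divided out of the transferred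
    kernel. *)
Lemma exists_rweak d1 d2 (U : measurableType d1) (Y : measurableType d2)
    (ups : {sigma_finite_measure set U -> \bar R})
    (rho : {sigma_finite_measure set Y -> \bar R})
    (h : nat -> V -> R) (G g : V * U -> R) (F : V * Y -> R) :
  frame mu h ->
  sqint (mu \x ups)%E G -> sqloc l mu ups g -> rweak ups G g ->
  sqint (mu \x rho)%E F ->
  {ae (mu \x mu)%E, forall p, kerp ups G G p = kerp rho F F p} ->
  exists2 dF, sqloc l mu rho dF & rweak rho F dF.
Proof.
move=> hF sG sg Gg sF GF.
have [theta [mt t0 sf tc]] := ex_weight ls sg.
have tn0 x : theta x != 0 by rewrite gt_eqF.
have mti := measurable_inv_gt0 mt t0.
pose I := {phi : V -> R | test_function phi}.
pose psi (i : I) x := sval i x / theta x.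
pose dphi (i : I) x := 'D_v (sval i) x.
have spsi i : sqint mu (psi i).
  case: i => phi tp; have [n pn] := test_support ls tp.
  have [M HM] := test_bounded tp; have [c c0 Hc] := tc n.
  apply: (sqint_bounded ls (n := n) (M := M * c^-1)) => //=.
  - exact: measurable_funM (test_measurable ls tp) mti.
  - move=> x; rewrite /psi /= normrM normfV (gtr0_norm (t0 x)).
    have [nx|nx] := pselect (cube n x).
      apply: ler_pM => //; first by rewrite invr_ge0 ltW.
      by rewrite lef_pV2 ?posrE// Hc.
    rewrite pn// normr0 mul0r mulr_ge0 ?invr_ge0 ?(ltW c0)//.
    exact: le_trans (HM x).
  - by move=> x nx; rewrite /psi /= pn// mul0r.
have sdphi i : sqint mu (dphi i) by exact: (test_sqint ls (test_derive v (svalP i))).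
have [||g' sg' Hg'] := transfer_weak_derivative hF sG sF GF spsi sdphi sf.
- case=> phi tp; apply: filterS (Gg phi tp) => u; rewrite /dphi /= => ->.
  rewrite opprK; apply: eq_Rintegral => x _; rewrite /psi /=.
  by have := tn0 x; move: (theta x) (g (x, u)) (phi x) => t a b ?; field.
(* Totality of [psi]: [theta] is bounded below on cubes, so g0 / theta is locally integrable, and it
   annihilates all test functions. *)
- move=> g0 sg0 g0psi.
  have : {ae mu, forall x, g0 x / theta x = 0}.
    apply: (ae0_of_tests_loc ls).
      move=> n; have [c c0 Hc] := tc n.
      apply: (@le_integrable _ _ _ _ _ _ _ (fun x => (c^-1%:E * (g0 x)%:E)%E)).
      - exact: ls_cube ls n.
      - apply/measurable_EFinP/measurable_funTS/measurable_funM => //.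
        exact: sqint_measurable sg0.
      - move=> x nx; rewrite -EFinM !abse_EFin lee_fin !normrM mulrC normfV.
        rewrite (gtr0_norm (t0 x)) (gtr0_norm (x := c^-1)) ?invr_gt0// ler_wpM2r//.
        by rewrite lef_pV2 ?posrE// Hc.
      - by apply: integrableZl; [exact: ls_cube ls n|apply: (sqint_loc_integrable ls n sg0)].
    move=> phi tp; rewrite -(g0psi (exist _ phi tp)); apply: eq_Rintegral => x _.
    by rewrite /psi /=; ring.
  by apply: filterS => x /eqP; rewrite mulf_eq0 invr_eq0 (negPf (tn0 x)) orbF => /eqP.
have mg' := sqint_measurable sg'.
exists (fun p => g' p / theta p.1).
  split.
    by apply: measurable_funM => //; exact: measurableT_comp mti measurable_fst.
  move=> n; have [c c0 Hc] := tc n.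
  apply: (sqint_le _ (sqintZ c^-1 sg')).
    apply: measurable_cut; first exact: ls_cube ls n.
    by apply: measurable_funM => //; exact: measurableT_comp mti measurable_fst.
  move=> p; rewrite /cut indicE; have [pS|] := boolP (p.1 \in _); last first.
    by rewrite mul0r normr0.
  rewrite mul1r !normrM mulrC normfV (gtr0_norm (t0 p.1)) (gtr0_norm (x := c^-1)) ?invr_gt0//.
  by rewrite ler_wpM2r// lef_pV2 ?posrE// Hc//; exact: set_mem.
move=> phi tp; have := Hg' (exist _ phi tp); apply: filterS => y e.
apply: oppr_inj; rewrite opprK -[LHS]e; apply: eq_Rintegral => x _.
by rewrite /psi /=; ring.
Qed.

(* The integral of the diagonal over a bounded set [S] is the trace of the product
   of the operators obtained by cutting the first variable down to [S]. *)
Lemma diag_unique d1 d2 (U : measurableType d1) (Y : measurableType d2)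
    (ups : {sigma_finite_measure set U -> \bar R})
    (rho : {sigma_finite_measure set Y -> \bar R})
    (h : nat -> V -> R) (g Q : V * U -> R) (g' Q' : V * Y -> R) :
  frame mu h ->
  sqloc l mu ups g -> sqloc l mu ups Q -> sqloc l mu rho g' -> sqloc l mu rho Q' ->
  {ae (mu \x mu)%E, forall p, kerp ups g Q p = kerp rho g' Q' p} ->
  {ae mu, forall x, \int[ups]_u (g (x, u) * Q (x, u)) = \int[rho]_y (g' (x, y) * Q' (x, y))}.
Proof.
move=> hF sg sQ sg' sQ' gQ.
have mf : measurable_fun setT (fun x => \int[ups]_u (g (x, u) * Q (x, u))).
  exact: (measurable_inty ups (measurable_funM sg.1 sQ.1)).
have mf' : measurable_fun setT (fun x => \int[rho]_y (g' (x, y) * Q' (x, y))).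
  exact: (measurable_inty rho (measurable_funM sg'.1 sQ'.1)).
(* Only one factor is cut to [S]. Because [S] lies in the cube, cutting the other one to the cube
   does not change the integral over the diagonal, while both kernels become square integrable. *)
have cutE d' (Z : measurableType d') (nu : {sigma_finite_measure set Z -> \bar R}) n S
    (a b : V * Z -> R) : measurable S -> S `<=` cube n -> sqloc l mu nu a -> sqloc l mu nu b ->
    mu.-integrable setT (fun x => (\1_S x * \int[nu]_z (a (x, z) * b (x, z)))%:E) /\
    rip (mu \x nu)%E (cut S a) (cut (cube n) b) =
    \int[mu]_x (\1_S x * \int[nu]_z (a (x, z) * b (x, z))).
  move=> mS Sn sa sb; have si := sqintM_integrable (sqloc_cut sa mS Sn) (sb.2 n).
  have e x : \int[nu]_z (cut S a (x, z) * cut (cube n) b (x, z)) =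
      \1_S x * \int[nu]_z (a (x, z) * b (x, z)).
    rewrite /cut /= !indicE; have [xS|] := boolP (x \in S).
      rewrite mem_set ?mul1r; last by apply: Sn; exact: set_mem.
      by apply: eq_Rintegral => z _; rewrite !mul1r.
    by rewrite mul0r; under eq_Rintegral do rewrite !mul0r; rewrite /Rintegral integral0.
  split; last first.
    by rewrite /rip (Rfubini_inty si); apply: eq_Rintegral => x _; rewrite e.
  by have := integrable_inty si; congr integrable; apply/funext => x /=; rewrite e.
have Seq n S : measurable S -> S `<=` cube n ->
    \int[mu]_x (\1_S x * \int[ups]_u (g (x, u) * Q (x, u))) =
    \int[mu]_x (\1_S x * \int[rho]_y (g' (x, y) * Q' (x, y))).
  move=> mS Sn; rewrite -(cutE _ _ ups n S g Q mS Sn sg sQ).2.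
  rewrite -(cutE _ _ rho n S g' Q' mS Sn sg' sQ').2.
  apply: (rip_of_kerp hF (sqloc_cut sg mS Sn) (sQ.2 n) (sqloc_cut sg' mS Sn) (sQ'.2 n)).
  have kc d' (Z : measurableType d') (nu : {sigma_finite_measure set Z -> \bar R})
    (a b : V * Z -> R) x y : kerp nu (cut S a) (cut (cube n) b) (x, y) =
    \1_S x * \1_(cube n) y * kerp nu a b (x, y).
    rewrite kerp_cut /cut /= -mulrA; congr (_ * _).
    rewrite /kerp /cut /= indicE; case: (y \in _).
      by rewrite mul1r; apply: eq_Rintegral => z _; rewrite mul1r.
    rewrite mul0r; under eq_Rintegral do rewrite mul0r mulr0.
    by rewrite /Rintegral integral0.
  by apply: filterS gQ => -[x y]; rewrite !kc => ->.
have en n : {ae mu, forall x, cube n x ->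
    (\int[ups]_u (g (x, u) * Q (x, u)))%R%:E = (\int[rho]_y (g' (x, y) * Q' (x, y)))%R%:E}.
  have mc := ls_cube ls n.
  have restr S f : measurable S ->
      \int[mu]_(x in S) f x = \int[mu]_x (\1_S x * f x).
    move=> mS; rewrite Rintegral_mkcond; apply: eq_Rintegral => x _.
    by rewrite patchE indicE; case: ifP => _; rewrite ?mul1r ?mul0r.
  have irestr d' (Z : measurableType d') (nu : {sigma_finite_measure set Z -> \bar R})
    (a b : V * Z -> R) : sqloc l mu nu a -> sqloc l mu nu b ->
    mu.-integrable (cube n) (fun x => (\int[nu]_z (a (x, z) * b (x, z)))%R%:E).
    move=> sa sb; apply/(integrable_mkcond _ mc).
    have := (cutE _ _ nu n _ a b mc (@subset_refl _ _) sa sb).1.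
    congr integrable; apply/funext => x; rewrite patchE indicE.
    by case: ifP => _; rewrite ?mul1r ?mul0r.
  have i1 := irestr _ _ _ _ _ sg sQ; have i2 := irestr _ _ _ _ _ sg' sQ'.
  apply: (integral_ae_eq mc i1) => [|E Ec mE].
    exact/measurable_EFinP/measurable_funTS.
  have j1 := integrableS mc mE Ec i1; have j2 := integrableS mc mE Ec i2.
  rewrite -[LHS]fineK; last exact: integrable_fin_num.
  rewrite -[RHS]fineK; last exact: integrable_fin_num.
  congr EFin; move: (Seq n E mE Ec); rewrite -(restr _ _ mE) -(restr _ _ mE); exact.
have := ae_foralln en; apply: filterS => x H.
have : setT x by []; rewrite -(bigcup_ccube l) => -[n _ nx].
by case: (H n nx).
Qed.

End weak_kernels.

(** * Weak derivatives on a space and on products *)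

Section real_weak_derivative.
Context d (R : realType) (V : measNormedModType d R) (J : finType).
Variables (l : J -> V -> R) (mu : {measure set V -> \bar R}).
Local Notation cube n := (ccube l n%:R).

Definition locint (f : V -> R) := measurable_fun setT f /\
  forall n : nat, mu.-integrable (cube n) (EFin \o f).

Definition wder (v : V) (f g : V -> R) := forall phi : V -> R, test_function phi ->
  \int[mu]_x (f x * 'D_v phi x) = - \int[mu]_x (g x * phi x).

Hypothesis ls : lebesgue_space l mu.
Implicit Types (f g b phi : V -> R).

Lemma locint_bounded f b n (M : R) : locint f -> measurable_fun setT b ->
  (forall x, `|b x| <= M) -> (forall x, ~ cube n x -> b x = 0) ->
  mu.-integrable setT (EFin \o (fun x => f x * b x)).
Proof.
move=> [mf fi] mb bM b0; have mc := ls_cube ls n.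
have /(integrable_mkcond _ mc) h : mu.-integrable (cube n) (fun x => (M%:E * (f x)%:E)%E).
  exact: integrableZl.
apply: (le_integrable measurableT _ _ h).
  exact/measurable_EFinP/measurable_funM.
move=> x _; rewrite patchE /=; case: ifPn => [_|]; last first.
  by rewrite notin_setE => /b0 ->; rewrite mulr0.
rewrite lee_fin !normrM mulrC ler_wpM2r//.
by apply: le_trans (bM x) _; rewrite ler_norm.
Qed.

Lemma locint_test f phi : locint f -> test_function phi ->
  mu.-integrable setT (EFin \o (fun x => f x * phi x)).
Proof.
move=> lf tp; have [n pn] := test_support ls tp; have [M HM] := test_bounded tp.
exact: locint_bounded lf (test_measurable ls tp) HM pn.
Qed.

Lemma locintB f g : locint f -> locint g -> locint (f - g).
Proof.
move=> [mf fi] [mg gi]; split; first exact: measurable_funB.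
by move=> n; have := integrableB (ls_cube ls n) (fi n) (gi n); congr integrable.
Qed.

Lemma wder_unique v f g g' : locint g -> locint g' -> wder v f g -> wder v f g' ->
  {ae mu, forall x, g x = g' x}.
Proof.
move=> lg lg' fg fg'; have lD := locintB lg lg'.
suff : {ae mu, forall x, (g - g') x = 0}.
  by apply: filterS => x /eqP; rewrite subr_eq0 => /eqP.
apply: (ae0_of_tests_loc ls lD.2) => phi tp.
under eq_Rintegral do rewrite mulrBl.
rewrite RintegralB//; [|exact: locint_test lg tp|exact: locint_test lg' tp].
by rewrite -[X in X - _]opprK -(fg _ tp) -[X in - _ - X]opprK -(fg' _ tp) opprK addNr.
Qed.

Lemma wder_ae v f f' g g' : measurable_fun setT f -> measurable_fun setT f' ->
  measurable_fun setT g -> measurable_fun setT g' ->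
  {ae mu, forall x, f x = f' x} -> {ae mu, forall x, g x = g' x} ->
  wder v f g -> wder v f' g'.
Proof.
move=> mf mf' mg mg' ff gg fg phi tp; have := fg phi tp.
have mp := test_measurable ls tp; have mdp := test_measurable ls (test_derive v tp).
rewrite (ae_eq_Rintegral (g := fun x => f' x * 'D_v phi x)); first last.
- by apply: filterS ff => x ->.
- exact: measurable_funM.
- exact: measurable_funM.
rewrite (ae_eq_Rintegral (f := fun x => g x * phi x) (g := fun x => g' x * phi x))//.
- exact: measurable_funM.
- exact: measurable_funM.
- by apply: filterS gg => x ->.
Qed.

Lemma locint_ae f g : measurable_fun setT g -> {ae mu, forall x, f x = g x} ->
  locint f -> locint g.
Proof.
move=> mg fg [mf fi]; split => // n; have mc := ls_cube ls n.
have /(integrable_mkcond _ mc) h := fi n; apply/(integrable_mkcond _ mc).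
have pE (b : V -> R) : (EFin \o b) \_ (cube n) = EFin \o (b \_ (cube n)).
  by apply/funext => x; rewrite /= !patchE; case: ifP.
rewrite pE in h; rewrite pE.
apply: (ae_integrable (mu := mu) _ _ h).
  by apply/(measurable_restrictT _ mc)/measurable_funTS.
by apply: filterS fg => x fx; rewrite !patchE fx.
Qed.

End real_weak_derivative.

Section pairs.
Context d1 d2 (R : realType) (V : measNormedModType d1 R) (W : measNormedModType d2 R).
Variables (J1 J2 : finType) (l1 : J1 -> V -> R) (l2 : J2 -> W -> R).
Variables (mu : {sigma_finite_measure set V -> \bar R}).
Variables (nu : {sigma_finite_measure set W -> \bar R}).
Hypotheses (ls1 : lebesgue_space l1 mu) (ls2 : lebesgue_space l2 nu).
Local Notation l := (pair_coord l1 l2).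

Lemma lebesgue_space_pair : lebesgue_space l (mu \x nu)%E.
Proof.
have [c1 f1 d1' b1] := ls1; have [c2 f2 d2' b2] := ls2; split.
- exact: pair_coordinates.
- move=> c; rewrite ccube_pair.
  have m1 := measurable_ccube c1 c; have m2 := measurable_ccube c2 c.
  apply: (@le_lt_trans _ _ (mu (ccube l1 c) * nu (ccube l2 c))%E).
    by rewrite -(product_measure1E mu nu m1 m2).
  apply: lte_mul_pinfty; [exact: measure_ge0| |exact: f2].
  by rewrite ge0_fin_numE//; exact: f1.
- exact: pair_dense.
- exact: measurable_pair_ball.
Qed.

Lemma test_secx (Phi : V * W -> R) q : test_function Phi ->
  test_function (fun x => Phi (x, q)) /\
  forall v x, 'D_v (fun x => Phi (x, q)) x = 'D_(v, 0) Phi (x, q).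
Proof.
move=> [sP [K cK K0]].
have cA : continuous (fun x : V => (x, q) : V * W).
  by move=> x; apply: cvg_pair => /=; [exact: cvg_id|exact: cvg_cst].
have AE (h : R) (v x : V) : (h *: v + x, q) = h *: ((v, 0) : V * W) + (x, q).
  by congr pair; rewrite /= scaler0 add0r.
split; last first.
  move=> v x; rewrite -[LHS]/(iter_derive (Phi \o (fun x => (x, q))) [:: v] x).
  by rewrite (iter_derive_comp_affine AE).
split; first exact: (smooth_comp_affine cA AE sP).
exists (fst @` K).
  by apply: continuous_compact => //; apply: continuous_subspaceT => x; exact: cvg_fst.
by move=> x nx; apply: K0 => Kx; apply: nx; exists (x, q).
Qed.

Lemma test_tens (phi : V -> R) (b : W -> R) : test_function phi -> test_function b ->
  test_function (fun p : V * W => phi p.1 * b p.2) /\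
  (forall v p, 'D_(v, 0) (fun p : V * W => phi p.1 * b p.2) p = 'D_v phi p.1 * b p.2) /\
  (forall v p, 'D_(0, v) (fun p : V * W => phi p.1 * b p.2) p = phi p.1 * 'D_v b p.2).
Proof.
move=> [sp [K cK K0]] [sb [L cL L0]].
have c1 : continuous (fun x : V * W => x.1) by move=> x; exact: cvg_fst.
have c2 : continuous (fun x : V * W => x.2) by move=> x; exact: cvg_snd.
have E1 (h : R) (v x : V * W) : (h *: v + x).1 = h *: v.1 + x.1 by [].
have E2 (h : R) (v x : V * W) : (h *: v + x).2 = h *: v.2 + x.2 by [].
have s1 := smooth_comp_affine c1 E1 sp; have s2 := smooth_comp_affine c2 E2 sb.
have d1' (v p : V * W) : 'D_v (phi \o fst) p = 'D_(v.1) phi p.1.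
  by rewrite -[LHS]/(iter_derive (phi \o fst) [:: v] p) (iter_derive_comp_affine E1).
have d2' (v p : V * W) : 'D_v (b \o snd) p = 'D_(v.2) b p.2.
  by rewrite -[LHS]/(iter_derive (b \o snd) [:: v] p) (iter_derive_comp_affine E2).
have dM (v p : V * W) : 'D_v (fun p : V * W => phi p.1 * b p.2) p =
    phi p.1 * 'D_(v.2) b p.2 + 'D_(v.1) phi p.1 * b p.2.
  rewrite -[LHS]/('D_v ((phi \o fst) * (b \o snd)) p) deriveM.
  - by rewrite d1' d2' /= [X in _ + X = _]mulrC.
  - exact: (smooth_derivable s1).
  - exact: (smooth_derivable s2).
split; last first.
  split => v p; rewrite dM /=.
    by rewrite derive0 mulr0 add0r.
  by rewrite derive0 mul0r addr0.
split; first exact: (smoothM s1 s2).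
exists (K `*` L); first exact: compact_setX.
move=> p np; have [Kp|/K0 ->] := pselect (K p.1); last by rewrite mul0r.
by rewrite L0 ?mulr0// => Lp; apply: np.
Qed.

End pairs.

Lemma ccube_le d (R : realType) (V : measNormedModType d R) (J : finType) (l : J -> V -> R)
  (m n : nat) : (m <= n)%N -> ccube l m%:R `<=` ccube l n%:R.
Proof. by move=> mn v vm j; apply: le_trans (vm j) _; rewrite ler_nat. Qed.

Lemma measurable_int_real d (T : measurableType d) (R : realType)
  (mu : {measure set T -> \bar R}) (f : T -> R) :
  mu.-integrable setT (EFin \o f) -> measurable_fun setT f.
Proof. by move/measurable_int/measurable_EFinP. Qed.

Section slices.
Context d1 d2 (R : realType) (V : measNormedModType d1 R) (W : measNormedModType d2 R).
Variables (J1 J2 : finType) (l1 : J1 -> V -> R) (l2 : J2 -> W -> R).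
Variables (mu : {sigma_finite_measure set V -> \bar R}).
Variables (nu : {sigma_finite_measure set W -> \bar R}).
Hypotheses (ls1 : lebesgue_space l1 mu) (ls2 : lebesgue_space l2 nu).
Local Notation l := (pair_coord l1 l2).
Let lsP := lebesgue_space_pair ls1 ls2.

Lemma locint_tens (F : V * W -> R) (a : V -> R) (b : W -> R) (n1 n2 : nat) (M1 M2 : R) :
  locint l (mu \x nu)%E F -> measurable_fun setT a -> measurable_fun setT b ->
  (forall x, `|a x| <= M1) -> (forall w, `|b w| <= M2) ->
  (forall x, ~ ccube l1 n1%:R x -> a x = 0) -> (forall w, ~ ccube l2 n2%:R w -> b w = 0) ->
  (mu \x nu)%E.-integrable setT (EFin \o (fun p : V * W => F p * (a p.1 * b p.2))).
Proof.
move=> lF ma mb aM bM a0 b0.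
apply: (locint_bounded (n := maxn n1 n2) (M := M1 * M2) lsP lF).
- by apply: measurable_funM; [exact: measurableT_comp ma measurable_fst|
    exact: measurableT_comp mb measurable_snd].
- by move=> p; rewrite normrM ler_pM.
- move=> p; rewrite ccube_pair => np.
  have [c1|/a0 ->] := pselect (ccube l1 n1%:R p.1); last by rewrite mul0r.
  have [c2|/b0 ->] := pselect (ccube l2 n2%:R p.2); last by rewrite mulr0.
  exfalso; apply: np; split.
    by apply: ccube_le c1; rewrite leq_maxl.
  by apply: ccube_le c2; rewrite leq_maxr.
Qed.

Lemma locint_cube (F : V * W -> R) (n : nat) : locint l (mu \x nu)%E F ->
  (mu \x nu)%E.-integrable setT
    (EFin \o (fun p : V * W => F p * (\1_(ccube l1 n%:R) p.1 * \1_(ccube l2 n%:R) p.2))).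
Proof.
move=> lF; apply: (locint_tens (n1 := n) (n2 := n) (M1 := 1) (M2 := 1) lF).
- by apply: measurable_indic; exact: (ls_cube ls1).
- by apply: measurable_indic; exact: (ls_cube ls2).
- by move=> x; rewrite indicE normr_nat; case: (_ \in _).
- by move=> x; rewrite indicE normr_nat; case: (_ \in _).
- by move=> x nx; rewrite indicE memNset.
- by move=> x nx; rewrite indicE memNset.
Qed.

(** Fubini on each cube; the countably many exceptional sets are united. *)
Lemma ae_locint_secx (F : V * W -> R) : locint l (mu \x nu)%E F ->
  {ae nu, forall w, locint l1 mu (fun x => F (x, w))}.
Proof.
move=> lF; have H n := ae_integrable_secx (locint_cube n lF).
have := ae_foralln H; apply: filterS => w Hw; split; first exact: measurable_secx lF.1.
move=> n; have : setT w by []; rewrite -(bigcup_ccube l2) => -[k _ kw].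
have mc := ls_cube ls1 (maxn n k).
apply: (integrableS mc (ls_cube ls1 n)); first by apply: ccube_le; rewrite leq_maxl.
apply/(integrable_mkcond _ mc); have := Hw (maxn n k); congr integrable.
apply/funext => x; rewrite patchE !indicE /= (mem_set (_ : ccube l2 _ w)); last first.
  by apply: ccube_le kw; rewrite leq_maxr.
by case: (_ \in _); rewrite ?mulr1 ?mul0r ?mulr0.
Qed.

(** [Psi] is continuous, and dominated convergence applies with a multiple of |f| on a cube
    containing the support. *)
Lemma cvg_integral_test (f : V -> R) (Psi : V * W -> R) (q : nat -> W) (w : W) :
  locint l1 mu f -> test_function Psi -> q k @[k --> \oo] --> w ->
  \int[mu]_x (f x * Psi (x, q k)) @[k --> \oo] --> \int[mu]_x (f x * Psi (x, w)).
Proof.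
move=> lf tP qw; have [M HM] := test_bounded tP; have [n Hn] := test_support lsP tP.
have mP y : measurable_fun setT (fun x => Psi (x, y)).
  exact: measurable_secx (test_measurable lsP tP).
have mc := ls_cube ls1 n.
have ib y : mu.-integrable setT (EFin \o (fun x => f x * Psi (x, y))).
  by have [t _] := test_secx y tP; exact: (locint_test ls1 lf t).
have ig := locint_bounded (n := n) (b := fun x => M * \1_(ccube l1 n%:R) x) (M := `|M|) ls1 lf.
have {}ig : mu.-integrable setT (EFin \o (fun x => `|f x * (M * \1_(ccube l1 n%:R) x)|)).
  have := integrable_abse (ig _ _ _) => /(_ _ _ _)/wrap[].
  - apply: measurable_funM => //; exact: measurable_indic.
  - by move=> x; rewrite indicE; case: (_ \in _); rewrite ?mulr1 ?mulr0 ?normr0.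
  - by move=> x nx; rewrite indicE memNset// mulr0.
  by congr integrable.
have mf k : measurable_fun setT (EFin \o (fun x => f x * Psi (x, q k))).
  by have := measurable_int _ (ib (q k)).
have mw : measurable_fun setT (EFin \o (fun x => f x * Psi (x, w))).
  by have := measurable_int _ (ib w).
have [||_ _ H] := dominated_convergence measurableT mf mw _ ig.
- apply: nearW => x _; apply: cvg_EFin; first exact: nearW.
  apply: cvgM; first exact: cvg_cst.
  have cP : continuous Psi := smooth_continuous tP.1.
  by apply: (cvg_comp (fun k => (x, q k)) Psi _ (cP (x, w))); apply: cvg_pair => //=; exact: cvg_cst.
- apply: nearW => x k _; rewrite lee_fin !normrM indicE ler_wpM2l//.
  have [xS|] := boolP (x \in _).
    by rewrite normr1 mulr1; apply: le_trans (HM _) _; exact: ler_norm.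
  rewrite notin_setE => nx; rewrite Hn ?normr0 ?mulr0//.
  by rewrite ccube_pair => -[].
apply: fine_cvg; rewrite fineK; first exact: H.
exact: (integrable_fin_num _ (ib w)).
Qed.

(** The exceptional null set in [rweak] depends on the test function, while the slice of [Phi]
    changes with [w]. For almost every [w] the identity holds simultaneously for the slices of [Phi]
    at all points of a dense sequence; letting these points tend to [w] gives it for the slice at
    [w] itself. *)
Lemma rweak_wder v (F g : V * W -> R) : locint l (mu \x nu)%E F ->
  locint l (mu \x nu)%E g -> rweak mu v nu F g -> wder (mu \x nu)%E (v, 0) F g.
Proof.
move=> lF lg Fg Phi tP; have tdP := test_derive (v, 0 : W) tP.
have [q dq] := ls_dense ls2.
have H j := Fg _ (test_secx (q j) tP).1.
rewrite (Rfubini_intx (locint_test lsP lF tdP)).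
have ig := locint_test lsP lg tP; rewrite (Rfubini_intx ig).
rewrite -[RHS]mulN1r -RintegralZl//; last exact: integrable_intx ig.
apply: ae_eq_Rintegral.
- exact: (measurable_intx mu (measurable_funM lF.1 (test_measurable lsP tdP))).
- apply: measurable_funM => //.
  exact: (measurable_intx mu (measurable_funM lg.1 (test_measurable lsP tP))).
apply: filterS3 (ae_foralln H) (ae_locint_secx lF) (ae_locint_secx lg) => w Hw lFw lgw.
have [k qk] := dense_seq_cvg dq w.
have c1 := cvg_integral_test lFw tdP qk.
have c2 := cvg_integral_test lgw tP qk.
rewrite mulN1r; apply: (cvg_unique _ c1) => //.
rewrite (_ : (fun j => _) = (fun j => - \int[mu]_x (g (x, w) * Phi (x, q (k j))))).
  exact: cvgN.
apply/funext => j; have := Hw (k j); rewrite /opT => <-.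
by apply: eq_Rintegral => x _; rewrite (test_secx (q (k j)) tP).2.
Qed.

End slices.

Section slices.
Context d1 d2 (R : realType) (V : measNormedModType d1 R) (W : measNormedModType d2 R).
Variables (J1 J2 : finType) (l1 : J1 -> V -> R) (l2 : J2 -> W -> R).
Variables (mu : {sigma_finite_measure set V -> \bar R}).
Variables (nu : {sigma_finite_measure set W -> \bar R}).
Hypotheses (ls1 : lebesgue_space l1 mu) (ls2 : lebesgue_space l2 nu).
Local Notation l := (pair_coord l2 l1).
Let lsP := lebesgue_space_pair ls2 ls1.

(** Tested against products [b w * phi x], the weak derivative says that the locally integrable
    function [a] of [w] annihilates every [b], hence vanishes. *)
Lemma wder_rweak v (F g : W * V -> R) :
  locint l (nu \x mu)%E F -> locint l (nu \x mu)%E g ->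
  wder (nu \x mu)%E (0, v) F g ->
  rweak mu v nu (fun p => F (p.2, p.1)) (fun p => g (p.2, p.1)).
Proof.
move=> lF lg Fg phi tp; have tdp := test_derive v tp.
have ic (H : W * V -> R) psi : locint l (nu \x mu)%E H -> test_function psi ->
    locint l2 nu (fun w => \int[mu]_x (H (w, x) * psi x)).
  move=> lH tpsi; split => [|n].
    apply: (measurable_inty mu (h := fun p => H p * psi p.2)).
    apply: measurable_funM lH.1 _.
    exact: measurableT_comp (test_measurable ls1 tpsi) measurable_snd.
  have mc := ls_cube ls2 n.
  have [M HM] := test_bounded tpsi; have [k Hk] := test_support ls1 tpsi.
  have := locint_tens (a := \1_(ccube l2 n%:R)) (n1 := n) (n2 := k) (M1 := 1)
    ls2 ls1 lH _ (test_measurable ls1 tpsi) _ HM _ Hk.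
  move=> /(_ _ _ _)/wrap[].
  - by apply: measurable_indic.
  - by move=> x; rewrite indicE normr_nat; case: (_ \in _).
  - by move=> x nx; rewrite indicE memNset.
  move/integrable_inty => H1; apply/(integrable_mkcond _ mc).
  move: H1; congr integrable; apply/funext => w; rewrite patchE /= indicE.
  case: (w \in _).
    by congr EFin; apply: eq_Rintegral => x _; rewrite mul1r.
  by under eq_Rintegral do rewrite mul0r mulr0; rewrite /Rintegral integral0.
have ii (H : W * V -> R) psi b : locint l (nu \x mu)%E H -> test_function psi ->
    test_function b ->
    (nu \x mu)%E.-integrable setT (EFin \o (fun p => H p * (b p.1 * psi p.2))) /\
    \int[(nu \x mu)%E]_p (H p * (b p.1 * psi p.2)) =
    \int[nu]_w (\int[mu]_x (H (w, x) * psi x) * b w).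
  move=> lH tpsi tb; have i1 := locint_test lsP lH (test_tens tb tpsi).1.
  split => //; rewrite (Rfubini_inty i1); apply: ae_eq_Rintegral.
  - exact: (measurable_inty mu (measurable_int_real i1)).
  - exact: measurable_funM (ic _ _ lH tpsi).1 (test_measurable ls2 tb).
  apply: filterS (ae_integrable_secy i1) => w iw /=.
  (* Integrability of the slice is available only with the factor [b w], which is divided out where
     it is nonzero. *)
  have [->|b0] := eqVneq (b w) 0.
    by rewrite mulr0; under eq_Rintegral do rewrite mul0r mulr0; rewrite /Rintegral integral0.
  rewrite [RHS](_ : _ = \int[mu]_x ((b w)^-1 * (H (w, x) * (b w * psi x))) * b w).
    by rewrite RintegralZl// mulrC mulrA divff// mul1r.
  congr (_ * _); apply: eq_Rintegral => x _.
  by move: (b w) b0 (H (w, x)) (psi x) => c c0 h t; field.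
pose a w := \int[mu]_x (F (w, x) * 'D_v phi x) + \int[mu]_x (g (w, x) * phi x).
suff : {ae nu, forall w, a w = 0}.
  by apply: filterS => w /eqP; rewrite addr_eq0 => /eqP.
have lF1 := ic _ _ lF tdp; have lg1 := ic _ _ lg tp.
apply: (ae0_of_tests_loc ls2) => [n|b tb].
  by have := integrableD (ls_cube ls2 n) (lF1.2 n) (lg1.2 n); congr integrable.
have [i1 e1] := ii _ _ _ lF tdp tb; have [i2 e2] := ii _ _ _ lg tp tb.
under eq_Rintegral do rewrite mulrDl.
rewrite RintegralD//; [|exact: (locint_test ls2 lF1 tb)|exact: (locint_test ls2 lg1 tb)].
rewrite -e1 -e2; have := Fg _ (test_tens tb tp).1.
under eq_Rintegral do rewrite (test_tens tb tp).2.2.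
by move=> ->; rewrite addNr.
Qed.

End slices.

(** * Complex kernels *)

Definition cnt {R : realType} : set nat -> \bar R := @counting nat R.
HB.instance Definition _ (R : realType) := Measure.on (@cnt R).
HB.instance Definition _ (R : realType) :=
  Measure_isSigmaFinite.Build _ _ _ (@cnt R) (sigma_finite_counting R).

Lemma measurable_family d (T : measurableType d) (R : realType) (k : T -> nat)
  (f : nat -> T -> R) : measurable_fun setT k -> (forall j, measurable_fun setT (f j)) ->
  measurable_fun setT (fun t => f (k t) t).
Proof.
move=> mk mf _ B mB; rewrite setTI.
rewrite (_ : _ @^-1` B = \bigcup_j ((k @^-1` [set j]) `&` (f j @^-1` B))).
  apply: bigcup_measurable => j _; apply: measurableI.
    by have := mk measurableT [set j] I; rewrite setTI.
  by have := mf j measurableT B mB; rewrite setTI.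
apply/seteqP; split => [t tB|t [j _ [/= -> //]]].
by exists (k t).
Qed.

(** A nonempty set has counting measure at least one. *)
Lemma ae_cnt (R : realType) (P : nat -> Prop) : {ae @cnt R, forall j, P j} -> forall j, P j.
Proof.
move=> [N [_ N0 PN]] j; apply: contrapT => nP.
have jN : [set j] `<=` N by move=> _ ->; exact: PN.
have : (@cnt R [set j] <= cnt N)%E by apply: le_measure; rewrite ?inE.
rewrite N0 /cnt /counting /= asboolT; last exact: finite_set1.
by rewrite fset_set1 finmap.cardfs1 lee_fin ler10.
Qed.

Section families.
Context d (Y : measurableType d) (R : realType).
Variable rho : {sigma_finite_measure set Y -> \bar R}.

(** Countably many disjoint copies of Y. Its L^2 space is a direct sum, so that a sequence of
    kernels (the states of an ensemble, or a real and an imaginary part) is a single kernel. *)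
Definition famm : {sigma_finite_measure set (nat * Y)%type -> \bar R} :=
  [the {sigma_finite_measure set (nat * Y)%type -> \bar R} of prodm (@cnt R) rho].

Lemma ae_famm (P : nat * Y -> Prop) :
  {ae famm, forall q, P q} <-> forall j, {ae rho, forall y, P (j, y)}.
Proof.
split=> [H|H]; first exact: (ae_cnt (ae_secy (mu := @cnt R) (nu := rho) H)).
have /choice[N HN] : forall j, exists N, [/\ measurable N, rho N = 0%E &
    ~` [set y | P (j, y)] `<=` N] by move=> j; exact: H.
have mN j : measurable ([set j] `*` N j) by apply: measurableX => //; have [] := HN j.
exists (\bigcup_j ([set j] `*` N j)); split.
- exact: bigcup_measurable.
- apply/eqP; rewrite -measure_le0.
  apply: (@le_trans _ _ (\sum_(0 <= j <oo) famm ([set j] `*` N j))%E).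
    by apply: measure_sigma_subadditive => //; exact: bigcup_measurable.
  rewrite eseries0// => j _ _; have [mj j0 _] := HN j.
  by rewrite /famm /= /prodm product_measure1E// [X in (_ * X)%E]j0 mule0.
- move=> [j y] nP; exists j => //; split => //=; have [_ _] := HN j; exact.
Qed.

Lemma integral_famm (h : nat * Y -> \bar R) : measurable_fun setT h ->
  (forall q, 0 <= h q)%E ->
  (\int[famm]_q h q = \sum_(0 <= j <oo) \int[rho]_y h (j, y))%E.
Proof.
move=> mh h0; rewrite -[LHS]/(\int[(@cnt R \x rho)%E]_q h q)%E fubini_tonelli1//.
by rewrite -[LHS]/(\int[counting]_j _)%E ge0_integral_count// => j; exact: integral_ge0.
Qed.

Lemma nneseries_finite (u : nat -> \bar R) (k : nat) : (forall j, (k <= j)%N -> u j = 0%E) ->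
  (\sum_(0 <= j <oo) u j = \sum_(0 <= j < k) u j)%E.
Proof.
move=> u0; apply: lim_near_cst => //; exists k => // n /= kn.
rewrite (big_cat_nat _ (n := k))//= [X in (_ + X)%E]big1_seq ?adde0// => j.
by rewrite mem_index_iota => /andP[_ /andP[kj _]]; exact: u0.
Qed.

(** Turns the series over the ensemble into a single integral; its absolute convergence is Fubini
    for the counting measure. *)
Lemma integrable_famm (h : nat * Y -> R) : famm.-integrable setT (EFin \o h) ->
  [/\ forall j, rho.-integrable setT (fun y => (h (j, y))%:E),
      cvgn (series (fun j => `|\int[rho]_y h (j, y)|)),
      cvgn (series (fun j => \int[rho]_y h (j, y))) &
      \int[famm]_q h q = limn (series (fun j => \int[rho]_y h (j, y)))].
Proof.
move=> ih; pose a j := \int[rho]_y h (j, y).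
have ij : (@cnt R).-integrable setT (EFin \o a) := integrable_inty (mu := @cnt R) (nu := rho) ih.
have /integrableP[_] := ij.
rewrite -[X in (X < _)%E]/(\int[counting]_j `|(a j)%:E|)%E ge0_integral_count//.
move=> ab.
have ca : cvgn (series (fun j => `|a j|)).
  apply/cvg_ex; exists (fine (\sum_(0 <= j <oo) (`|a j|)%:E)).
  apply: cvg_series_EFin => //; rewrite fineK// ge0_fin_numE//.
  by apply: nneseries_ge0 => *; rewrite lee_fin.
have ca' : cvgn (series a) := normed_cvg ca.
split => //; first exact: (ae_cnt (ae_integrable_secy (mu := @cnt R) (nu := rho) ih)).
rewrite -[LHS]/(\int[(@cnt R \x rho)%E]_q h q) Rfubini_inty// -/(a _).
rewrite /Rintegral -[X in fine X]/(\int[counting]_j (a j)%:E)%E integral_count.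
  by rewrite (eseries_EFin ca').
rewrite /summable -nneseries_esumT//.
Qed.

End families.

Section sqint_families.
Context d1 d2 (X : measurableType d1) (Z : measurableType d2) (R : realType).
Variables (mu : {sigma_finite_measure set X -> \bar R}).
Variables (nu : {sigma_finite_measure set Z -> \bar R}).
Implicit Types (a b : X * Z -> R).

Definition unfam (F : nat -> X * Z -> R) (p : X * (nat * Z)) : R := F p.2.1 (p.1, p.2.2).

Lemma measurable_unfam F : (forall j, measurable_fun setT (F j)) ->
  measurable_fun setT (unfam F).
Proof.
move=> mF; apply: (measurable_family (k := fun p : X * (nat * Z) => p.2.1)
  (f := fun j p => F j (p.1, p.2.2))) => [|j].
  exact: measurableT_comp measurable_fst measurable_snd.
apply: (measurableT_comp (mF j)); apply/measurable_fun_pairP; split => /=.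
  exact: measurable_fst.
exact: measurableT_comp measurable_snd measurable_snd.
Qed.

Lemma measurable_component (G : X * (nat * Z) -> R) j : measurable_fun setT G ->
  measurable_fun setT (fun p => G (p.1, (j, p.2))).
Proof.
move=> mG; apply: (measurableT_comp mG); apply/measurable_fun_pairP; split => /=.
  exact: measurable_fst.
by apply/measurable_fun_pairP; split => /=; [exact: measurable_cst|exact: measurable_snd].
Qed.

Let iter_famm (G : X * (nat * Z) -> R) x : measurable_fun setT G ->
  (\int[famm nu]_q (G (x, q) ^+ 2)%:E = \sum_(0 <= j <oo) \int[nu]_z (G (x, (j, z)) ^+ 2)%:E)%E.
Proof.
move=> mG; rewrite integral_famm//; last by move=> q; rewrite lee_fin sqr_ge0.
by apply/measurable_EFinP/measurable_funX; exact: measurable_secy mG.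
Qed.

Lemma sqint_unfam (F : nat -> X * Z -> R) (C : R) :
  (forall j, sqint (mu \x nu)%E (F j)) ->
  (forall n, \sum_(0 <= j < n) rip (mu \x nu)%E (F j) (F j) <= C) ->
  sqint (mu \x famm nu)%E (unfam F).
Proof.
move=> sF FC; have mF j := sqint_measurable (sF j); have mU := measurable_unfam mF.
apply/(sqint_iterP mu (famm nu) mU).
under eq_integral do rewrite iter_famm//.
rewrite integral_nneseries//; last 2 first.
- by move=> j; exact: (measurable_iter nu (mF j)).
- by move=> j x _; apply: integral_ge0 => z _; rewrite lee_fin sqr_ge0.
apply: (@le_lt_trans _ _ C%:E); last exact: ltry.
apply: lime_le.
  apply: is_cvg_nneseries => j _ _; apply: integral_ge0 => x _; apply: integral_ge0 => z _.
  by rewrite lee_fin sqr_ge0.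
apply: nearW => n; apply: le_trans (_ : _ <= (\sum_(0 <= j < n) rip (mu \x nu)%E (F j) (F j))%:E)%E _; last by rewrite lee_fin.
rewrite -sumEFin; apply: lee_sum => j _; rewrite EFin_rip// fubini_tonelli1//.
  by apply/measurable_EFinP; exact: measurable_funX.
by move=> p; rewrite lee_fin sqr_ge0.
Qed.

Lemma sqint_component (G : X * (nat * Z) -> R) j : sqint (mu \x famm nu)%E G ->
  sqint (mu \x nu)%E (fun p => G (p.1, (j, p.2))).
Proof.
move=> sG; have mG := sqint_measurable sG; have mj := measurable_component j mG.
apply/(sqint_iterP mu nu mj).
move/(sqint_iterP mu (famm nu) mG): sG; apply: le_lt_trans.
have i0 x k : (0 <= \int[nu]_z (G (x, (k, z)) ^+ 2)%:E)%E.
  by apply: integral_ge0 => z _; rewrite lee_fin sqr_ge0.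
apply: ge0_le_integral => //.
- by move=> x _; exact: i0.
- exact: (measurable_iter nu mj).
- exact: (measurable_iter (famm nu) mG).
move=> x _; rewrite iter_famm//=.
apply: le_trans (nneseries_lim_ge j.+1 (fun k _ _ => i0 x k)).
by rewrite big_nat_recr//= leeDr// sume_ge0.
Qed.

(* A complex kernel is encoded as a real one whose second variable carries an
   index, 0 for the real part and 1 for the imaginary part. *)
Definition enc a b : X * (nat * Z) -> R :=
  unfam (fun j => match j with 0 => a | 1 => b | _ => fun=> 0 end).

Lemma measurable_enc a b : measurable_fun setT a -> measurable_fun setT b ->
  measurable_fun setT (enc a b).
Proof. by move=> ma mb; apply: measurable_unfam => -[|[|j]]. Qed.

Lemma sqint_enc a b : sqint (mu \x nu)%E a -> sqint (mu \x nu)%E b ->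
  sqint (mu \x famm nu)%E (enc a b).
Proof.
move=> sa sb; apply: (@sqint_unfam _ (rip (mu \x nu)%E a a + rip (mu \x nu)%E b b)).
  by move=> [|[|j]] //; exact: sqint0.
move=> n; have ra := rip_ge0 (mu \x nu)%E a; have rb := rip_ge0 (mu \x nu)%E b.
have r0 : rip (mu \x nu)%E (fun=> 0) (fun=> 0) = 0.
  by rewrite /rip; under eq_Rintegral do rewrite mul0r; rewrite /Rintegral integral0.
case: n => [|[|n]]; first by rewrite big_geq// addr_ge0.
  by rewrite big_nat1 lerDl.
rewrite !big_nat_recl//= big1 ?addr0// => j _; exact: r0.
Qed.

End sqint_families.

Section enc_integral.
Context d (Z : measurableType d) (R : realType) (nu : {sigma_finite_measure set Z -> \bar R}).

Lemma integral_enc (h : nat * Z -> R) : measurable_fun setT h ->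
  (forall j, (1 < j)%N -> forall z, h (j, z) = 0) ->
  (forall j, nu.-integrable setT (fun z => (h (j, z))%:E)) ->
  (famm nu).-integrable setT (EFin \o h) /\
  \int[famm nu]_q h q = \int[nu]_z h (0%N, z) + \int[nu]_z h (1%N, z).
Proof.
move=> mh h0 ih; have ih' : (famm nu).-integrable setT (EFin \o h).
  apply/integrableP; split; first exact/measurable_EFinP.
  have -> : (\int[famm nu]_q `|(EFin \o h) q| =
      \sum_(0 <= j <oo) \int[nu]_z `|(h (j, z))%:E|)%E.
    by apply: integral_famm => //; exact/measurableT_comp/measurable_EFinP.
  rewrite (nneseries_finite (k := 2)); last first.
    by move=> j j1; under eq_integral do rewrite h0// abse0; exact: integral0.
  rewrite big_nat_recl// big_nat1; apply: lte_add_pinfty.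
    by have /integrableP[] := ih 0.
  by have /integrableP[] := ih 1.
split=> //; have [_ _ _ ->] := integrable_famm ih'.
apply: lim_near_cst => //; exists 2 => // n /= n2.
rewrite /series/= (big_cat_nat _ (n := 2))//= [X in _ + X]big1_seq ?addr0.
  by rewrite big_nat_recl// big_nat1.
move=> j; rewrite mem_index_iota => /andP[_ /andP[j2 _]].
by under eq_Rintegral do rewrite h0//; rewrite /Rintegral integral0.
Qed.

End enc_integral.

Definition re (R : realType) T (f : T -> R[i]) (t : T) : R := complex.Re (f t).
Definition im (R : realType) T (f : T -> R[i]) (t : T) : R := complex.Im (f t).

Definition csq d (T : measurableType d) (R : realType) (m : {measure set T -> \bar R})
  (f : T -> R[i]) := sqint m (re f) /\ sqint m (im f).

Section complex_kernel.
Context d1 d2 (X : measurableType d1) (Z : measurableType d2) (R : realType).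
Variables (nu : {sigma_finite_measure set Z -> \bar R}).
Implicit Types (f g : X * Z -> R[i]).

Definition ckerp f g (p : X * X) : R[i] :=
  cint nu setT (fun z => f (p.1, z) * (g (p.2, z))^*%C).

Definition cenc f := enc (re f) (im f).
(** The encoding of [i f]: the imaginary part of a times the conjugate of b is the real inner
    product of a and i b. *)
Definition icenc f := enc (- im f) (re f).

Definition csec f x := csq nu (fun z => f (x, z)).

Let Re_prod (a b : R[i]) : complex.Re (a * b^*%C) =
  complex.Re a * complex.Re b + complex.Im a * complex.Im b.
Proof. by rewrite Re_mul Re_conjc Im_conjc mulrN opprK. Qed.

Let Im_prod (a b : R[i]) : complex.Im (a * b^*%C) =
  complex.Re a * - complex.Im b + complex.Im a * complex.Re b.
Proof. by rewrite Im_mul Re_conjc Im_conjc. Qed.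

Lemma cmeasurable f : measurable_fun setT (re f) -> measurable_fun setT (im f) ->
  measurable_fun setT (cenc f) /\ measurable_fun setT (icenc f).
Proof.
by move=> mr mi; split; apply: measurable_enc => //; exact: measurableT_comp.
Qed.

Lemma measurable_ckerp f g : measurable_fun setT (re f) -> measurable_fun setT (im f) ->
  measurable_fun setT (re g) -> measurable_fun setT (im g) ->
  measurable_fun setT (re (ckerp f g)) /\ measurable_fun setT (im (ckerp f g)).
Proof.
move=> mrf mif mrg mig.
have c (h : X * Z -> R) (u : X * X -> X) : measurable_fun setT h -> measurable_fun setT u ->
    measurable_fun setT (fun q : (X * X) * Z => h (u q.1, q.2)).
  move=> mh mu'; apply: (measurableT_comp mh); apply/measurable_fun_pairP; split => /=.
    exact: measurableT_comp mu' measurable_fst.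
  exact: measurable_snd.
have m1 := @measurable_fst _ _ X X; have m2 := @measurable_snd _ _ X X.
split.
  apply: (measurable_inty nu (h := fun q : (X * X) * Z => complex.Re (f (q.1.1, q.2) * (g (q.1.2, q.2))^*%C))).
  under [X in measurable_fun _ X]eq_fun do rewrite Re_prod.
  exact: measurable_funD (measurable_funM (c _ _ mrf m1) (c _ _ mrg m2))
    (measurable_funM (c _ _ mif m1) (c _ _ mig m2)).
apply: (measurable_inty nu (h := fun q : (X * X) * Z => complex.Im (f (q.1.1, q.2) * (g (q.1.2, q.2))^*%C))).
under [X in measurable_fun _ X]eq_fun do rewrite Im_prod.
apply: measurable_funD.
  apply: measurable_funM; first exact: (c _ _ mrf m1).
  apply: measurableT_comp => //; exact: (c _ _ mig m2).
exact: measurable_funM (c _ _ mif m1) (c _ _ mrg m2).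
Qed.

Lemma ckerp_enc f g x y : measurable_fun setT (re f) -> measurable_fun setT (im f) ->
  measurable_fun setT (re g) -> measurable_fun setT (im g) -> csec f x -> csec g y ->
  [/\ cintegrable nu setT (fun z => f (x, z) * (g (y, z))^*%C),
    re (ckerp f g) (x, y) = kerp (famm nu) (cenc f) (cenc g) (x, y) &
    im (ckerp f g) (x, y) = kerp (famm nu) (cenc f) (icenc g) (x, y)].
Proof.
move=> mrf mif mrg mig [srf sif] [srg sig].
have [mf _] := cmeasurable mrf mif; have [mg mig'] := cmeasurable mrg mig.
have i1 := sqintM_integrable srf srg; have i2 := sqintM_integrable sif sig.
have i3 := sqintM_integrable srf (sqintN sig); have i4 := sqintM_integrable sif srg.
have i0 : nu.-integrable setT (fun=> (0 : R)%:E) by exact: integrable0.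
have [_ e1] : (famm nu).-integrable setT (EFin \o (fun q => cenc f (x, q) * cenc g (y, q))) /\
   kerp (famm nu) (cenc f) (cenc g) (x, y) =
   \int[nu]_z (re f (x, z) * re g (y, z)) + \int[nu]_z (im f (x, z) * im g (y, z)).
  apply: integral_enc.
  - exact: measurable_funM (measurable_secy x mf) (measurable_secy y mg).
  - by move=> [|[|j]]// _ z; rewrite /cenc /enc /unfam /= mul0r.
  - move=> [|[|j]] //; move: i0; congr integrable; apply/funext => z.
    by rewrite /cenc /enc /unfam /= mul0r.
have [_ e2] : (famm nu).-integrable setT (EFin \o (fun q => cenc f (x, q) * icenc g (y, q))) /\
   kerp (famm nu) (cenc f) (icenc g) (x, y) =
   \int[nu]_z (re f (x, z) * - im g (y, z)) + \int[nu]_z (im f (x, z) * re g (y, z)).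
  apply: integral_enc.
  - exact: measurable_funM (measurable_secy x mf) (measurable_secy y mig').
  - by move=> [|[|j]]// _ z; rewrite /cenc /enc /unfam /= mul0r.
  - move=> [|[|j]] //; move: i0; congr integrable; apply/funext => z.
    by rewrite /cenc /enc /unfam /= mul0r.
split; last 2 first.
- rewrite e1 -RintegralD//; apply: eq_Rintegral => z _; exact: Re_prod.
- rewrite e2 -RintegralD//; apply: eq_Rintegral => z _; exact: Im_prod.
split.
  have := integrableD measurableT i1 i2; congr integrable; apply/funext => z.
  by rewrite /= Re_prod.
have := integrableD measurableT i3 i4; congr integrable; apply/funext => z.
by rewrite /= Im_prod.
Qed.

End complex_kernel.

Section real_sqloc.
Context d1 d2 (R : realType) (V : measNormedModType d1 R) (J : finType)
  (Z : measurableType d2).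
Variables (l : J -> V -> R) (mu : {sigma_finite_measure set V -> \bar R}).
Variables (nu : {sigma_finite_measure set Z -> \bar R}).
Hypothesis ls : lebesgue_space l mu.
Local Notation cube n := (ccube l n%:R).
Implicit Types (f g : V * Z -> R[i]) (a b : V * Z -> R).

Lemma sqlocN a : sqloc l mu nu a -> sqloc l mu nu (- a).
Proof.
move=> [ma sa]; split; first exact: measurableT_comp.
move=> n; have := sqintN (sa n); congr sqint; apply/funext => p.
by rewrite /cut /= !fctE mulrN.
Qed.

Lemma sqloc_enc a b : sqloc l mu nu a -> sqloc l mu nu b -> sqloc l mu (famm nu) (enc a b).
Proof.
move=> [ma sa] [mb sb]; split; first exact: measurable_enc.
move=> n; have := sqint_enc (sa n) (sb n); congr sqint; apply/funext => -[x [j z]].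
by rewrite /cut /enc /unfam /=; case: j => [|[|j]] //=; rewrite mulr0.
Qed.

Lemma sqloc_sec a : sqloc l mu nu a -> {ae mu, forall x, sqint nu (fun z => a (x, z))}.
Proof.
move=> [ma sa]; have H n := sqint_secy (sa n).
have := ae_foralln H; apply: filterS => x Hx.
have : setT x by []; rewrite -(bigcup_ccube l) => -[n _ nx].
have := Hx n; congr sqint; apply/funext => z.
by rewrite /cut indicE mem_set//= mul1r.
Qed.

Lemma locint_diag a b : sqloc l mu nu a -> sqloc l mu nu b ->
  locint l mu (fun x => \int[nu]_z (a (x, z) * b (x, z))).
Proof.
move=> sa sb; split; first exact: (measurable_inty nu (measurable_funM sa.1 sb.1)).
move=> n; have mc := ls_cube ls n; apply/(integrable_mkcond _ mc).
have := integrable_inty (sqintM_integrable (sa.2 n) (sb.2 n)).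
congr integrable; apply/funext => x; rewrite patchE /cut /= indicE.
case: (x \in _).
  by congr EFin; apply: eq_Rintegral => z _; rewrite !mul1r.
by under eq_Rintegral do rewrite !mul0r; rewrite /Rintegral integral0.
Qed.

End real_sqloc.

Section complex_sqloc.
Context d1 d2 (R : realType) (V : measNormedModType d1 R) (J : finType)
  (Z : measurableType d2).
Variables (l : J -> V -> R) (mu : {sigma_finite_measure set V -> \bar R}).
Variables (nu : {sigma_finite_measure set Z -> \bar R}).
Hypothesis ls : lebesgue_space l mu.
Local Notation cube n := (ccube l n%:R).
Implicit Types (f g : V * Z -> R[i]) (a b : V * Z -> R).

Definition csqloc f := sqloc l mu nu (re f) /\ sqloc l mu nu (im f).

Lemma csq_csqloc f : csq (mu \x nu)%E f -> csqloc f.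
Proof. by move=> [s1 s2]; split; exact: sqint_sqloc. Qed.

Lemma csqloc_sec f : csqloc f -> {ae mu, forall x, csec nu f x}.
Proof. by move=> [/(sqloc_sec) s1 /(sqloc_sec) s2]; apply: filterS2 s1 s2 => x. Qed.

Lemma csqloc_enc f : csqloc f ->
  sqloc l mu (famm nu) (cenc f) /\ sqloc l mu (famm nu) (icenc f).
Proof. by move=> [s1 s2]; split; apply: sqloc_enc => //; exact: sqlocN. Qed.

Lemma csq_enc f : csq (mu \x nu)%E f ->
  sqint (mu \x famm nu)%E (cenc f) /\ sqint (mu \x famm nu)%E (icenc f).
Proof. by move=> [s1 s2]; split; apply: sqint_enc => //; exact: sqintN. Qed.

(** The diagonal needs its own statement, since it may be a null set of the product measure. Both
    follow from [csec], which holds for almost every first variable. *)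
Lemma ckerp_enc_ae f g : csqloc f -> csqloc g ->
  {ae (mu \x mu)%E, forall p,
    re (ckerp nu f g) p = kerp (famm nu) (cenc f) (cenc g) p /\
    im (ckerp nu f g) p = kerp (famm nu) (cenc f) (icenc g) p} /\
  {ae mu, forall x, [/\ cintegrable nu setT (fun z => f (x, z) * (g (x, z))^*%C),
    re (ckerp nu f g) (x, x) = kerp (famm nu) (cenc f) (cenc g) (x, x) &
    im (ckerp nu f g) (x, x) = kerp (famm nu) (cenc f) (icenc g) (x, x)]}.
Proof.
move=> sf sg; have [[mrf _] [mif _]] := sf; have [[mrg _] [mig _]] := sg.
have af := csqloc_sec sf; have ag := csqloc_sec sg; split.
  have a1 := ae_prodx (mu := mu) mu af; have a2 := ae_prody mu (nu := mu) ag.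
  apply: filterS2 a1 a2 => -[x y] /= fx gy.
  by have [_] := ckerp_enc mrf mif mrg mig fx gy.
by apply: filterS2 af ag => x fx gx; exact: ckerp_enc.
Qed.

Definition clocint d (T : measNormedModType d R) (K : finType) (k : K -> T -> R)
  (m : {measure set T -> \bar R}) (f : T -> R[i]) := locint k m (re f) /\ locint k m (im f).

(** Source of the local integrability of the momentum density. *)
Lemma clocint_diag f g : csqloc f -> csqloc g ->
  clocint l mu (fun x => ckerp nu f g (x, x)).
Proof.
move=> sf sg; have [[mrf _] [mif _]] := sf; have [[mrg _] [mig _]] := sg.
have [m1 m2] := measurable_ckerp nu mrf mif mrg mig.
have mD : measurable_fun setT (fun x : V => (x, x)).
  by apply/measurable_fun_pairP; split => /=; exact: measurable_id.
have [ef eif] := csqloc_enc sf; have [eg eig] := csqloc_enc sg.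
have [_ H] := ckerp_enc_ae sf sg; split.
  have m1' := measurableT_comp m1 mD.
  apply: (locint_ae (g := fun x => re (ckerp nu f g) (x, x)) ls m1' _ (locint_diag ls ef eg)).
  by apply: filterS H => x [_ -> _].
have m2' := measurableT_comp m2 mD.
apply: (locint_ae (g := fun x => im (ckerp nu f g) (x, x)) ls m2' _ (locint_diag ls ef eig)).
by apply: filterS H => x [_ _ ->].
Qed.

End complex_sqloc.

(** * Weak derivatives and diagonals of complex kernel products *)

Section complex_weak.
Context d1 (R : realType) (V : measNormedModType d1 R) (J : finType).
Variables (l : J -> V -> R) (mu : {sigma_finite_measure set V -> \bar R}) (v : V).
Hypothesis ls : lebesgue_space l mu.
Local Notation cube n := (ccube l n%:R).
Local Notation lP := (pair_coord l l).

Definition crweak d2 (Z : measurableType d2) (nu : {measure set Z -> \bar R})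
  (f g : V * Z -> R[i]) := rweak mu v nu (re f) (re g) /\ rweak mu v nu (im f) (im g).

Definition cwder d (T : measNormedModType d R) (m : {measure set T -> \bar R}) (w : T)
  (f g : T -> R[i]) := wder m w (re f) (re g) /\ wder m w (im f) (im g).

Lemma crweak_enc d2 (Z : measurableType d2) (nu : {sigma_finite_measure set Z -> \bar R})
  (f g : V * Z -> R[i]) : crweak nu f g -> rweak mu v (famm nu) (cenc f) (cenc g).
Proof.
move=> [wr wi] phi tp; apply/ae_famm => -[|[|j]]; [exact: wr|exact: wi|].
apply: nearW => z; rewrite /opT /cenc /enc /unfam /=.
by under eq_Rintegral do rewrite mul0r; under [in RHS]eq_Rintegral do rewrite mul0r;
  rewrite /Rintegral integral0 oppr0.
Qed.

(** The transfer for encoded kernels yields a real kernel with an index in its second variable; its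
    components 0 and 1 are the real and imaginary parts of [dF]. *)
Lemma exists_crweak d2 d3 (U : measurableType d2) (Y : measurableType d3)
    (ups : {sigma_finite_measure set U -> \bar R})
    (rho : {sigma_finite_measure set Y -> \bar R})
    (h : nat -> V -> R) (G g : V * U -> R[i]) (F : V * Y -> R[i]) :
  frame mu h -> csq (mu \x ups)%E G -> csqloc l mu ups g -> crweak ups G g ->
  csq (mu \x rho)%E F ->
  {ae (mu \x mu)%E, forall p, ckerp ups G G p = ckerp rho F F p} ->
  exists2 dF, csqloc l mu rho dF & crweak rho F dF.
Proof.
move=> hF sG sg Gg sF GF.
have lG := csq_csqloc ls sG; have lF := csq_csqloc ls sF.
have GF' : {ae (mu \x mu)%E, forall p, kerp (famm ups) (cenc G) (cenc G) p =
    kerp (famm rho) (cenc F) (cenc F) p}.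
  apply: filterS3 GF (ckerp_enc_ae lG lG).1 (ckerp_enc_ae lF lF).1 => p e [<- _] [<- _].
  by rewrite /re e.
have [dF sdF FdF] := exists_rweak ls hF (csq_enc sG).1 (csqloc_enc sg).1
  (crweak_enc Gg) (csq_enc sF).1 GF'.
have sc j : sqloc l mu rho (fun p => dF (p.1, (j, p.2))).
  split; first exact: measurable_component sdF.1.
  by move=> n; exact: (sqint_component j (sdF.2 n)).
have wc j phi (tp : test_function phi) := (ae_famm rho _).1 (FdF phi tp) j.
exists (fun p => Complex (dF (p.1, (0%N, p.2))) (dF (p.1, (1%N, p.2)))).
  by split; [exact: sc|exact: sc].
by split => phi tp; [exact: (wc 0%N phi tp)|exact: (wc 1%N phi tp)].
Qed.

Lemma sqloc_locint d2 (W : measNormedModType d2 R) (J2 : finType) (l2 : J2 -> W -> R)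
    (nu : {sigma_finite_measure set W -> \bar R}) (g : V * W -> R) :
  lebesgue_space l2 nu -> sqloc l mu nu g -> locint (pair_coord l l2) (mu \x nu)%E g.
Proof.
move=> ls2 [mg sg]; split => // n; have lsP := lebesgue_space_pair ls ls2.
have mc := ls_cube lsP n.
have := sqint_loc_integrable lsP n (sg n).
apply: eq_integrable => // p; rewrite inE => /=; rewrite ccube_pair => -[c1 _].
by rewrite /cut indicE mem_set ?mul1r.
Qed.

(** A derivative in the first variable falls on the first factor only: slicewise by [rweak_kerp],
    then on the product space by [rweak_wder]. The real and the imaginary part of the product differ
    only in the encoding of [Q], which [key] leaves arbitrary. *)
Lemma cwder_ckerp d2 (Z : measurableType d2) (nu : {sigma_finite_measure set Z -> \bar R})
    (G g Q : V * Z -> R[i]) :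
  csq (mu \x nu)%E G -> csqloc l mu nu g -> crweak nu G g -> csq (mu \x nu)%E Q ->
  [/\ clocint lP (mu \x mu)%E (ckerp nu G Q), clocint lP (mu \x mu)%E (ckerp nu g Q) &
      cwder (mu \x mu)%E (v, 0) (ckerp nu G Q) (ckerp nu g Q)].
Proof.
move=> sG sg Gg sQ; have lsP := lebesgue_space_pair ls ls.
have lG := csq_csqloc ls sG; have lQ := csq_csqloc ls sQ.
have [eQ eiQ] := csq_enc sQ; have [eG _] := csq_enc sG; have [eg _] := csqloc_enc sg.
have [HG _] := ckerp_enc_ae lG lQ; have [Hg _] := ckerp_enc_ae sg lQ.
have wGg := crweak_enc Gg.
have [[mrG _] [miG _]] := lG; have [[mrg _] [mig _]] := sg; have [[mrQ _] [miQ _]] := lQ.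
have [mGr mGi] := measurable_ckerp nu mrG miG mrQ miQ.
have [mgr mgi] := measurable_ckerp nu mrg mig mrQ miQ.
have key (Q' : V * (nat * Z) -> R) (a b : V * V -> R) : sqint (mu \x famm nu)%E Q' ->
    measurable_fun setT a -> measurable_fun setT b ->
    {ae (mu \x mu)%E, forall p, kerp (famm nu) (cenc G) Q' p = a p} ->
    {ae (mu \x mu)%E, forall p, kerp (famm nu) (cenc g) Q' p = b p} ->
    [/\ locint lP (mu \x mu)%E a, locint lP (mu \x mu)%E b & wder (mu \x mu)%E (v, 0) a b].
  move=> sQ' ma mb Ha Hb.
  have l1 := sqloc_locint ls (sqloc_kerp (sqint_sqloc ls eG) sQ').
  have l2 := sqloc_locint ls (sqloc_kerp eg sQ').
  have w := rweak_wder ls ls l1 l2 (rweak_kerp ls eG eg wGg sQ').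
  split; [exact: (locint_ae lsP ma Ha l1)|exact: (locint_ae lsP mb Hb l2)|].
  exact: (wder_ae lsP l1.1 ma l2.1 mb Ha Hb w).
have [] := key _ _ _ eQ mGr mgr.
- by apply: filterS HG => p [-> _].
- by apply: filterS Hg => p [-> _].
move=> l1 l2 w1; have [] := key _ _ _ eiQ mGi mgi.
- by apply: filterS HG => p [_ ->].
- by apply: filterS Hg => p [_ ->].
by move=> l3 l4 w2; exact: (And3 (conj l1 l3) (conj l2 l4) (conj w1 w2)).
Qed.

Lemma ckerp_diag_unique d2 d3 (U : measurableType d2) (Y : measurableType d3)
    (ups : {sigma_finite_measure set U -> \bar R})
    (rho : {sigma_finite_measure set Y -> \bar R})
    (h : nat -> V -> R) (g Q : V * U -> R[i]) (g' Q' : V * Y -> R[i]) :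
  frame mu h -> csqloc l mu ups g -> csqloc l mu ups Q ->
  csqloc l mu rho g' -> csqloc l mu rho Q' ->
  {ae (mu \x mu)%E, forall p, ckerp ups g Q p = ckerp rho g' Q' p} ->
  {ae mu, forall x, ckerp ups g Q (x, x) = ckerp rho g' Q' (x, x)}.
Proof.
move=> hF sg sQ sg' sQ' E.
have [H1 D1] := ckerp_enc_ae sg sQ; have [H2 D2] := ckerp_enc_ae sg' sQ'.
have [eg _] := csqloc_enc sg; have [eg' _] := csqloc_enc sg'.
have [eQ eiQ] := csqloc_enc sQ; have [eQ' eiQ'] := csqloc_enc sQ'.
have Er : {ae (mu \x mu)%E, forall p, kerp (famm ups) (cenc g) (cenc Q) p =
    kerp (famm rho) (cenc g') (cenc Q') p}.
  by apply: filterS3 E H1 H2 => p e [<- _] [<- _]; rewrite /re e.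
have Ei : {ae (mu \x mu)%E, forall p, kerp (famm ups) (cenc g) (icenc Q) p =
    kerp (famm rho) (cenc g') (icenc Q') p}.
  by apply: filterS3 E H1 H2 => p e [_ <-] [_ <-]; rewrite /im e.
have dr := diag_unique ls hF eg eQ eg' eQ' Er.
have di := diag_unique ls hF eg eiQ eg' eiQ' Ei.
have dri : {ae mu, forall x,
    kerp (famm ups) (cenc g) (cenc Q) (x, x) = kerp (famm rho) (cenc g') (cenc Q') (x, x) /\
    kerp (famm ups) (cenc g) (icenc Q) (x, x) = kerp (famm rho) (cenc g') (icenc Q') (x, x)}.
  by apply: filterS2 dr di.
apply: filterS3 dri D1 D2 => x [er ei] [_ r1 i1] [_ r2 i2].
move: er ei; rewrite -r1 -i1 -r2 -i2 /re /im.
by case: (ckerp ups _ _ _) => a b; case: (ckerp rho _ _ _) => a' b' /= -> ->.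
Qed.

End complex_weak.

(** * Agreement with the complex weak derivatives of the definitions *)

Section weak_derivative_parts.
Context d (R : realType) (V : measNormedModType d R) (J : finType).
Variables (l : J -> V -> R) (mu : {measure set V -> \bar R}).
Hypothesis ls : lebesgue_space l mu.
Local Notation cube n := (ccube l n%:R).
Implicit Types (f g : V -> R[i]).

Lemma locint_compact (a : V -> R) K : locint l mu a -> compact K ->
  mu.-integrable K (EFin \o a).
Proof.
move=> [ma ia] cK; have [n Kn] := bounded_in_ccube (ls_coordinates ls) cK.
exact: integrableS (ls_cube ls n) (ls_compact ls cK) Kn (ia n).
Qed.

Lemma locint_of_compact (a : V -> R) :
  (forall K, compact K -> mu.-integrable K (EFin \o a)) -> locint l mu a.
Proof.
move=> H; have Hn n : mu.-integrable (cube n) (EFin \o a).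
  by apply: H; exact: coordinate_compact (ls_coordinates ls) _.
split => //; rewrite -(bigcup_ccube l); apply/measurable_fun_bigcup => n.
  exact: ls_cube ls n.
by have /measurable_int/measurable_EFinP := Hn n.
Qed.

Lemma in_L1locP f : in_L1loc mu f <-> clocint l mu f.
Proof.
split=> [H|[lr li] K cK]; last by split; exact: locint_compact.
by split; apply: locint_of_compact => K /H[].
Qed.

Lemma weak_deriveP v f g : weak_derive mu v f g <->
  [/\ clocint l mu f, clocint l mu g & cwder mu v f g].
Proof.
have cE h (phi : V -> R) : cint mu setT (fun x => h x * (phi x)%:C%C) =
    Complex (\int[mu]_x (re h x * phi x)) (\int[mu]_x (im h x * phi x)).
  rewrite /cint; congr Complex; apply: eq_Rintegral => x _.
    by rewrite Re_mul /= mulr0 subr0.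
  by rewrite Im_mul /= mulr0 add0r.
split=> [[/in_L1locP lf /in_L1locP lg H]|[lf lg [H1 H2]]].
  split => //; split => phi tp; have := H phi tp; rewrite !cE => -[]//.
split; [exact/in_L1locP|exact/in_L1locP|].
by move=> phi tp; rewrite !cE; congr Complex; [exact: H1|exact: H2].
Qed.

Lemma cwder_unique v f g g' : clocint l mu g -> clocint l mu g' ->
  cwder mu v f g -> cwder mu v f g' -> {ae mu, forall x, g x = g' x}.
Proof.
move=> [l1 l2] [l1' l2'] [w1 w2] [w1' w2'].
apply: filterS2 (wder_unique ls l1 l1' w1 w1') (wder_unique ls l2 l2' w2 w2') => x.
by rewrite /re /im; case: (g x) => a b; case: (g' x) => a' b' /= -> ->.
Qed.

Lemma clocint_ae f g : measurable_fun setT (re g) -> measurable_fun setT (im g) ->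
  {ae mu, forall x, f x = g x} -> clocint l mu f -> clocint l mu g.
Proof.
move=> m1 m2 fg [l1 l2]; split.
  by apply: (locint_ae ls m1 _ l1); apply: filterS fg => x e; rewrite /re e.
by apply: (locint_ae ls m2 _ l2); apply: filterS fg => x e; rewrite /im e.
Qed.

Lemma cwder_ae v f f' g g' : clocint l mu f -> clocint l mu f' ->
  clocint l mu g -> clocint l mu g' ->
  {ae mu, forall x, f x = f' x} -> {ae mu, forall x, g x = g' x} ->
  cwder mu v f g -> cwder mu v f' g'.
Proof.
move=> [[m1 _] [m2 _]] [[m1' _] [m2' _]] [[n1 _] [n2 _]] [[n1' _] [n2' _]] ff gg [w1 w2].
split.
  apply: (wder_ae ls m1 m1' n1 n1' _ _ w1); first by apply: filterS ff => x e; rewrite /re e.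
  by apply: filterS gg => x e; rewrite /re e.
apply: (wder_ae ls m2 m2' n2 n2' _ _ w2); first by apply: filterS ff => x e; rewrite /im e.
by apply: filterS gg => x e; rewrite /im e.
Qed.

End weak_derivative_parts.

(** * Many-electron states *)

Section matrix_space.
Context {R : realType}.

Lemma lebesgue_space_rV n : lebesgue_space (@entry R 1 n) (leb_rV n).
Proof.
split; [exact: mx_coordinates|exact: leb_rV_ccube|exact: mx_dense|exact: measurable_mx_ball].
Qed.

Lemma lebesgue_space_mx m n : lebesgue_space (@entry R m n) (leb_mx m n).
Proof.
split; [exact: mx_coordinates|exact: leb_mx_ccube|exact: mx_dense|exact: measurable_mx_ball].
Qed.

Variables m n : nat.
Local Notation M1 := 'M[R]_(m.+1, n).
Local Notation mu1 := (leb_mx m.+1 n : {sigma_finite_measure set M1 -> \bar R}).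
Local Notation mu2 := (leb_rV n \x leb_mx m n)%E.
Local Notation cons := (@mx_cons R m n).
Local Notation uncons := (@mx_uncons R m n).

Lemma mx_unconsK : cancel uncons cons.
Proof. by move=> M; rewrite /mx_cons /mx_uncons vsubmxK. Qed.

Lemma ge0_integral_mx_cons (f : M1 -> \bar R) : measurable_fun setT f ->
  (forall x, (0 <= f x)%E) -> (\int[mu1]_x f x = \int[mu2]_p f (cons p))%E.
Proof.
move=> mf f0; rewrite -[LHS]/(\int[pushforward mu2 cons]_x f x)%E.
by rewrite ge0_integral_pushforward//; exact: measurable_mx_cons.
Qed.

Lemma measurable_comp_cons (f : M1 -> R) : measurable_fun setT f ->
  measurable_fun setT (fun p => f (cons p)).
Proof. by move=> mf; apply: measurableT_comp mf _; exact: measurable_mx_cons. Qed.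

Lemma integrable_mx_cons (f : M1 -> R) : measurable_fun setT f ->
  mu1.-integrable setT (EFin \o f) <->
  mu2.-integrable setT (EFin \o (fun p => f (cons p))).
Proof.
move=> mf; have mf' := measurable_comp_cons mf.
have e : (\int[mu1]_x `|(f x)%:E| = \int[mu2]_p `|(f (cons p))%:E|)%E.
  by rewrite ge0_integral_mx_cons//; exact/measurableT_comp/measurable_EFinP.
split=> /integrableP[_ H]; apply/integrableP.
  by split; [exact/measurable_EFinP|rewrite -[X in (X < _)%E]e].
by split; [exact/measurable_EFinP|rewrite [X in (X < _)%E]e].
Qed.

Lemma Rintegral_mx_cons (f : M1 -> R) : measurable_fun setT f ->
  \int[mu1]_x f x = \int[mu2]_p f (cons p).
Proof.
move=> mf; rewrite /Rintegral; congr fine; have mE : measurable_fun setT (EFin \o f).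
  exact/measurable_EFinP.
rewrite integralE [RHS]integralE; congr (_ - _)%E.
  have mp : measurable_fun setT (EFin \o f)^\+%E by exact/measurable_funepos/measurable_EFinP.
  by rewrite (ge0_integral_mx_cons mp)//; apply: eq_integral => p _; rewrite !funeposE.
have mp : measurable_fun setT (EFin \o f)^\-%E by exact/measurable_funeneg/measurable_EFinP.
by rewrite (ge0_integral_mx_cons mp)//; apply: eq_integral => p _; rewrite !funenegE.
Qed.

Lemma sqint_mx_cons (f : M1 -> R) : measurable_fun setT f ->
  sqint mu1 f <-> sqint mu2 (fun p => f (cons p)).
Proof.
move=> mf; have mf' := measurable_comp_cons mf.
have e : (\int[mu1]_x (f x ^+ 2)%:E = \int[mu2]_p (f (cons p) ^+ 2)%:E)%E.
  rewrite ge0_integral_mx_cons//; last by move=> x; rewrite lee_fin sqr_ge0.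
  by apply/measurable_EFinP; exact: measurable_funX.
by rewrite /sqint e; split => -[].
Qed.

Lemma ae_mx_cons (P : M1 -> Prop) : {ae mu1, forall x, P x} -> {ae mu2, forall p, P (cons p)}.
Proof.
move=> [N [mN N0 PN]]; exists (cons @^-1` N); split => //.
  by rewrite -[X in measurable X]setTI; exact: measurable_mx_cons.
by move=> p /= nP; exact: PN.
Qed.

Lemma ccube_mx_cons c : cons @^-1` (ccube (@entry R m.+1 n) c) =
  ccube (pair_coord (@entry R 1 n) (@entry R m n)) c.
Proof.
apply/seteqP; split=> [p H [[i j]|[i j]]|p H [i j]] /=.
- have := H (@lshift 1 m i, j).
  by rewrite /entry /= /mx_cons (col_mxEu p.1 p.2).
- have := H (@rshift 1 m i, j).
  by rewrite /entry /= /mx_cons (col_mxEd p.1 p.2).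
rewrite /entry /= /mx_cons; case: (@split_ordP 1 m i) => k ->.
  by rewrite (col_mxEu p.1 p.2); exact: (H (inl (k, j))).
by rewrite (col_mxEd p.1 p.2); exact: (H (inr (k, j))).
Qed.

Lemma locint_mx_cons (f : M1 -> R) : measurable_fun setT f ->
  locint (@entry R m.+1 n) mu1 f <->
  locint (pair_coord (@entry R 1 n) (@entry R m n)) mu2 (fun p => f (cons p)).
Proof.
move=> mf; have mf' := measurable_comp_cons mf.
have mc k := ls_cube (lebesgue_space_mx m.+1 n) k.
have mc' k := ls_cube (lebesgue_space_pair (lebesgue_space_rV n) (lebesgue_space_mx m n)) k.
suff H k : mu1.-integrable (ccube (@entry R m.+1 n) k%:R) (EFin \o f) <->
   mu2.-integrable (ccube (pair_coord (@entry R 1 n) (@entry R m n)) k%:R)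
     (EFin \o (fun p => f (cons p))).
  by split=> -[_ H']; split => // k; apply/H.
rewrite (integrable_mkcond _ (mc k)) (integrable_mkcond _ (mc' k)).
have pE d (T : measurableType d) (b : T -> R) A :
    (EFin \o b) \_ A = EFin \o (b \_ A).
  by apply/funext => x; rewrite /= !patchE; case: ifP.
rewrite !pE integrable_mx_cons; last first.
  by apply/(measurable_restrictT _ (mc k))/measurable_funTS.
rewrite (_ : (fun p => _) = (fun p => f (cons p)) \_ (ccube (pair_coord (@entry R 1 n) (@entry R m n)) k%:R))//.
apply/funext => p; rewrite !patchE -ccube_mx_cons.
by rewrite (_ : (cons p \in _) = (p \in cons @^-1` ccube (@entry R m.+1 n) k%:R)).
Qed.

(** [mx_cons] is linear and bicontinuous, hence pulls test functions back to test functions, and it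
    carries the direction [(delta_mx 0 k, 0)] to the k-th coordinate direction of the first
    electron. *)
Lemma wder_mx_cons k (f g : M1 -> R) : measurable_fun setT f -> measurable_fun setT g ->
  wder mu2 (delta_mx 0 k, 0) (fun p => f (cons p)) (fun p => g (cons p)) ->
  wder mu1 (delta_mx 0 k) f g.
Proof.
move=> mf mg H phi tp.
have ls := lebesgue_space_mx m.+1 n.
have mp := test_measurable ls tp; have mdp := test_measurable ls (test_derive (delta_mx 0 k) tp).
have cA : continuous cons.
  move=> p0; apply: mx_continuous => i j; rewrite /mx_cons.
  case: (@split_ordP 1 m i) => k' ->.
    under eq_fun do rewrite (col_mxEu _.1 _.2).
    move=> p; apply: (@continuous_comp _ _ _ fst (@entry R 1 n (k', j))); first exact: cvg_fst.
    exact: coordinate_continuous (mx_coordinates R 1 n) (k', j) _.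
  under eq_fun do rewrite (col_mxEd _.1 _.2).
  move=> p; apply: (@continuous_comp _ _ _ snd (@entry R m n (k', j))); first exact: cvg_snd.
  exact: coordinate_continuous (mx_coordinates R m n) (k', j) _.
have cB : continuous uncons.
  have c1 : continuous (fun x : M1 => (uncons x).1).
    apply: mx_continuous => i j; under eq_fun do rewrite mxE.
    by move=> x; exact: coordinate_continuous (mx_coordinates R m.+1 n) (@lshift 1 m i, j) x.
  have c2 : continuous (fun x : M1 => (uncons x).2).
    apply: mx_continuous => i j; under eq_fun do rewrite mxE.
    by move=> x; exact: coordinate_continuous (mx_coordinates R m.+1 n) (@rshift 1 m i, j) x.
  by move=> x; exact: (cvg_pair (c1 x) (c2 x)).
have AE (h : R) v x : cons (h *: v + x) = h *: cons v + cons x.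
  by rewrite /mx_cons scale_col_mx add_col_mx.
have tp' : test_function (phi \o cons).
  have [sp [K cK K0]] := tp; split; first exact: (@smooth_comp_affine _ _ R ('rV[R]_n * 'M[R]_(m, n))%type M1 cons cons cA AE phi sp).
  exists (uncons @` K); first by apply: continuous_compact => //; exact: continuous_subspaceT.
  by move=> p np; apply: K0 => Kp; apply: np; exists (cons p) => //; rewrite mx_consK.
rewrite Rintegral_mx_cons; last exact: measurable_funM.
rewrite Rintegral_mx_cons; last exact: measurable_funM.
apply: etrans (H _ tp'); apply: eq_Rintegral => p _; congr (_ * _).
have := @iter_derive_comp_affine _ _ R ('rV[R]_n * 'M[R]_(m, n))%type M1 cons cons AE phi
  [:: (delta_mx 0 k, 0)].
move=> /(congr1 (fun h => h p)) /= ->; congr ('D_ _ _ _).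
rewrite /mx_cons /=; apply/matrixP => i j.
case: (@split_ordP 1 m i) => i' ->.
  by apply: etrans (esym (col_mxEu _ _ _ _)); rewrite !mxE ord1.
by apply: etrans (esym (col_mxEd _ _ _ _)); rewrite !mxE.
Qed.

End matrix_space.

Lemma in_L2_indic d (T : measurableType d) (R : realType) (m : {measure set T -> \bar R})
  A (f : T -> R[i]) : measurable A -> in_L2 m A f ->
  sqint m (fun t => \1_A t * re f t) /\ sqint m (fun t => \1_A t * im f t).
Proof.
move=> mA [mr mi foo].
have key (a : T -> R) : measurable_fun A a -> (forall t, a t ^+ 2 <= Normc.normc (f t) ^+ 2) ->
    sqint m (fun t => \1_A t * a t).
  move=> ma le; have aE : (fun t => \1_A t * a t) = a \_ A.
    by apply/funext => t; rewrite patchE indicE; case: (_ \in _); rewrite ?mul1r ?mul0r.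
  have mE : measurable_fun setT (fun t => \1_A t * a t).
    by rewrite aE; exact/(measurable_restrictT _ mA).
  split => //.
  apply: le_lt_trans foo; rewrite [leRHS]integral_mkcond.
  apply: ge0_le_integral => //.
  - by move=> t _; rewrite lee_fin sqr_ge0.
  - by apply/measurable_EFinP; exact: measurable_funX.
  - apply/(measurable_restrictT _ mA)/measurable_EFinP.
    under [X in measurable_fun _ X]eq_fun do rewrite sqr_normc.
    by apply: measurable_funD; exact: measurable_funX.
  move=> t _; rewrite patchE indicE; case: (_ \in _).
    by rewrite mul1r lee_fin le.
  by rewrite mul0r expr0n.
split; apply: key => // t; rewrite sqr_normc.
  by rewrite lerDl sqr_ge0.
by rewrite lerDr sqr_ge0.
Qed.

Lemma in_L2_csq d (T : measurableType d) (R : realType) (m : {measure set T -> \bar R})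
  (f : T -> R[i]) : in_L2 m setT f <-> csq m f.
Proof. exact: in_L2P. Qed.

Section swapping.
Context d1 d2 (X : measurableType d1) (Z : measurableType d2) (R : realType).
Variables (mu : {sigma_finite_measure set X -> \bar R}).
Variables (nu : {sigma_finite_measure set Z -> \bar R}).

Lemma measurable_swap_pair : measurable_fun setT (fun p : X * Z => (p.2, p.1)).
Proof. by apply/measurable_fun_pairP; split => /=; [exact: measurable_snd|exact: measurable_fst]. Qed.

Lemma sqint_swap (f : Z * X -> R) : sqint (nu \x mu)%E f ->
  sqint (mu \x nu)%E (fun p => f (p.2, p.1)).
Proof.
move=> [mf foo]; have mf' := measurableT_comp mf measurable_swap_pair; split => //.
rewrite fubini_tonelli1//; last 2 first.
- by apply/measurable_EFinP; exact: measurable_funX.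
- by move=> p; rewrite lee_fin sqr_ge0.
move: foo; rewrite fubini_tonelli2//.
- by apply/measurable_EFinP; exact: measurable_funX.
- by move=> p; rewrite lee_fin sqr_ge0.
Qed.

Lemma csq_swap (f : Z * X -> R[i]) : csq (nu \x mu)%E f ->
  csq (mu \x nu)%E (fun p => (f (p.2, p.1))^*%C).
Proof.
move=> [/sqint_swap sr /sqint_swap si]; split.
  by move: sr; congr sqint; apply/funext => p; rewrite /re Re_conjc.
by move/sqintN: si; congr sqint; apply/funext => p; rewrite /im Im_conjc.
Qed.

End swapping.

Section local_L2_sets.
Context d1 d2 (R : realType) (V : measNormedModType d1 R) (J : finType)
  (Z : measurableType d2).
Variables (l : J -> V -> R) (mu : {sigma_finite_measure set V -> \bar R}).
Variables (nu : {sigma_finite_measure set Z -> \bar R}).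
Hypothesis ls : lebesgue_space l mu.
Local Notation cube n := (ccube l n%:R).

Lemma csqloc_of_in_L2 (f : V * Z -> R[i]) :
  (forall K, compact K -> in_L2 (mu \x nu)%E (K `*` setT) f) -> csqloc l mu nu f.
Proof.
move=> H; have Hn n : in_L2 (mu \x nu)%E (cube n `*` setT) f.
  by apply: H; exact: coordinate_compact (ls_coordinates ls) _.
have mc n : measurable (cube n `*` (setT : set Z)).
  by apply: measurableX => //; exact: ls_cube ls n.
have cT : \bigcup_n (cube n `*` (setT : set Z)) = setT.
  apply/seteqP; split => // -[x z] _; have : setT x by [].
  by rewrite -(bigcup_ccube l) => -[n _ nx]; exists n.
have cE n (a : V * Z -> R) : cut (cube n) a = (fun t => \1_(cube n `*` setT) t * a t).
  apply/funext => p; rewrite /cut !indicE; congr (_%:R * _); congr nat_of_bool.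
  by apply/idP/idP => /set_mem h; apply/mem_set; [split|have [] := h].
split; split.
- by rewrite -cT; apply/measurable_fun_bigcup => // n; have [] := Hn n.
- by move=> n; rewrite cE; have [] := in_L2_indic (mc n) (Hn n).
- by rewrite -cT; apply/measurable_fun_bigcup => // n; have [] := Hn n.
- by move=> n; rewrite cE; have [] := in_L2_indic (mc n) (Hn n).
Qed.

(** Right factors of a product carry the inner variable first. The kernels compared by [ckerp] carry
    it second and the second argument is conjugated, so such a factor enters through its adjoint. *)
Lemma csqloc_of_in_L2_swap (f : Z * V -> R[i]) :
  (forall K, compact K -> in_L2 (nu \x mu)%E (setT `*` K) f) ->
  csqloc l mu nu (fun p => (f (p.2, p.1))^*%C).
Proof.
move=> H; have Hn n : in_L2 (nu \x mu)%E (setT `*` cube n) f.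
  by apply: H; exact: coordinate_compact (ls_coordinates ls) _.
have mc n : measurable ((setT : set Z) `*` cube n).
  by apply: measurableX => //; exact: ls_cube ls n.
have cT : \bigcup_n ((setT : set Z) `*` cube n) = setT.
  apply/seteqP; split => // -[z x] _; have : setT x by [].
  by rewrite -(bigcup_ccube l) => -[n _ nx]; exists n.
have mr : measurable_fun setT (re f).
  by rewrite -cT; apply/measurable_fun_bigcup => // n; have [] := Hn n.
have mi : measurable_fun setT (im f).
  by rewrite -cT; apply/measurable_fun_bigcup => // n; have [] := Hn n.
have cE n (a : Z * V -> R) : cut (cube n) (fun p => a (p.2, p.1)) =
    (fun p => (fun t => \1_(setT `*` cube n) t * a t) (p.2, p.1)).
  apply/funext => p; rewrite /cut !indicE; congr (_%:R * _); congr nat_of_bool.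
  by apply/idP/idP => /set_mem h; apply/mem_set; [split|have [] := h].
have s1 : sqloc l mu nu (fun p => re f (p.2, p.1)).
  split; first exact: measurableT_comp mr (@measurable_swap_pair _ _ V Z).
  by move=> n; rewrite cE; have [h _] := in_L2_indic (mc n) (Hn n); exact: (sqint_swap h).
have s2 : sqloc l mu nu (fun p => im f (p.2, p.1)).
  split; first exact: measurableT_comp mi (@measurable_swap_pair _ _ V Z).
  by move=> n; rewrite cE; have [_ h] := in_L2_indic (mc n) (Hn n); exact: (sqint_swap h).
split.
  by move: s1; congr sqloc; apply/funext => p; rewrite /re Re_conjc.
by move/sqlocN: s2; congr sqloc; apply/funext => p; rewrite /im Im_conjc.
Qed.

End local_L2_sets.

Lemma wderZ d (R : realType) (V : measNormedModType d R) (J : finType) (l : J -> V -> R)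
  (mu : {measure set V -> \bar R}) v (c : R) (f g : V -> R) :
  lebesgue_space l mu -> locint l mu f -> locint l mu g -> wder mu v f g ->
  wder mu v (fun x => c * f x) (fun x => c * g x).
Proof.
move=> ls lf lg fg phi tp.
under eq_Rintegral do rewrite -mulrA; under [in RHS]eq_Rintegral do rewrite -mulrA.
rewrite RintegralZl//; last exact: (locint_test ls lf (test_derive v tp)).
by rewrite RintegralZl//; [rewrite fg// mulrN|exact: (locint_test ls lg tp)].
Qed.

Lemma locintZ d (R : realType) (V : measNormedModType d R) (J : finType) (l : J -> V -> R)
  (mu : {measure set V -> \bar R}) (c : R) (f : V -> R) :
  lebesgue_space l mu -> locint l mu f -> locint l mu (fun x => c * f x).
Proof.
move=> ls [mf fi]; split; first exact: measurable_funM.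
move=> n; have := integrableZl (ls_cube ls n) c (fi n); congr integrable.
Qed.

Section minus_i.
Context (R : realType).
Implicit Types (z : R[i]).

Lemma Re_mulNi z : complex.Re (- 'i%C * z) = complex.Im z.
Proof. by rewrite Re_mul /= oppr0 mul0r add0r mulN1r opprK. Qed.

Lemma Im_mulNi z : complex.Im (- 'i%C * z) = - complex.Re z.
Proof. by rewrite Im_mul /= oppr0 mul0r add0r mulN1r. Qed.

Lemma cint_mulNi d (T : measurableType d) (m : {measure set T -> \bar R}) (f : T -> R[i]) :
  cintegrable m setT f ->
  cintegrable m setT (fun t => - 'i%C * f t) /\
  cint m setT (fun t => - 'i%C * f t) = - 'i%C * cint m setT f.
Proof.
move=> [ir ii]; split.
  split; first by move: ii; congr integrable; apply/funext => t; rewrite Re_mulNi.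
  have := integrableN ir; congr integrable; apply/funext => t.
  by rewrite Im_mulNi.
apply: complex_eq; rewrite ?Re_mulNi ?Im_mulNi /=.
  by apply: eq_Rintegral => t _; rewrite Re_mulNi.
rewrite -[RHS]mulN1r -RintegralZl//; apply: eq_Rintegral => t _.
by rewrite Im_mulNi mulN1r.
Qed.

Context d1 d2 (V : measNormedModType d1 R) (J : finType) (Z : measurableType d2).
Variables (l : J -> V -> R) (mu : {sigma_finite_measure set V -> \bar R}).
Variables (nu : {sigma_finite_measure set Z -> \bar R}).
Hypothesis ls : lebesgue_space l mu.

Lemma csqloc_mulNi (f : V * Z -> R[i]) : csqloc l mu nu f ->
  csqloc l mu nu (fun p => - 'i%C * f p).
Proof.
move=> [sr si]; split.
  by move: si; congr sqloc; apply/funext => p; rewrite /re Re_mulNi.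
by move/sqlocN: sr; congr sqloc; apply/funext => p; rewrite /im Im_mulNi.
Qed.

Lemma ckerp_mulNi (f g : V * Z -> R[i]) : csqloc l mu nu f -> csqloc l mu nu g ->
  {ae (mu \x mu)%E, forall p,
    ckerp nu (fun p => - 'i%C * f p) g p = - 'i%C * ckerp nu f g p} /\
  {ae mu, forall x, ckerp nu (fun p => - 'i%C * f p) g (x, x) = - 'i%C * ckerp nu f g (x, x)}.
Proof.
move=> sf sg; have [[mrf _] [mif _]] := sf; have [[mrg _] [mig _]] := sg.
have af := csqloc_sec sf; have ag := csqloc_sec sg.
have key x y : csec nu f x -> csec nu g y ->
    ckerp nu (fun p => - 'i%C * f p) g (x, y) = - 'i%C * ckerp nu f g (x, y).
  move=> fx gy; have [ic _ _] := ckerp_enc mrf mif mrg mig fx gy.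
  by rewrite -(cint_mulNi ic).2; congr cint; apply/funext => z; rewrite mulrA.
split.
  have a1 := ae_prodx (mu := mu) mu af; have a2 := ae_prody mu (nu := mu) ag.
  by apply: filterS2 a1 a2 => -[x y] /= fx gy; exact: key.
by apply: filterS2 af ag => x fx gx; exact: key.
Qed.

Lemma in_L2_of_csqloc (f : V * Z -> R[i]) K : csqloc l mu nu f -> compact K ->
  in_L2 (mu \x nu)%E (K `*` setT) f.
Proof.
move=> [[mr sr] [mi si]] cK.
have [n Kn] := bounded_in_ccube (ls_coordinates ls) cK.
have mK := ls_compact ls cK; have mKT : measurable (K `*` (setT : set Z)) by exact: measurableX.
split; [exact: measurable_funTS|exact: measurable_funTS|].
rewrite integral_mkcond.
have [m1 f1] := sr n; have [m2 f2] := si n.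
apply: (@le_lt_trans _ _ (\int[(mu \x nu)%E]_p
    ((cut (ccube l n%:R) (re f) p ^+ 2)%:E + (cut (ccube l n%:R) (im f) p ^+ 2)%:E))%E).
  apply: ge0_le_integral => //.
  - by move=> p _; rewrite patchE; case: ifP => // _; rewrite lee_fin sqr_ge0.
  - apply/(measurable_restrictT _ mKT)/measurable_funTS/measurable_EFinP.
    under [X in measurable_fun _ X]eq_fun do rewrite sqr_normc.
    by apply: measurable_funD; exact: measurable_funX.
  - by apply: emeasurable_funD; apply/measurable_EFinP; exact: measurable_funX.
  move=> p _; rewrite patchE; case: ifPn => [/set_mem[Kp _]|_]; last first.
    by rewrite -EFinD lee_fin addr_ge0 ?sqr_ge0.
  by rewrite /cut indicE mem_set ?mul1r -?EFinD ?lee_fin ?sqr_normc//; exact: Kn.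
rewrite ge0_integralD//.
- exact: lte_add_pinfty.
- by move=> p _; rewrite lee_fin sqr_ge0.
- by apply/measurable_EFinP; exact: measurable_funX.
- by move=> p _; rewrite lee_fin sqr_ge0.
- by apply/measurable_EFinP; exact: measurable_funX.
Qed.

End minus_i.

Lemma normc_le_parts (R : realType) (z : R[i]) :
  Normc.normc z <= `|complex.Re z| + `|complex.Im z|.
Proof.
case: z => a b /=; rewrite -[leRHS]ger0_norm ?addr_ge0// -sqrtr_sqr.
rewrite ler_wsqrtr// sqrrD !real_normK ?num_real// -addrA lerD2l.
by rewrite lerDr mulrn_wge0// mulr_ge0.
Qed.

(** * Sums over the ensemble as integrals *)

Section countable_mixture.
Context d (Y : measurableType d) (R : realType).
Variable nu : {sigma_finite_measure set Y -> \bar R}.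

(* Nothing relates [h] to [k i] when [p i = 0]: there the derivative of the state
   is unconstrained. *)
Lemma csum_famm (N : nat) (p : nat -> R) (h : nat * Y -> R[i]) (k : nat -> Y -> R[i]) :
  (0 < N)%N -> (forall i, 0 <= p i) -> cintegrable (famm nu) setT h ->
  (forall i, 0 < p i -> measurable_fun setT (re (k i)) /\ measurable_fun setT (im (k i))) ->
  (forall i, 0 < p i -> {ae nu, forall y, h (i, y) = (N%:R * p i)%:C%C * k i y}) ->
  (forall i y, p i = 0 -> h (i, y) = 0) ->
  [/\ forall i, 0 < p i -> cintegrable nu setT (k i),
      cvgn (series (fun i => Normc.normc ((p i)%:C%C * cint nu setT (k i)))) &
      N%:R * csum (fun i => (p i)%:C%C * cint nu setT (k i)) = cint (famm nu) setT h].
Proof.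
move=> N0 p0 [ihr ihi] mk hk h0.
have [jr ar cr er] := integrable_famm ihr; have [ji ai ci ei] := integrable_famm ihi.
have NR : (N%:R : R) != 0 by rewrite pnatr_eq0 -lt0n.
have key (P : R[i] -> R) : (forall (c : R) z, P (c%:C%C * z) = c * P z) -> P 0 = 0 ->
    (forall i, 0 < p i -> measurable_fun setT (fun y => P (k i y))) ->
    (forall i, nu.-integrable setT (fun y => (P (h (i, y)))%:E)) ->
    (forall i, 0 < p i -> nu.-integrable setT (fun y => (P (k i y))%:E)) /\
    (forall i, \int[nu]_y P (h (i, y)) = N%:R * (p i * \int[nu]_y P (k i y))).
  move=> Pc P0 mP ih.
  (* For a positive weight the factor N p_i is invertible, and integrability passes from [h] to
     [k i]. *)
  have e i : 0 < p i -> {ae nu, forall y, P (k i y) = (N%:R * p i)^-1 * P (h (i, y))}.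
    move=> pi; apply: filterS (hk i pi) => y ->; rewrite Pc mulrA mulVf ?mul1r//.
    by rewrite mulf_neq0// gt_eqF.
  have ik i : 0 < p i -> nu.-integrable setT (fun y => (P (k i y))%:E).
    move=> pi; apply: (ae_integrable (mu := nu)
      (f := fun y => (N%:R * p i)^-1 * P (h (i, y)))); first exact: mP.
      by apply: filterS (e i pi) => y ->.
    by have := integrableZl measurableT (N%:R * p i)^-1 (ih i); congr integrable.
  split=> // i; have [pi|] := ltP 0 (p i); last first.
    move=> pi; have {}pi : p i = 0 by apply/eqP; rewrite eq_le pi p0.
    rewrite pi mul0r mulr0; under eq_Rintegral do rewrite h0// P0.
    by rewrite /Rintegral integral0.
  rewrite mulrA -RintegralZl//; last exact: ik.
  have mh : measurable_fun setT (fun y => P (h (i, y))).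
    by have /measurable_int/measurable_EFinP := ih i.
  apply: ae_eq_Rintegral => //; first by apply: measurable_funM => //; exact: mP.
  by apply: filterS (hk i pi) => y ->; rewrite Pc.
have Rec (c : R) z : complex.Re (c%:C%C * z) = c * complex.Re z.
  by rewrite Re_mul /= mul0r subr0.
have Imc (c : R) z : complex.Im (c%:C%C * z) = c * complex.Im z.
  by rewrite Im_mul /= mul0r addr0.
have [ikr Er] := key _ Rec erefl (fun i pi => (mk i pi).1) jr.
have [iki Ei] := key _ Imc erefl (fun i pi => (mk i pi).2) ji.
have scale (u v : nat -> R) : (forall i, v i = N%:R * u i) -> u = N%:R^-1 *: v.
  by move=> uv; apply/funext => i; rewrite !fctE uv /GRing.scale/= mulrA mulVf// mul1r.
have sr := scale _ _ Er; have si := scale _ _ Ei.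
split.
- by move=> i pi; split; [exact: ikr|exact: iki].
- pose b i := `|p i * \int[nu]_y complex.Re (k i y)| + `|p i * \int[nu]_y complex.Im (k i y)|.
  apply: (@series_le_cvg _ _ b).
  + by move=> i; case: (_ * _) => x y; exact: sqrtr_ge0.
  + by move=> i; rewrite addr_ge0.
  + by move=> i; apply: le_trans (normc_le_parts _) _; rewrite Rec Imc.
  rewrite (_ : b = (N%:R^-1 *: (fun i => `|\int[nu]_y complex.Re (h (i, y))|)) +
     (N%:R^-1 *: (fun i => `|\int[nu]_y complex.Im (h (i, y))|))).
    rewrite seriesD; exact: (is_cvgD (is_cvg_seriesZ ar) (is_cvg_seriesZ ai)).
  have a0 (x : R) : `|x| = N%:R^-1 * `|N%:R * x|.
    by rewrite normrM normr_nat mulrA mulVf// mul1r.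
  by apply/funext => i; rewrite /b !fctE /GRing.scale/= Er Ei; congr (_ + _); exact: a0.
have NC (z : R[i]) : N%:R * z = (N%:R : R)%:C%C * z by rewrite rmorph_nat.
have Re_csum u : complex.Re (csum u) = limn (series (fun i => complex.Re (u i : R[i]))) by [].
have Im_csum u : complex.Im (csum u) = limn (series (fun i => complex.Im (u i : R[i]))) by [].
rewrite NC; apply: complex_eq; rewrite ?Rec ?Imc ?Re_csum ?Im_csum.
  rewrite [X in series X](_ : _ = (fun i => p i * \int[nu]_y complex.Re (k i y))); last first.
    by apply/funext => i; rewrite Rec.
  by rewrite sr (lim_seriesZ _ cr) /GRing.scale/= mulrA divff// mul1r er.
rewrite [X in series X](_ : _ = (fun i => p i * \int[nu]_y complex.Im (k i y))); last first.
  by apply/funext => i; rewrite Imc.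
by rewrite si (lim_seriesZ _ ci) /GRing.scale/= mulrA divff// mul1r ei.
Qed.

End countable_mixture.

(** * The two factorizations of the density matrix *)

Section factor.
Context {R : realType}.
Local Notation R3 := 'rV[R]_3.
Local Notation mu := (@leb_rV R 3).
Let ls3 := @lebesgue_space_rV R 3.
Variables (G : R3 * R3 -> R[i]) (dG : 'I_3 -> R3 * R3 -> R[i]).

(** Applied to [G] this is the kernel H, with the differentiated variable in first position. *)
Definition adj (A : R3 * R3 -> R[i]) (p : R3 * R3) : R[i] := (A (p.2, p.1))^*%C.

Lemma kmul_ckerp (A B : R3 * R3 -> R[i]) q :
  kmul mu setT (kadj A) B q = ckerp mu (adj A) (adj B) q.
Proof. by congr cint; apply/funext => z; rewrite /adj /kadj /= conjcK. Qed.

(** [wder_rweak] for the real and imaginary parts of [G]; conjugation changes the sign of the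
    latter, whence the scaling by -1. *)
Lemma crweak_adj k : weak_grad2 G dG ->
  crweak mu (delta_mx 0 k : R3) mu (adj G) (adj (dG k)).
Proof.
move=> /(_ k); have lsP := lebesgue_space_pair ls3 ls3.
move=> /(weak_deriveP lsP)[[lr li] [ldr ldi] [wr wi]].
split.
  have := wder_rweak ls3 ls3 lr ldr wr; congr rweak; apply/funext => p.
    by rewrite /re /adj Re_conjc.
  by rewrite /re /adj Re_conjc.
have lN := locintZ (-1) lsP li; have ldN := locintZ (-1) lsP ldi.
have := wder_rweak ls3 ls3 lN ldN (wderZ (-1) lsP li ldi wi).
congr rweak; apply/funext => p; by rewrite /im /adj Im_conjc mulN1r.
Qed.

End factor.

Section state.
Context {R : realType} (n : nat) (p : nat -> R) (Psi : nat -> 'M[R]_(n.+1, 3) -> R[i]).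
Hypothesis st : mixed_state p Psi.
Local Notation R3 := 'rV[R]_3.
Local Notation mu := (@leb_rV R 3).
Local Notation nu := (@leb_mx R n 3).
Local Notation M1 := 'M[R]_(n.+1, 3).
Let ls3 := @lebesgue_space_rV R 3.

Definition wt i : R := Num.sqrt (n.+1%:R * p i).

(** The kernel F, where N is [n.+1]: the index of the ensemble is part of the inner variable, and a
    state of weight 0 gives the zero component. *)
Definition wstate (q : R3 * (nat * 'M[R]_(n, 3))) : R[i] :=
  (wt q.2.1)%:C%C * Psi q.2.1 (mx_cons (q.1, q.2.2)).

Lemma wt2 i : wt i * wt i = n.+1%:R * p i.
Proof. by rewrite -expr2 sqr_sqrtr// mulr_ge0//; exact: weight_ge0 st i. Qed.

Lemma wt_gt0 i : 0 < p i -> 0 < wt i.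
Proof. by move=> pi; rewrite sqrtr_gt0 mulr_gt0. Qed.

Lemma Re_real (c : R) z : complex.Re (c%:C%C * z) = c * complex.Re z.
Proof. by rewrite Re_mul /= mul0r subr0. Qed.

Lemma Im_real (c : R) z : complex.Im (c%:C%C * z) = c * complex.Im z.
Proof. by rewrite Im_mul /= mul0r addr0. Qed.

Lemma realM_conj (a b : R) (z w : R[i]) :
  (a%:C%C * z) * (b%:C%C * w)^*%C = (a * b)%:C%C * (z * w^*%C).
Proof.
by case: z => x y; case: w => u v; apply: complex_eq => /=; ring.
Qed.

Lemma state_csq i : csq (leb_mx n.+1 3) (Psi i).
Proof. by apply/in_L2_csq; exact: state_L2 st i. Qed.

Lemma state_csq_cons i : csq (mu \x nu)%E (fun q => Psi i (mx_cons q)).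
Proof.
have [sr si] := state_csq i.
split; [exact/(sqint_mx_cons (sqint_measurable sr))|exact/(sqint_mx_cons (sqint_measurable si))].
Qed.

Lemma rip_state i : rip (mu \x nu)%E (fun q => re (Psi i) (mx_cons q)) (fun q => re (Psi i) (mx_cons q)) +
  rip (mu \x nu)%E (fun q => im (Psi i) (mx_cons q)) (fun q => im (Psi i) (mx_cons q)) = 1.
Proof.
have [[mr _] [mi _]] := state_csq i.
transitivity (complex.Re (1 : R[i])); last by [].
rewrite -(state_norm st i) (Re_ip (state_L2 st i) (state_L2 st i)).
have er := Rintegral_mx_cons (measurable_funM mr mr).
have ei := Rintegral_mx_cons (measurable_funM mi mi).
by congr (_ + _); symmetry; [exact: er|exact: ei].
Qed.

Lemma sum_weights m : \sum_(0 <= i < m) p i <= 1.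
Proof.
have nd : nondecreasing_seq (series p).
  by apply/nondecreasing_seqP => k; rewrite seriesSr lerDl; exact: weight_ge0 st k.
have c := weight_sum st; have := nondecreasing_cvgn_le nd (cvgP _ c) m.
by rewrite (cvg_lim _ c).
Qed.

(** The squared norms of the components add up to at most N, since the states are normalised and
    partial sums of the weights are at most 1. *)
Lemma csq_wstate : csq (mu \x famm nu)%E wstate.
Proof.
have key (P : R[i] -> R) : (forall (c : R) z, P (c%:C%C * z) = c * P z) ->
    (forall i, sqint (mu \x nu)%E (fun q => P (Psi i (mx_cons q)))) ->
    (forall i, rip (mu \x nu)%E (fun q => P (Psi i (mx_cons q))) (fun q => P (Psi i (mx_cons q))) <= 1) ->
    sqint (mu \x famm nu)%E (fun q => P (wstate q)).
  move=> Pc sP P1.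
  have sZ i := sqintZ (wt i) (sP i).
  have := @sqint_unfam _ _ _ _ R mu nu (fun i q => wt i * P (Psi i (mx_cons q))) n.+1%:R sZ.
  move=> /(_ _)/wrap[m|].
    apply: (@le_trans _ _ (\sum_(0 <= i < m) n.+1%:R * p i)).
      apply: ler_sum => i _.
      rewrite (ripZl _ (sP i) (sZ i)) (ripC _ _ (fun q => wt i * _)) (ripZl _ (sP i) (sP i)).
      by rewrite mulrA wt2 ler_piMr// mulr_ge0//; exact: weight_ge0 st i.
    by rewrite -big_distrr/= ler_piMr// sum_weights.
  by congr sqint; apply/funext => q; rewrite /unfam /wstate Pc.
split; apply: key => [c z|i|i]; [exact: Re_real|exact: (state_csq_cons i).1| |
  exact: Im_real|exact: (state_csq_cons i).2|].
  by rewrite -(rip_state i) lerDl rip_ge0.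
by rewrite -(rip_state i) lerDr rip_ge0.
Qed.

Lemma measurable_sec_cons (f : M1 -> R) r : measurable_fun setT f ->
  measurable_fun setT (fun x => f (mx_cons (r, x))).
Proof. by move=> mf; exact: (measurable_secy r (measurable_comp_cons mf)). Qed.

Lemma measurable_prod_parts d (T : measurableType d) (f g : T -> R[i]) :
  measurable_fun setT (re f) -> measurable_fun setT (im f) ->
  measurable_fun setT (re g) -> measurable_fun setT (im g) ->
  measurable_fun setT (re (fun t => f t * (g t)^*%C)) /\
  measurable_fun setT (im (fun t => f t * (g t)^*%C)).
Proof.
move=> m1 m2 m3 m4; split.
  rewrite (_ : re _ = (fun t => re f t * re g t + im f t * im g t)).
    by apply: measurable_funD; exact: measurable_funM.
  by apply/funext => t; rewrite /re Re_mul Re_conjc Im_conjc mulrN opprK.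
rewrite (_ : im _ = (fun t => im f t * re g t - re f t * im g t)).
  by apply: measurable_funB; exact: measurable_funM.
by apply/funext => t; rewrite /im Im_mul Re_conjc Im_conjc mulrN addrC.
Qed.

Lemma rdm_ckerp : {ae (mu \x mu)%E, forall q,
  rdm p Psi q = ckerp (famm nu) wstate wstate q}.
Proof.
have lF := csq_csqloc ls3 csq_wstate.
have [[mr _] [mi _]] := lF; have aF := csqloc_sec lF.
have a1 := ae_prodx (mu := mu) mu aF; have a2 := ae_prody mu (nu := mu) aF.
apply: filterS2 a1 a2 => -[r s] /= Fr Fs.
have [ic _ _] := ckerp_enc mr mi mr mi Fr Fs.
have [||| _ _ e] := @csum_famm _ _ R nu n.+1 p _
  (fun i x => Psi i (col_mx r x) * (Psi i (col_mx s x))^*%C) isT (weight_ge0 st) ic; last exact: e.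
- move=> i _; have [[mpr _] [mpi _]] := state_csq i.
  exact: (measurable_prod_parts (f := fun x => Psi i (mx_cons (r, x)))
    (g := fun x => Psi i (mx_cons (s, x)))
    (measurable_sec_cons r mpr) (measurable_sec_cons r mpi)
    (measurable_sec_cons s mpr) (measurable_sec_cons s mpi)).
- by move=> i _; apply: nearW => y; rewrite /wstate /= realM_conj wt2.
- by move=> i y pi; rewrite /wstate /wt /= pi mulr0 sqrtr0 mul0r mul0r.
Qed.

(** [csum_famm] applied on the diagonal. The gradients [dPsi] are an arbitrary choice of
    representatives, so [r] is restricted to the slices on which they agree with [dF] almost
    everywhere, for all states of positive weight at once. *)
Lemma momentum_density_ckerp (dPsi : nat -> 'I_3 -> M1 -> R[i]) k
    (dF : R3 * (nat * 'M[R]_(n, 3)) -> R[i]) :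
  csqloc (@entry R 1 3) mu (famm nu) dF ->
  (forall i, 0 < p i -> measurable_fun setT (re (dPsi i k)) /\
    measurable_fun setT (im (dPsi i k))) ->
  (forall i, 0 < p i -> {ae (mu \x nu)%E, forall q,
    dF (q.1, (i, q.2)) = (wt i)%:C%C * dPsi i k (mx_cons q)}) ->
  {ae mu, forall r,
    [/\ forall i, 0 < p i -> cintegrable nu setT (momentum_integrand Psi dPsi i k r),
      cvgn (series (fun i => Normc.normc (momentum_term p Psi dPsi i k r))) &
      momentum_density p Psi dPsi k r =
      ckerp (famm nu) (fun q => - 'i%C * dF q) wstate (r, r)]}.
Proof.
move=> sdF md dFd; have lF := csq_csqloc ls3 csq_wstate.
have [[mr _] [mi _]] := lF; have aF := csqloc_sec lF.
have sdN := csqloc_mulNi sdF; have [[mdr _] [mdi _]] := sdN; have adN := csqloc_sec sdN.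
have ad : {ae mu, forall r, forall i, 0 < p i -> {ae nu, forall x,
    dF (r, (i, x)) = (wt i)%:C%C * dPsi i k (mx_cons (r, x))}}.
  apply: ae_foralln => i; have [pi|] := ltP 0 (p i); last by move=> _; apply: nearW.
  by apply: filterS (ae_secy (dFd i pi)) => r H _.
apply: filterS3 aF adN ad => r Fr dFr dr.
have [ic _ _] := ckerp_enc mdr mdi mr mi dFr Fr.
have [||| i1 i2 i3] := @csum_famm _ _ R nu n.+1 p _
  (fun i => momentum_integrand Psi dPsi i k r) isT (weight_ge0 st) ic; last by split.
- move=> i pi; have [[mpr _] [mpi _]] := state_csq i; have [mdpr mdpi] := md i pi.
  apply: (measurable_prod_parts (f := fun x => - 'i%C * dPsi i k (mx_cons (r, x)))
    (g := fun x => Psi i (mx_cons (r, x)))).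
  + rewrite (_ : re _ = (fun x => im (dPsi i k) (mx_cons (r, x)))).
      exact: measurable_sec_cons r mdpi.
    by apply/funext => x; rewrite /re Re_mulNi.
  + rewrite (_ : im _ = (fun x => - re (dPsi i k) (mx_cons (r, x)))).
      exact: measurableT_comp (measurable_sec_cons r mdpr).
    by apply/funext => x; rewrite /im Im_mulNi.
  + exact: measurable_sec_cons r mpr.
  + exact: measurable_sec_cons r mpi.
- move=> i pi; apply: filterS (dr i pi) => x ->; rewrite /wstate /=.
  by rewrite mulrCA realM_conj wt2.
- by move=> i y pi; rewrite /wstate /wt /= pi mulr0 sqrtr0 mul0r conjc0 mulr0.
Qed.

(** Local integrability concerns the density as defined at every [r], including points where its
    series diverges; there [measurable_fun_limn] still applies. *)
Lemma measurable_momentum_density (dPsi : nat -> 'I_3 -> M1 -> R[i]) k :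
  (forall i, 0 < p i -> measurable_fun setT (re (dPsi i k)) /\
    measurable_fun setT (im (dPsi i k))) ->
  measurable_fun setT (re (momentum_density p Psi dPsi k)) /\
  measurable_fun setT (im (momentum_density p Psi dPsi k)).
Proof.
move=> md.
have mt i : measurable_fun setT (re (momentum_term p Psi dPsi i k)) /\
    measurable_fun setT (im (momentum_term p Psi dPsi i k)).
  have [pi|] := ltP 0 (p i); last first.
    move=> pi; have {}pi : p i = 0 by apply/eqP; rewrite eq_le pi (weight_ge0 st).
    rewrite (_ : momentum_term _ _ _ _ _ = fun=> 0); first by split; exact: measurable_cst.
    by apply/funext => r; rewrite /momentum_term pi mul0r.
  have [[mpr _] [mpi _]] := state_csq i; have [mdpr mdpi] := md i pi.
  have [m1 m2] : measurable_fun setT (re (fun q : R3 * 'M[R]_(n, 3) =>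
      (- 'i%C * dPsi i k (mx_cons q)) * (Psi i (mx_cons q))^*%C)) /\
      measurable_fun setT (im (fun q : R3 * 'M[R]_(n, 3) =>
      (- 'i%C * dPsi i k (mx_cons q)) * (Psi i (mx_cons q))^*%C)).
    apply: (measurable_prod_parts (f := fun q : R3 * 'M[R]_(n, 3) => - 'i%C * dPsi i k (mx_cons q))
      (g := fun q => Psi i (mx_cons q))).
    + rewrite (_ : re _ = (fun q => im (dPsi i k) (mx_cons q))).
        exact: measurable_comp_cons mdpi.
      by apply/funext => x; rewrite /re Re_mulNi.
    + rewrite (_ : im _ = (fun q => - re (dPsi i k) (mx_cons q))).
        exact: measurableT_comp (measurable_comp_cons mdpr).
      by apply/funext => x; rewrite /im Im_mulNi.
    + exact: measurable_comp_cons mpr.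
    + exact: measurable_comp_cons mpi.
  split.
    rewrite (_ : re _ = (fun r => p i * \int[nu]_x re (momentum_integrand Psi dPsi i k r) x)).
      by apply: measurable_funM => //; exact: (measurable_inty nu m1).
    by apply/funext => r; rewrite /re /momentum_term Re_real.
  rewrite (_ : im _ = (fun r => p i * \int[nu]_x im (momentum_integrand Psi dPsi i k r) x)).
    by apply: measurable_funM => //; exact: (measurable_inty nu m2).
  by apply/funext => r; rewrite /im /momentum_term Im_real.
have NC (z : R[i]) : n.+1%:R * z = (n.+1%:R : R)%:C%C * z by rewrite rmorph_nat.
split.
  rewrite (_ : re _ = (fun r => n.+1%:R * limn (series (fun i => re (momentum_term p Psi dPsi i k) r)))).
    apply: measurable_funM => //.
    apply: (measurable_fun_limn (h := fun m r => series (fun i => re (momentum_term p Psi dPsi i k) r) m)) => m.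
    by apply: measurable_sum => i; exact: (mt i).1.
  by apply/funext => r; rewrite /re /momentum_density NC Re_real.
rewrite (_ : im _ = (fun r => n.+1%:R * limn (series (fun i => im (momentum_term p Psi dPsi i k) r)))).
  apply: measurable_funM => //.
  apply: (measurable_fun_limn (h := fun m r => series (fun i => im (momentum_term p Psi dPsi i k) r) m)) => m.
  by apply: measurable_sum => i; exact: (mt i).2.
by apply/funext => r; rewrite /im /momentum_density NC Im_real.
Qed.

(** The gradient of a single state, read off from F by removing its weight; for weight 0 the inverse
    is 0 by convention. *)
Definition dstate (dF : R3 * (nat * 'M[R]_(n, 3)) -> R[i]) i (x : M1) : R[i] :=
  ((wt i)^-1)%:C%C * dF ((mx_uncons x).1, (i, (mx_uncons x).2)).

Lemma weak_derive_dstate dF k i : 0 < p i ->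
  csqloc (@entry R 1 3) mu (famm nu) dF ->
  crweak mu (delta_mx 0 k : R3) (famm nu) wstate dF ->
  weak_derive (leb_mx n.+1 3) (delta_mx 0 k : M1) (Psi i) (dstate dF i).
Proof.
move=> pi sdF [wr wi]; have w0 := wt_gt0 pi.
have wn0 : wt i != 0 by rewrite gt_eqF.
have lsM := @lebesgue_space_mx R n.+1 3; have lsn := @lebesgue_space_mx R n 3.
have lsP := lebesgue_space_pair ls3 lsn.
have sP := state_csq_cons i.
have key (P : R[i] -> R) : (forall (c : R) z, P (c%:C%C * z) = c * P z) ->
    measurable_fun setT (fun x => P (Psi i x)) ->
    sqint (mu \x nu)%E (fun q => P (Psi i (mx_cons q))) ->
    sqloc (@entry R 1 3) mu (famm nu) (fun q => P (dF q)) ->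
    rweak mu (delta_mx 0 k : R3) (famm nu) (fun q => P (wstate q)) (fun q => P (dF q)) ->
    [/\ locint (@entry R n.+1 3) (leb_mx n.+1 3) (fun x => P (Psi i x)),
        locint (@entry R n.+1 3) (leb_mx n.+1 3) (fun x => P (dstate dF i x)) &
        wder (leb_mx n.+1 3) (delta_mx 0 k : M1) (fun x => P (Psi i x)) (fun x => P (dstate dF i x))].
  move=> Pc mP sqP [mdF sdF'] Pw.
  have ldF : locint (pair_coord (@entry R 1 3) (@entry R n 3)) (mu \x nu)%E
      (fun q => P (dF (q.1, (i, q.2)))).
    apply: (sqloc_locint ls3 lsn); split; first exact: measurable_component mdF.
    by move=> m; exact: (sqint_component i (sdF' m)).
  have lP : locint (pair_coord (@entry R 1 3) (@entry R n 3)) (mu \x nu)%E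
      (fun q => P (Psi i (mx_cons q))).
    by have := sqloc_locint ls3 lsn (sqint_sqloc ls3 sqP).
  have lwP := locintZ (wt i) lsP lP.
  have wP : rweak mu (delta_mx 0 k : R3) nu (fun q => wt i * P (Psi i (mx_cons q)))
      (fun q => P (dF (q.1, (i, q.2)))).
    move=> phi tp; have := (ae_famm nu _).1 (Pw phi tp) i; apply: filterS => x <-.
    by apply: eq_Rintegral => r _; rewrite /wstate /= Pc.
  have wp := wderZ (wt i)^-1 lsP lwP ldF (rweak_wder ls3 lsn lwP ldF wP).
  have lD := locintZ (wt i)^-1 lsP ldF.
  have eP : (fun q => (wt i)^-1 * (wt i * P (Psi i (mx_cons q)))) =
      (fun q => P (Psi i (mx_cons q))).
    by apply/funext => q; rewrite mulrA mulVf// mul1r.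
  have eD : (fun q : R3 * 'M[R]_(n, 3) => (wt i)^-1 * P (dF (q.1, (i, q.2)))) =
      (fun q => P (dstate dF i (mx_cons q))).
    by apply/funext => q; rewrite /dstate mx_consK Pc.
  rewrite eP eD in wp; rewrite eD in lD.
  have mD : measurable_fun setT (fun x => P (dstate dF i x)).
    have := measurableT_comp lD.1 (@measurable_mx_uncons R n 3).
    by congr measurable_fun; apply/funext => x /=; rewrite mx_unconsK.
  split; [exact/(locint_mx_cons mP)|exact/(locint_mx_cons mD)|].
  exact: wder_mx_cons mP mD wp.
have [[mr _] [mi _]] := state_csq i.
have [lr ldr wdr] := key _ Re_real mr sP.1 sdF.1 wr.
have [li ldi wdi] := key _ Im_real mi sP.2 sdF.2 wi.
have [_ H] := weak_deriveP lsM (delta_mx 0 k : M1) (Psi i) (dstate dF i).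
apply: H; exact: (And3 (conj lr li) (conj ldr ldi) (conj wdr wdi)).
Qed.

End state.

(** * The formula for the momentum density *)

Theorem mainTheorem4 (R : realType) (n : nat)
    (D : 'rV[R]_3 * 'rV[R]_3 -> R[i])
    (G : 'rV[R]_3 * 'rV[R]_3 -> R[i])
    (dG : 'I_3 -> 'rV[R]_3 * 'rV[R]_3 -> R[i])
    (p : nat -> R) (Psi : nat -> 'M[R]_(n.+1, 3) -> R[i]) :
  rdm1 n.+1 D ->
  loc_finite_kinetic D ->
  in_L2 (leb_rV 3 \x leb_rV 3)%E setT G ->
  {ae (leb_rV 3 \x leb_rV 3)%E, forall q,
     D q = kmul (leb_rV 3) setT (kadj G) G q} ->
  weak_grad2 G dG ->
  (forall k (K : set 'rV[R]_3), compact K ->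
     in_L2 (leb_rV 3 \x leb_rV 3)%E (setT `*` K) (dG k)) ->
  mixed_state p Psi ->
  {ae (leb_rV 3 \x leb_rV 3)%E, forall q, rdm p Psi q = D q} ->
  [/\ exists dPsi, weak_grad_state p Psi dPsi,
      exists dD, weak_grad1 D dD &
      forall dPsi dD, weak_grad_state p Psi dPsi -> weak_grad1 D dD ->
        [/\ momentum_density_defined p Psi dPsi,
            forall k, in_L1loc (leb_rV 3) (momentum_density p Psi dPsi k),
            forall k, {ae leb_rV 3, forall r,
              momentum_density p Psi dPsi k r =
              - 'i%C * kmul (leb_rV 3) setT (kadj (dG k)) G (r, r)} &
            forall k, is_diag (fun q => - 'i%C * dD k q)
              (momentum_density p Psi dPsi k)]].
Proof.
move=> rD _ sG DG wG sdG st rdmD.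
pose mu := @leb_rV R 3; pose nu := @leb_mx R n 3.
have ls3 := @lebesgue_space_rV R 3; have lsP := lebesgue_space_pair ls3 ls3.
have lsM := @lebesgue_space_mx R n.+1 3.
pose H := adj G; pose dH k := adj (dG k); pose F := wstate p Psi.
have cH : csq (mu \x mu)%E H := csq_swap ((in_L2_csq _ _).1 sG).
have lH := csq_csqloc ls3 cH.
have ldH k : csqloc (@entry R 1 3) mu mu (dH k) := csqloc_of_in_L2_swap ls3 (sdG k).
have wH k : crweak mu (delta_mx 0 k : 'rV[R]_3) mu H (dH k) := crweak_adj k wG.
(* The basis in which the trace of [D] is computed gives the frame used throughout. *)
have [h hF] : exists h, frame mu h.
  by have [e [/frame_of_onb he _ _]] := rdm1_trace rD; eexists; exact: he.
have cF : csq (mu \x famm nu)%E F := csq_wstate st.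
have lF := csq_csqloc ls3 cF.
have DH : {ae (mu \x mu)%E, forall q, D q = ckerp mu H H q}.
  by apply: filterS DG => q; rewrite kmul_ckerp.
have DF : {ae (mu \x mu)%E, forall q, D q = ckerp (famm nu) F F q}.
  by apply: filterS2 rdmD (rdm_ckerp st) => q <-.
have HF : {ae (mu \x mu)%E, forall q, ckerp mu H H q = ckerp (famm nu) F F q}.
  by apply: filterS2 DH DF => q <-.
have /choice[dF HdF] : forall k, exists dF, csqloc (@entry R 1 3) mu (famm nu) dF /\
    crweak mu (delta_mx 0 k : 'rV[R]_3) (famm nu) F dF.
  move=> k; have [dF ldF wdF] := exists_crweak ls3 hF cH (ldH k) (wH k) cF HF.
  by exists dF.
have ldF k := (HdF k).1; have wF k := (HdF k).2.
have kH k := cwder_ckerp ls3 cH (ldH k) (wH k) cH.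
have kF k := cwder_ckerp ls3 cF (ldF k) (wF k) cF.
have [mDr mDi _] := rdm1_L2 rD.
have lD : clocint (pair_coord (@entry R 1 3) (@entry R 1 3)) (mu \x mu)%E D.
  have [l0 _ _] := kH 0; apply: (clocint_ae lsP mDr mDi _ l0).
  by apply: filterS DH => q ->.
have wDH k : cwder (mu \x mu)%E (delta_mx 0 k : 'rV[R]_3, 0 : 'rV[R]_3) D (ckerp mu (dH k) H).
  have [l1 l2 w] := kH k; apply: (cwder_ae lsP l1 lD l2 l2 _ _ w).
    by apply: filterS DH => q ->.
  exact: nearW.
have wDF k : cwder (mu \x mu)%E (delta_mx 0 k : 'rV[R]_3, 0 : 'rV[R]_3) D (ckerp (famm nu) (dF k) F).
  have [l1 l2 w] := kF k; apply: (cwder_ae lsP l1 lD l2 l2 _ _ w).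
    by apply: filterS DF => q ->.
  exact: nearW.
have dHF k : {ae (mu \x mu)%E, forall q, ckerp mu (dH k) H q = ckerp (famm nu) (dF k) F q}.
  have [_ l1 _] := kH k; have [_ l2 _] := kF k.
  by have := cwder_unique lsP l1 l2 (wDH k) (wDF k).
have wP i k (pi : 0 < p i) := weak_derive_dstate st pi (ldF k) (wF k).
split.
- by exists (fun i k => dstate p (dF k) i) => i pi k; exact: wP.
- exists (fun k => ckerp mu (dH k) H) => k; have [_ l2 _] := kH k.
  have [_ c] := weak_deriveP lsP (delta_mx 0 k : 'rV[R]_3, 0 : 'rV[R]_3) D (ckerp mu (dH k) H).
  by apply: c; split.
move=> dPsi dD wPsi wdD.
have mP k i : 0 < p i -> measurable_fun setT (re (dPsi i k)) /\
    measurable_fun setT (im (dPsi i k)).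
  by move=> pi; have [_ /(in_L1locP lsM)[[? _] [? _]] _] := wPsi i pi k.
(* Weak gradients of a state are unique up to null sets, so a given [dPsi] agrees with the
   transferred gradient after its weight is restored. *)
have PdF k i : 0 < p i -> {ae (mu \x nu)%E, forall q,
    dF k (q.1, (i, q.2)) = (wt n p i)%:C%C * dPsi i k (mx_cons q)}.
  move=> pi; have /(weak_deriveP lsM)[_ l1 w1] := wPsi i pi k.
  have /(weak_deriveP lsM)[_ l2 w2] := wP i k pi.
  have := ae_mx_cons (cwder_unique lsM l1 l2 w1 w2); apply: filterS => q ->.
  rewrite /dstate mx_consK mulrA -rmorphM/= divff ?rmorph1 ?mul1r; first by case: q.
  by rewrite gt_eqF//; exact: wt_gt0.
have mom k := momentum_density_ckerp st (ldF k) (mP k) (PdF k).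
have [mdr mdi] : (forall k, measurable_fun setT (re (momentum_density p Psi dPsi k))) /\
    (forall k, measurable_fun setT (im (momentum_density p Psi dPsi k))).
  by split=> k; have [] := measurable_momentum_density st (mP k).
have ldN k := csqloc_mulNi (ldF k).
have dDH k : {ae (mu \x mu)%E, forall q, dD k q = ckerp mu (dH k) H q}.
  have /(weak_deriveP lsP)[_ l1 w1] := wdD k; have [_ l2 _] := kH k.
  by have := cwder_unique lsP l1 l2 w1 (wDH k).
have dDF k : {ae (mu \x mu)%E, forall q,
    - 'i%C * dD k q = ckerp (famm nu) (fun q => - 'i%C * dF k q) F q}.
  apply: filterS3 (dDH k) (dHF k) (ckerp_mulNi (ldF k) lF).1 => q -> -> ->.
  by [].
split.
- by move=> k; apply: filterS (mom k) => r [].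
- move=> k; apply/(in_L1locP ls3).
  apply: (clocint_ae ls3 (mdr k) (mdi k) _ (clocint_diag ls3 (ldN k) lF)).
  by apply: filterS (mom k) => r [_ _ ->].
- move=> k; have du := ckerp_diag_unique ls3 hF (ldH k) lH (ldF k) lF (dHF k).
  apply: filterS3 (mom k) du (ckerp_mulNi (ldF k) lF).2 => r [_ _ ->] e ->.
  by rewrite kmul_ckerp e.
- move=> k; split.
    (* A factorization of -i times the gradient of [D] in its first argument: the gradient of H
       times -i, and [G] itself, with inner variable in R^3. *)
    exists 3, (fun q => - 'i%C * dH k q), G; split.
    + by move=> K cK; have := in_L2_of_csqloc ls3 (csqloc_mulNi (ldH k)) cK.
    + move=> K cK; have mK : measurable ((setT : set 'rV[R]_3) `*` K).
        by have := ls_compact ls3 cK; exact: measurableX.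
      have [m1 m2 foo] := sG; split; [exact: measurable_funTS|exact: measurable_funTS|].
      apply: le_lt_trans foo; apply: ge0_subset_integral => //.
        apply/measurable_EFinP; under [X in measurable_fun _ X]eq_fun do rewrite sqr_normc.
        by apply: measurable_funD; exact: measurable_funX.
      by move=> q _; rewrite lee_fin sqr_ge0.
    + apply: filterS2 (dDH k) (ckerp_mulNi (ldH k) lH).1 => q -> <-.
      by congr cint; apply/funext => z; rewrite /H /adj /= conjcK.
  (* Any other factorization has the same product as -i (nabla F) and F, whose diagonal is the
     momentum density; by [ckerp_diag_unique] the diagonals agree. *)
  move=> m P Q [sP sQ PQ].
  have lP := csqloc_of_in_L2 ls3 sP; have lQ := csqloc_of_in_L2_swap ls3 sQ.
  have kPQ q : kmul (leb_rV m) setT P Q q =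
      ckerp (leb_rV m) P (fun q => (Q (q.2, q.1))^*%C) q.
    by congr cint; apply/funext => z; rewrite /= conjcK.
  have E : {ae (mu \x mu)%E, forall q,
      ckerp (leb_rV m) P (fun q => (Q (q.2, q.1))^*%C) q =
      ckerp (famm nu) (fun q => - 'i%C * dF k q) F q}.
    by apply: filterS2 PQ (dDF k) => q; rewrite -kPQ => <- <-.
  apply: filterS2 (mom k) (ckerp_diag_unique ls3 hF lP lQ (ldN k) lF E) => r [_ _ ->] <-.
  by rewrite kPQ.
Qed.
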